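(* Let $b\ge 2$, $\beta\ge 0$, $h\in\mathbb{R}$, and let $\tau\in\{\pm1\}^{\mathbb{T}^b}$ be a boundary condition. Suppose that at least one of the following holds: (i) $\tau$ is arbitrary, and either $\beta<\beta_1$ (with $h$ arbitrary), or $|h|>h_c(\beta)$ (with $\beta$ arbitrary); (ii) $\tau$ is the $(+)$-boundary condition, i.e. $\tau\equiv +1$, and $\beta,h$ are arbitrary. Then the logarithmic Sobolev constant of the Glauber dynamics for the Ising model on complete $b$-ary trees with boundary condition $\tau$ is $\Omega(1)$: there exists a constant $C>0$ such that $c_{\mathrm{sob}}(\mu_T^\tau)\ge 1/C$ for every finite complete subtree $T$ of $\mathbb{T}^b$.
   Context: Setting. Fix an integer $b\ge2$, $\beta\ge0$ (inverse temperature) and $h\in\mathbb{R}$ (external field). $\mathbb{T}^b$ is the infinite rooted tree in which every vertex has $b$ children. $T$ denotes a finite complete subtree: for some vertex $r$ (the root of $T$) and some $m\ge0$, $T$ consists of $r$ and all its descendants at distance at most $m$ from $r$; $n=|T|=(b^{m+1}-1)/(b-1)$. $\partial T$ is the set of children in $\mathbb{T}^b$ of the leaves of $T$ (so $|\partial T|=b^{m+1}$); only edges inside $T\cup\partial T$ are considered. For $A\subseteq T$, $\partial A$ is the set of vertices of $(T\cup\partial T)\setminus A$ adjacent to $A$, and $E(A\cup\partial A)$ is the set of edges with both endpoints in $A\cup\partial A$. A boundary condition is a configuration $\tau\in\{\pm1\}^{\mathbb{T}^b}$; $\Omega=\Omega_T^\tau$ is the set of $\sigma\in\{\pm1\}^{T\cup\partial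 T}$ agreeing with $\tau$ on $\partial T$. For $\eta\in\Omega$ and $A\subseteq T$, $\mu_A^\eta$ is the probability measure on $\Omega$ with $\mu_A^\eta(\sigma)\propto\exp[\beta(\sum_{xy\in E(A\cup\partial A)}\sigma_x\sigma_y+h\sum_{x\in A}\sigma_x)]$ if $\sigma$ agrees with $\eta$ outside $A$, and $\mu_A^\eta(\sigma)=0$ otherwise. $\mu=\mu_T^\tau$ is the case $A=T$. $\mu_A^\eta(f)$ is the expectation of $f:\Omega\to\mathbb{R}$, $\mathrm{Var}_A^\eta(f)=\mu_A^\eta(f^2)-\mu_A^\eta(f)^2$; viewed as functions of $\eta$ these are written $\mu_A(f),\mathrm{Var}_A(f)$. For $f\ge0$, $\mathrm{Ent}(f)=\mu(f\log f)-\mu(f)\log\mu(f)$. Log-Sobolev constant. The (heat-bath) Glauber dynamics has generator $(\mathcal{L}f)(\sigma)=\sum_{x\in T}\mu^\sigma_{\{x\}}(\sigma^x)[f(\sigma^x)-f(\sigma)]$, where $\sigma^x$ is $\sigma$ with the spin at $x$ flipped; its Dirichlet form is $\mathcal{D}(f)=\sum_{x\in T}\mu(\mathrm{Var}_{\{x\}}(f))$, and $c_{\mathrm{sob}}(\mu)=\inf_{f\ge0}\mathcal{D}(\sqrt f)/\mathrm{Ent}(f)$ over non-constant $f:\Omega\to[0,\infty)$. Critical values. $\beta_0=\frac12\log\frac{b+1}{b-1}$ and $\beta_1=\frac12\log\frac{\sqrt b+1}{\sqrt b-1}$. For $\beta>\beta_0$, $h_c(\beta)>0$ is the critical field such that the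 infinite-volume Ising Gibbs measure on $\mathbb{T}^b$ with parameters $(\beta,h)$ is non-unique when $|h|\le h_c(\beta)$ and unique when $|h|>h_c(\beta)$; for $\beta\le\beta_0$ (where the Gibbs measure is unique for all $h$) $h_c(\beta)=0$. *)

(* Defs.v *)
From HB Require Import structures.
From mathcomp Require Import all_boot all_order all_algebra finmap.
From mathcomp Require Import all_classical all_reals all_analysis.

Set Implicit Arguments.
Unset Strict Implicit.
Unset Printing Implicit Defensive.

Import Order.TTheory GRing.Theory Num.Theory.
Import numFieldNormedType.Exports.

Local Open Scope classical_set_scope.
Local Open Scope ring_scope.

(* A vertex of T^b is the word of child labels read from the vertex up to the
   root: the root is [::], the children of x are the words i :: x, and the
   parent of x <> [::] is behead x. *)
Notation vertex b := (seq 'I_b).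

(* Spins are booleans, true standing for +1 and false for -1. *)
Notation config b := (vertex b -> bool).

Definition spin (R : realType) (s : bool) : R := if s then 1 else -1.

(* The vertices outside A adjacent to A in T^b. For the root, behead [::] = [::]
   is not a neighbour, but it only occurs when [::] \in A and is then removed. *)
Definition nbrs (b : nat) (A : {fset vertex b}) : {fset vertex b} :=
  (([fset i :: x | i in 'I_b, x in A] `|` [fset behead x | x in A]) `\` A)%fset.

(* beta * (\sum_(xy in E(B)) s_x s_y + h \sum_(x in A) s_x), to be used with
   B = A U dA; each edge is listed once, from parent to child. *)
Definition energy (R : realType) (b : nat) (beta h : R)
    (A B : {fset vertex b}) (s : config b) : R :=
  beta * (\sum_(x <- B) \sum_(i < b | (i :: x) \in B)
             spin R (s x) * spin R (s (i :: x))
          + h * \sum_(x <- A) spin R (s x)).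

(* The configuration equal to xi on A and to eta off A. *)
Definition glue (b : nat) (A : {fset vertex b}) (xi : {ffun A -> bool})
    (eta : config b) : config b :=
  fun x => if insub x is Some u then xi u else eta x.

Section FiniteTree.
Variables (R : realType) (b : nat) (beta h : R).

Definition subtree (r : vertex b) (m : nat) : {fset vertex b} :=
  [fset (val s) ++ r | s in {: m.-bseq 'I_b}]%fset.

(* The children of the leaves. *)
Definition subtree_bd (r : vertex b) (m : nat) : {fset vertex b} :=
  [fset i :: ((val s) ++ r) | i in 'I_b, s in {: m.-tuple 'I_b}]%fset.

Variables (tau : config b) (r : vertex b) (m : nat).

Local Notation T := (subtree r m).

(* Omega_T^tau: a configuration on T U dT agreeing with tau on dT is given by
   its restriction to T, and is recovered as glue s tau. *)
Definition Omega : finType := {ffun T -> bool}.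

(* The boundary of A relative to T U dT: in particular the parent of r, when it
   exists, plays no role. *)
Definition bd (A : {fset vertex b}) : {fset vertex b} :=
  (nbrs A `&` (T `|` subtree_bd r m))%fset.

Definition weight (A : {fset vertex b}) (s : Omega) : R :=
  expR (energy beta h A (A `|` bd A)%fset (glue s tau)).

Definition agree_off (A : {fset vertex b}) (eta s : Omega) : bool :=
  [forall x : T, (val x \notin A) ==> (s x == eta x)].

Definition gibbs (A : {fset vertex b}) (eta s : Omega) : R :=
  if agree_off A eta s
  then weight A s / \sum_(s' : Omega | agree_off A eta s') weight A s'
  else 0.

Definition mean (A : {fset vertex b}) (f : Omega -> R) (eta : Omega) : R :=
  \sum_(s : Omega) gibbs A eta s * f s.

Definition local_var (A : {fset vertex b}) (f : Omega -> R) (eta : Omega) : R :=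
  mean A (fun s => f s ^+ 2) eta - mean A f eta ^+ 2.

(* Expectation under mu = mu_T^tau. For A = T the interior configuration passed
   to mean is irrelevant; we pass the restriction of tau to T. *)
Definition mu (f : Omega -> R) : R := mean T f [ffun x => tau (val x)].

(* ln 0 = 0, so that 0 log 0 = 0. *)
Definition entropy (f : Omega -> R) : R :=
  mu (fun s => f s * ln (f s)) - mu f * ln (mu f).

Definition dirichlet (f : Omega -> R) : R :=
  \sum_(x <- T) mu (local_var [fset x]%fset f).

Definition csob : R :=
  inf [set dirichlet (fun s => Num.sqrt (f s)) / entropy f |
       f in [set f : Omega -> R |
              (forall s, 0 <= f s) /\ (exists s s', f s != f s')]].

End FiniteTree.

Section InfiniteVolume.
Variables (R : realType) (b : nat) (beta h : R).

(* Cylinder events determined by one coordinate in D; <<s cylinders D >> is the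
   sigma-algebra generated by the spins in D. *)
Definition cylinders (D : set (vertex b)) : set (set (config b)) :=
  [set F | exists x s, D x /\ F = [set eta : config b | eta x = s]].

Definition configs := g_sigma_algebraType (cylinders setT).

Definition weight_inf (A : {fset vertex b}) (s : config b) : R :=
  expR (energy beta h A (A `|` nbrs A)%fset s).

(* mu_A^eta(F), on the whole tree T^b. *)
Definition gibbs_kernel (A : {fset vertex b}) (eta : config b)
    (F : set (config b)) : R :=
  (\sum_(xi : {ffun A -> bool}) weight_inf A (glue xi eta) * \1_F (glue xi eta))
  / \sum_(xi : {ffun A -> bool}) weight_inf A (glue xi eta).

(* DLR: for every finite A, mu_A^eta(F) is a version of the conditional
   probability of F given the spins off A. *)
Definition is_gibbs (P : probability configs R) : Prop :=
  forall (A : {fset vertex b}) (F G : set configs),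
    measurable F -> <<s cylinders (~` [set` A]) >> G ->
    P (F `&` G) = (\int[P]_(eta in G) (gibbs_kernel A eta F)%:E)%E.

(* Measures are compared on measurable sets only: a library measure is a
   function on all sets, with arbitrary values on non-measurable ones. *)
Definition gibbs_unique : Prop :=
  exists2 P : probability configs R, is_gibbs P &
    forall Q : probability configs R, is_gibbs Q ->
      forall F : set configs, measurable F -> P F = Q F.

End InfiniteVolume.

Definition beta0 (R : realType) (b : nat) : R :=
  2^-1 * ln ((b%:R + 1) / (b%:R - 1)).

Definition beta1 (R : realType) (b : nat) : R :=
  2^-1 * ln ((Num.sqrt b%:R + 1) / (Num.sqrt b%:R - 1)).

(* The threshold in |h| between non-uniqueness and uniqueness. The supremum is
   taken in the extended reals so that no junk value can arise. *)
Definition hcrit (R : realType) (b : nat) (beta : R) : \bar R :=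
  if beta <= beta0 R b then 0%E
  else ereal_sup [set `|h|%:E | h in [set h : R | ~ gibbs_unique b beta h]].

(* Main.v *)
(* Under the Ising measure the spins form a Markov chain down the tree, started
   from an exponential tilt; the effective field of a vertex is obtained by
   iterating z |-> beta h + b msgf(z) from the boundary. The entropy of f is a
   sum over the vertices x of the entropies, in the spin at x alone, of f
   averaged over what lies below x, so it is enough to bound this root entropy.

   Let lam be the factor b (1 - D ^ 2), where D is the Bhattacharyya coefficient
   of the two laws of a spin given its parent. When lam < 1 far from the
   boundary, the Hellinger distance between the laws of the spins at depth k for
   the two values of the root decays like lam ^ k: the posterior mean of the root
   spin given depth k has an exponentially small second moment, and concentration
   along the tree makes it sub-Gaussian with variance proxy o(1/k). By the Gibbs
   variational principle, the root entropy is then at most o(1/k) times the sum of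
   the entropies at depth <= k + 1, plus a constant times Dirichlet terms near the
   root. Each vertex lies below at most k + 2 vertices at distance <= k + 1, so
   summing over the tree absorbs the entropy terms.

   In terms of the effective field z of the child, 1 - D ^ 2 = tanh(beta) msgf'(z),
   and msgf' <= tanh(beta), so lam < 1 when beta < beta1. With the (+)-boundary the
   fields decrease to the largest fixed point z of the recursion, where
   b msgf'(z) <= 1; the extra factor tanh(beta) < 1 makes lam < 1 even at
   criticality. The same holds for every boundary condition when the fixed point
   is unique, which uniqueness of the Gibbs measure implies: distinct fixed points
   give distinct infinite-volume Gibbs measures, the Bethe Markov chains, realized
   on the binary digits of a coding of the points of [0, 1[. *)
From HB Require Import structures.
Require Import Defs.
From mathcomp Require Import all_boot all_order all_algebra finmap.
From mathcomp Require Import all_classical all_reals all_analysis.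
From mathcomp Require Import measurable_realfun ring lra zify.

Set Implicit Arguments.
Unset Strict Implicit.
Unset Printing Implicit Defensive.

Import Order.TTheory GRing.Theory Num.Theory.
Import numFieldNormedType.Exports.

Local Open Scope ring_scope.

(** * Entropy of finite measures *)

(** A small second moment of the posterior does not by itself give a variance proxy of order 1/k:
    the exponential moment must be controlled for parameters up to order k, where values of the
    posterior above a fixed threshold get weights exponential in k. Their probability must therefore
    decay faster than any prescribed exponential rate, while the Hellinger estimate supplies only
    the rate [lam].

    The rate is improved by doubling. Passing an edge multiplies a log-likelihood ratio by at most
    tanh(beta) < 1, so the ratio at a vertex exceeds a level only if one child has a ratio above a
    higher level, or two children have ratios that are not small. The children are independent given
    their parent, so the second event has squared probability. Starting from a level that is never
    exceeded, finitely many steps reach any positive level, at twice the original rate.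

    Kernels carry the height and the vertex as arguments, since an arbitrary boundary condition
    makes the chain inhomogeneous. *)

Section FiniteEntropy.
Variables (R : realType).

Lemma ln_le_sub1 (x : R) : 0 < x -> ln x <= x - 1.
Proof.
move=> x0; have := @expR_ge1Dx R (ln x).
by rewrite lnK ?posrE // addrC lerBrDr.
Qed.

(** This is [ln y <= y - 1] at [y = g * c / d / f]. With [c] and [d] the means of [f] and [g], the
    bracket on the right integrates to zero, which yields the Gibbs variational principle. *)
Lemma mul_ln_le (f g c d : R) : 0 <= f -> 0 <= g -> (0 < f -> 0 < g) ->
  0 < c -> 0 < d -> f * ln g + f * ln c - f * ln d <= f * ln f + (g * c / d - f).
Proof.
move=> f0 g0 fg c0 d0; case: (ltgtP 0 f) f0 => // [fp _|<- _]; last first.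
  rewrite !mul0r !addr0 subr0 add0r subr0.
  by apply: divr_ge0; [apply: mulr_ge0|] => //; apply: ltW.
have gp := fg fp.
have /ln_le_sub1 : 0 < g * c / d / f by rewrite !divr_gt0 ?mulr_gt0.
rewrite !ln_div ?posrE ?divr_gt0 ?mulr_gt0 // lnM ?posrE //.
rewrite -(ler_pM2l fp) => H.
have -> : g * c / d - f = f * (g * c / d / f - 1) by field; rewrite !gt_eqF.
by rewrite !mulrBr !mulrDr in H *; lra.
Qed.

Definition fmean (I : finType) (p f : I -> R) : R := \sum_i p i * f i.

Definition fent (I : finType) (p f : I -> R) : R :=
  fmean p (fun i => f i * ln (f i)) - fmean p f * ln (fmean p f).

Section Fixed.
Variables (I : finType) (p : I -> R).
Hypothesis p_gt0 : forall i, 0 < p i.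

Lemma fmean_ge0 f : (forall i, 0 <= f i) -> 0 <= fmean p f.
Proof. by move=> f0; apply: sumr_ge0 => i _; rewrite mulr_ge0 // ltW. Qed.

Lemma fmean_le f g : (forall i, f i <= g i) -> fmean p f <= fmean p g.
Proof. by move=> fg; apply: ler_sum => i _; rewrite ler_pM2l. Qed.

Lemma fmean_gt0 f i : (forall i, 0 <= f i) -> 0 < f i -> 0 < fmean p f.
Proof.
move=> f0 fi; rewrite /fmean (bigD1 i) //= ltr_pwDl ?mulr_gt0 //.
by apply: sumr_ge0 => j _; rewrite mulr_ge0 // ltW.
Qed.

Lemma fmean_eq0 f : (forall i, 0 <= f i) -> fmean p f = 0 -> forall i, f i = 0.
Proof.
move=> f0 m0 i; apply/eqP; rewrite eq_le f0 andbT leNgt; apply/negP => fi.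
by have := fmean_gt0 f0 fi; rewrite m0 ltxx.
Qed.

(* The Gibbs variational principle, with 0 log 0 = 0. *)
Lemma fent_var f g : (forall i, 0 <= f i) -> (forall i, 0 <= g i) ->
  (forall i, 0 < f i -> 0 < g i) ->
  fmean p (fun i => f i * ln (g i)) <= fent p f + fmean p f * ln (fmean p g).
Proof.
move=> f0 g0 fg; have [m0|m0] := eqVneq (fmean p f) 0.
  have fE := fmean_eq0 f0 m0.
  rewrite /fent m0 !mul0r subr0 addr0 le_eqVlt; apply/orP; left; apply/eqP.
  by apply: eq_bigr => i _; rewrite fE !mul0r.
have mf : 0 < fmean p f by rewrite lt_def m0 fmean_ge0.
have [i fi] : exists i, 0 < f i.
  apply/existsP; rewrite -[X in is_true X]negbK; apply/negP.
  rewrite negb_exists => /forallP H; move: m0; rewrite /fmean big1 ?eqxx // => i _.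
  by have := H i; rewrite -leNgt => fi; rewrite (@le_anti _ _ (f i) 0) ?mulr0 // fi f0.
have mg : 0 < fmean p g by apply: (fmean_gt0 g0 (fg _ fi)).
have := fmean_le (fun i => mul_ln_le (f0 i) (g0 i) (@fg i) mf mg).
rewrite /fent /fmean.
rewrite (eq_bigr (fun i => p i * (f i * ln (g i)) + (p i * f i) * (ln (fmean p f) - ln (fmean p
  g))));
  last by move=> j _; rewrite -/(fmean p f) -/(fmean p g); ring.
rewrite [X in _ <= X](eq_bigr (fun i => p i * (f i * ln (f i)) +
  ((p i * g i) * (fmean p f / fmean p g) - (p i * f i)))); last first.
  by move=> j _; rewrite -/(fmean p f) -/(fmean p g); field; rewrite gt_eqF.
rewrite !big_split /= -!mulr_suml sumrN -/(fmean p f) -/(fmean p g).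
have -> : fmean p g * (fmean p f / fmean p g) = fmean p f by field; rewrite gt_eqF.
by rewrite subrr addr0 mulrBr => H; lra.
Qed.

(** By [fent_var], entropy is a supremum of functionals linear in [f]: each [f j] is tested against
    the mixture itself. *)
Lemma fent_convex (J : finType) (w : J -> R) (f : J -> I -> R) :
  (forall j, 0 <= w j) -> (forall j i, 0 <= f j i) ->
  fent p (fun i => \sum_j w j * f j i) <= \sum_j w j * fent p (f j).
Proof.
move=> w0 f0; set F := fun i => _.
have F0 i : 0 <= F i by apply: sumr_ge0 => j _; rewrite mulr_ge0.
have mF : fmean p F = \sum_j w j * fmean p (f j).
  rewrite /fmean; under eq_bigr do rewrite mulr_sumr.
  rewrite exchange_big; apply: eq_bigr => j _; rewrite mulr_sumr.
  by apply: eq_bigr => i _; ring.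
rewrite {1}/fent.
have -> : fmean p (fun i => F i * ln (F i)) =
    \sum_j w j * fmean p (fun i => f j i * ln (F i)).
  rewrite /fmean; under eq_bigr do rewrite /F mulr_suml mulr_sumr.
  rewrite exchange_big; apply: eq_bigr => j _; rewrite mulr_sumr.
  by apply: eq_bigr => i _; ring.
rewrite {1}mF mulr_suml -sumrB; apply: ler_sum => j _.
rewrite -mulrA -mulrBr; have [->|wj] := eqVneq (w j) 0; first by rewrite !mul0r.
have wp : 0 < w j by rewrite lt_def wj w0.
rewrite ler_pM2l // lerBlDr; apply: fent_var => // i fi.
rewrite /F (bigD1 j) //= ltr_pwDl ?mulr_gt0 //.
by apply: sumr_ge0 => k _; rewrite mulr_ge0.
Qed.

Lemma fent_ge0 f : \sum_i p i = 1 -> (forall i, 0 <= f i) -> 0 <= fent p f.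
Proof.
move=> p1 f0; have := @fent_var f (fun=> 1) f0 (fun=> ler01) (fun _ _ => ltr01).
have -> : fmean p (fun=> 1) = 1 by rewrite /fmean; under eq_bigr do rewrite mulr1.
rewrite ln1 mulr0 addr0; congr (_ <= _).
by apply: big1 => i _; rewrite mulr0 mulr0.
Qed.

End Fixed.

(** Entropy is at most variance over mean, from [ln y <= y - 1] at [y = f a / fmean p f]. On two
    points the variance is a multiple of the squared difference of the values, so a root entropy is
    controlled by that difference. *)
Lemma fent_bool_le (p f : bool -> R) : (forall a, 0 < p a) ->
  p true + p false = 1 -> (forall a, 0 <= f a) -> 0 < fmean p f ->
  fent p f <= p true * p false * (f true - f false) ^+ 2 / fmean p f.
Proof.
move=> p0 p1 f0 m0.
have E1 h : fmean p h = p true * h true + p false * h false by rewrite /fmean big_bool.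
have key a : p a * (f a * ln (f a)) <= p a * (f a * ln (fmean p f) + f a * (f a / fmean p f - 1)).
  rewrite ler_pM2l //; case: (ltgtP 0 (f a)) (f0 a) => // [fa _|<-]; last by rewrite !mul0r addr0.
  have /ln_le_sub1 : 0 < f a / fmean p f by rewrite divr_gt0.
  rewrite ln_div ?posrE // -(ler_pM2l fa) => H; rewrite -mulrDr ler_pM2l //.
  by move: H; rewrite ler_pM2l // => H; lra.
rewrite /fent lerBlDr {1}E1; apply: le_trans (lerD (key true) (key false)) _.
set m := fmean p f in m0 *.
have mE : m = p true * f true + p false * f false by rewrite /m E1.
rewrite le_eqVlt; apply/orP; left; apply/eqP.
have pf : p false = 1 - p true by rewrite -p1; ring.
have mn : m != 0 by rewrite gt_eqF.
transitivity ((p true * f true + p false * f false) * ln m +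
    (p true * f true * (f true - m) + p false * f false * (f false - m)) / m).
  by field.
rewrite -mE addrC; congr (_ / _ + _); rewrite mE pf; ring.
Qed.

End FiniteEntropy.

(** * Product measures and the tensorization of entropy *)

Section ProductMeasure.
Variables (R : realType) (I X : finType) (nu : I -> X -> R).
Hypothesis nu_gt0 : forall i x, 0 < nu i x.
Hypothesis nu_sum1 : forall i, \sum_x nu i x = 1.

Definition upd (d : {ffun I -> X}) (i : I) (x : X) : {ffun I -> X} :=
  [ffun j => if j == i then x else d j].

Lemma upd_upd d i x y : upd (upd d i x) i y = upd d i y.
Proof. by apply/ffunP => j; rewrite !ffunE; case: eqP. Qed.

Lemma updC d i j x y : i != j -> upd (upd d i x) j y = upd (upd d j y) i x.
Proof.
move=> ij; apply/ffunP => k; rewrite !ffunE.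
by case: (eqVneq k j) => [->|//]; rewrite eq_sym (negbTE ij).
Qed.

Lemma upd_id d i : upd d i (d i) = d.
Proof. by apply/ffunP => j; rewrite !ffunE; case: eqP => [->|]. Qed.

Definition pnu (d : {ffun I -> X}) : R := \prod_i nu i (d i).

Definition pmean (f : {ffun I -> X} -> R) : R := \sum_d pnu d * f d.

Lemma pnu_gt0 d : 0 < pnu d.
Proof. by apply: prodr_gt0 => i _. Qed.

Lemma pnu_sum1 : \sum_d pnu d = 1.
Proof. by rewrite /pnu -bigA_distr_bigA big1. Qed.

Lemma pmean_le f g : (forall d, f d <= g d) -> pmean f <= pmean g.
Proof. by move=> fg; apply: ler_sum => d _; rewrite ler_pM2l ?pnu_gt0. Qed.

Lemma pmean_ge0 f : (forall d, 0 <= f d) -> 0 <= pmean f.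
Proof. by move=> f0; apply: sumr_ge0 => d _; rewrite mulr_ge0 // ltW ?pnu_gt0. Qed.

Lemma pmean_cst c : pmean (fun=> c) = c.
Proof. by rewrite /pmean -mulr_suml pnu_sum1 mul1r. Qed.

Lemma pmeanD f g : pmean (fun d => f d + g d) = pmean f + pmean g.
Proof. by rewrite /pmean -big_split; apply: eq_bigr => d _; rewrite mulrDr. Qed.

Lemma pmeanZ c f : pmean (fun d => c * f d) = c * pmean f.
Proof. by rewrite /pmean mulr_sumr; apply: eq_bigr => d _; ring. Qed.

Lemma pmean_sum (J : Type) (r : seq J) (P : pred J) (f : J -> {ffun I -> X} -> R) :
  pmean (fun d => \sum_(j <- r | P j) f j d) = \sum_(j <- r | P j) pmean (f j).
Proof.
by rewrite /pmean; under eq_bigr do rewrite mulr_sumr; rewrite exchange_big.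
Qed.

Lemma pnu_upd d i x : pnu (upd d i x) * nu i (d i) = pnu d * nu i x.
Proof.
rewrite /pnu (bigD1 i) //= [in RHS](bigD1 i) //= !ffunE eqxx.
rewrite (eq_bigr (fun j => nu j (d j))); first by ring.
by move=> j ji; rewrite ffunE (negbTE ji).
Qed.

(* (d, x) |-> (upd d i x, d i) is an involution preserving pnu d * nu i x. *)
Lemma pmean_resample i f :
  pmean (fun d => \sum_x nu i x * f (upd d i x)) = pmean f.
Proof.
pose T (p : {ffun I -> X} * X) := (upd p.1 i p.2, p.1 i).
have TK : involutive T.
  by move=> [d x]; rewrite /T /= upd_upd upd_id ffunE eqxx.
transitivity (\sum_(p : {ffun I -> X} * X) pnu p.1 * nu i p.2 * f (T p).1).
  rewrite -(pair_bigA _ (fun d x => pnu d * nu i x * f (upd d i x))) /=.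
  by apply: eq_bigr => d _; rewrite mulr_sumr; apply: eq_bigr => x _; ring.
rewrite (reindex_inj (inv_inj TK)) /=.
rewrite (eq_bigr (fun p : {ffun I -> X} * X => pnu p.1 * nu i p.2 * f p.1)); last first.
  by case=> d x _; rewrite /T /= upd_upd upd_id pnu_upd.
rewrite -(pair_bigA _ (fun d x => pnu d * nu i x * f d)) /=.
apply: eq_bigr => d _; rewrite -mulr_suml; congr (_ * _).
by rewrite -mulr_sumr nu_sum1 mulr1.
Qed.

Definition avg (i : I) (f : {ffun I -> X} -> R) (d : {ffun I -> X}) : R :=
  \sum_x nu i x * f (upd d i x).

Definition avgs (s : seq I) (f : {ffun I -> X} -> R) : {ffun I -> X} -> R :=
  foldr avg f s.

Lemma pmean_avgs s f : pmean (avgs s f) = pmean f.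
Proof. by elim: s => //= i s IH; rewrite pmean_resample. Qed.

Lemma avg_ge0 i f : (forall d, 0 <= f d) -> forall d, 0 <= avg i f d.
Proof. by move=> f0 d; apply: sumr_ge0 => x _; rewrite mulr_ge0 // ltW. Qed.

Lemma avgs_ge0 s f : (forall d, 0 <= f d) -> forall d, 0 <= avgs s f d.
Proof. by move=> f0; elim: s => //= i s IH; apply: avg_ge0. Qed.

Lemma avgs_const f d : avgs (enum I) f d = pmean f.
Proof.
pose indep (h : {ffun I -> X} -> R) i := forall d x, h (upd d i x) = h d.
have indep_avg j h i : i = j \/ indep h i -> indep (avg j h) i.
  case=> [-> d' x|ih d' x]; first by apply: eq_bigr => y _; rewrite upd_upd.
  apply: eq_bigr => y _; have [->|ij] := eqVneq i j; first by rewrite upd_upd.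
  by rewrite updC // ih.
have indep_avgs s i : i \in s -> indep (avgs s f) i.
  elim: s => //= j s IH; rewrite inE => /orP[/eqP->|/IH H].
    by apply: indep_avg; left.
  by apply: indep_avg; right.
set h := avgs _ f.
have const d' : h d' = h d.
  (* [mix s] takes the coordinates in [s] from [d'] and the others from [d]; [h] is blind to each
     single change. *)
  pose mix s := foldr (fun i acc => upd acc i (d' i)) d s.
  have hm s : h (mix s) = h d.
    elim: s => //= i s <-; apply: indep_avgs; exact: mem_enum.
  rewrite -(hm (enum I)); congr h; apply/ffunP => i.
  have : i \in enum I by rewrite mem_enum.
  elim: (enum I) => //= j s IH; rewrite inE ffunE.
  by case: eqP => [->//|_]; exact: IH.
rewrite -(pmean_avgs (enum I) f) -/h -[LHS]pmean_cst.
by apply: eq_bigr => d' _; rewrite const.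
Qed.

Section Chain.
Variables (S : I -> (X -> R) -> R) (same : X -> X -> Prop).

(** On the tree, [S i] becomes the sum of the entropies in the first levels of the subtree [i]. Such
    a partial entropy obeys the variational principle only against functions of these levels; [same]
    relates points that such functions cannot distinguish. *)
Definition compat (g : X -> R) := forall x y, same x y -> g x = g y.

Hypothesis S_convex : forall i (J : finType) (w : J -> R) (f : J -> X -> R),
  (forall j, 0 <= w j) -> (forall j x, 0 <= f j x) ->
  S i (fun x => \sum_j w j * f j x) <= \sum_j w j * S i (f j).
Hypothesis S_var : forall i f g, compat g -> (forall x, 0 <= f x) ->
  (forall x, 0 <= g x) -> (forall x, 0 < f x -> 0 < g x) ->
  fmean (nu i) (fun x => f x * ln (g x)) <=
  S i f + fmean (nu i) f * ln (fmean (nu i) g).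

(** Jensen's inequality for [S i], one averaged coordinate at a time; [i \notin s] lets the update
    at [i] commute with the averages. *)
Lemma avgs_S_convex i s f d : i \notin s -> (forall d, 0 <= f d) ->
  S i (fun x => avgs s f (upd d i x)) <= avgs s (fun d => S i (fun x => f (upd d i x))) d.
Proof.
move=> + f0; elim: s d => //= j s IH d; rewrite inE negb_or => /andP[ij is_].
rewrite /avg.
have -> : (fun x => \sum_y nu j y * avgs s f (upd (upd d i x) j y)) =
    (fun x => \sum_y nu j y * avgs s f (upd (upd d j y) i x)).
  by apply/funext => x; apply: eq_bigr => y _; rewrite updC.
apply: le_trans (S_convex _ _ _) _ => [y|y x|]; first exact: ltW.
  exact: avgs_ge0.
by apply: ler_sum => y _; rewrite ler_pM2l // IH.
Qed.

(* Integrate out one coordinate after the other. *)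
Lemma product_chain f g :
  (forall d i, compat (fun x => g (upd d i x))) ->
  (forall d, 0 <= f d) -> (forall d, 0 <= g d) -> (forall d, 0 < f d -> 0 < g d) ->
  pmean (fun d => f d * ln (g d)) <=
  pmean (fun d => \sum_i S i (fun x => f (upd d i x))) + pmean f * ln (pmean g).
Proof.
move=> cg f0 g0 fg.
have key s : uniq s -> (forall d i, compat (fun x => avgs s g (upd d i x))) /\
   (forall d, 0 < avgs s f d -> 0 < avgs s g d) /\
   pmean (fun d => f d * ln (g d)) <=
   pmean (fun d => \sum_(i <- s) S i (fun x => f (upd d i x))) +
   pmean (fun d => avgs s f d * ln (avgs s g d)).
  elim: s => [_|i s IH /= /andP[is_ us]].
    split=> //; split=> //; rewrite /= -pmeanD; apply: pmean_le => d.
    by rewrite big_nil add0r.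
  have [cs [ss Hs]] := IH us; split; [|split].
  - move=> d j x x' xx'; apply: eq_bigr => y _; congr (_ * _).
    have [->|ij] := eqVneq i j; first by rewrite !upd_upd.
    by rewrite !(@updC _ j i) 1?eq_sym //; apply: cs.
  - move=> d; rewrite {1}/avg => H.
    have [x fx] : exists x, 0 < avgs s f (upd d i x).
      apply/existsP; rewrite -[X in is_true X]negbK; apply/negP.
      rewrite negb_exists => /forallP H'; move: H; rewrite big1 ?ltxx // => x _.
      have := H' x; rewrite -leNgt => fx.
      by rewrite (@le_anti _ _ (avgs s f (upd d i x)) 0) ?mulr0 // fx avgs_ge0.
    by apply: (@fmean_gt0 _ _ (nu i) _ (fun y => avgs s g (upd d i y)) x) => // [y|]; [exact:
      avgs_ge0|exact: ss].
  apply: le_trans Hs _.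
  rewrite (_ : pmean (fun d => \sum_(j <- i :: s) _) =
    pmean (fun d => S i (fun x => f (upd d i x))) +
    pmean (fun d => \sum_(j <- s) S j (fun x => f (upd d j x)))); last first.
    by rewrite -pmeanD; apply: eq_bigr => d _; rewrite big_cons.
  rewrite [X in _ <= X + _]addrC -addrA lerD2l.
  (* Averaging over [s] and resampling [i] leave the mean unchanged; the comparison then becomes
     pointwise in [d], by [S_var] followed by Jensen. *)
  rewrite -(pmean_avgs s (fun d => S i _)) -pmeanD -(pmean_resample i).
  apply: pmean_le => d.
  apply: le_trans (@S_var i (fun x => avgs s f (upd d i x))
    (fun x => avgs s g (upd d i x)) (cs d i) _ _ _) _ => [x|x|x|].
  - exact: avgs_ge0.
  - exact: avgs_ge0.
  - exact: ss.
  by rewrite lerD2r avgs_S_convex.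
have [_ [_ H]] := key _ (enum_uniq I).
apply: le_trans H _; rewrite lerD //.
  by apply: pmean_le => d; rewrite big_enum.
rewrite (_ : (fun d => _) = fun=> pmean f * ln (pmean g)) ?pmean_cst //.
by apply/funext => d; rewrite !avgs_const.
Qed.

End Chain.
End ProductMeasure.

(** * Markov chains on trees and the chain rule for entropy *)

(** [conf b 0] is the empty tree, so a vertex of height [m], with [m] levels below it, is the root
    of a [conf b m.+1]. This explains the shift between the index of [conf] and that of the kernel
    [pk] below. *)
Fixpoint conf (b m : nat) : finType :=
  if m is m'.+1 then (bool * {ffun 'I_b -> conf b m'})%type : finType
  else unit : finType.

Section TreeChain.
Variables (R : realType) (b : nat).
Variable pk : nat -> seq 'I_b -> option bool -> bool -> R.
Hypothesis pk_gt0 : forall m x u a, 0 < pk m x u a.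
Hypothesis pk_sum1 : forall m x u, pk m x u true + pk m x u false = 1.

(** Here [u] is the spin of the parent of [x], with [None] when the parent is ignored, as at the
    root of the finite tree. *)
Fixpoint nu (m : nat) : seq 'I_b -> option bool -> conf b m -> R :=
  match m with
  | 0 => fun _ _ _ => 1
  | m'.+1 => fun x u c => pk m' x u c.1 * pnu (fun i => nu (i :: x) (Some c.1)) c.2
  end.

Definition nuc (m : nat) (x : seq 'I_b) (a : bool) (i : 'I_b) : conf b m -> R :=
  nu (i :: x) (Some a).

Definition Ex (m : nat) (x : seq 'I_b) (u : option bool) (f : conf b m -> R) : R :=
  fmean (nu x u) f.

Lemma nu_gt0 m x u (c : conf b m) : 0 < nu x u c.
Proof.
elim: m x u c => [|m IH] x u c //=; rewrite mulr_gt0 //.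
by apply: pnu_gt0.
Qed.

Lemma sum_confS m (F : conf b m.+1 -> R) : \sum_c F c = \sum_a \sum_d F (a, d).
Proof. by rewrite pair_bigA; apply: eq_bigr => -[]. Qed.

Lemma ExS m x u (f : conf b m.+1 -> R) :
  Ex x u f = fmean (pk m x u) (fun a => pmean (nuc x a) (fun d => f (a, d))).
Proof.
rewrite /Ex /fmean sum_confS; apply: eq_bigr => a _.
by rewrite mulr_sumr; apply: eq_bigr => d _; rewrite mulrA.
Qed.

Lemma nu_sum1 m x u : \sum_(c : conf b m) nu x u c = 1.
Proof.
elim: m x u => [|m IH] x u; first by rewrite (big_pred1 tt) // => -[].
rewrite sum_confS (eq_bigr (pk m x u)) => [|a _]; first by rewrite big_bool; exact: pk_sum1.
by rewrite /= -mulr_sumr pnu_sum1 ?mulr1.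
Qed.

Lemma nuc_gt0 m x a i (c : conf b m) : 0 < nuc x a i c.
Proof. exact: nu_gt0. Qed.

Lemma nuc_sum1 m x a i : \sum_(c : conf b m) nuc x a i c = 1.
Proof. exact: nu_sum1. Qed.

Lemma Ex_ge0 m x u (f : conf b m -> R) : (forall c, 0 <= f c) -> 0 <= Ex x u f.
Proof. by move=> f0; apply: fmean_ge0 => // c; apply: nu_gt0. Qed.

Lemma Ex_le m x u (f g : conf b m -> R) : (forall c, f c <= g c) -> Ex x u f <= Ex x u g.
Proof. by move=> f0; apply: fmean_le => // c; apply: nu_gt0. Qed.

Definition functional := forall m, seq 'I_b -> option bool -> (conf b m -> R) -> R.

(* The average over the configurations off the subtrees rooted at the children
   of the root, summed over these children. *)
Definition lift (Phi : functional) : functional := fun m =>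
  match m return seq 'I_b -> option bool -> (conf b m -> R) -> R with
  | 0 => fun _ _ _ => 0
  | m'.+1 => fun x u f => fmean (pk m' x u) (fun a => pmean (nuc x a) (fun d =>
      \sum_i Phi m' (i :: x) (Some a) (fun e => f (a, upd d i e))))
  end.

Fixpoint tot (k : nat) (Phi : functional) : functional :=
  if k is k'.+1 then fun m x u f => Phi m x u f + lift (tot k' Phi) x u f
  else fun _ _ _ _ => 0.

Fixpoint all_tot (Phi : functional) (m : nat) :
    seq 'I_b -> option bool -> (conf b m -> R) -> R :=
  match m return seq 'I_b -> option bool -> (conf b m -> R) -> R with
  | 0 => fun x u f => Phi 0%N x u f
  | m'.+1 => fun x u f => Phi m'.+1 x u f +
     fmean (pk m' x u) (fun a => pmean (nuc x a) (fun d =>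
      \sum_i all_tot Phi (i :: x) (Some a) (fun e => f (a, upd d i e))))
  end.

Lemma all_totE Phi m x u f : all_tot Phi x u f = Phi m x u f + lift (all_tot Phi) x u f.
Proof. by case: m f => [|m] f //=; rewrite addr0. Qed.

Definition nonneg (Phi : functional) :=
  forall m x u (f : conf b m -> R), (forall c, 0 <= f c) -> 0 <= Phi m x u f.

Definition dominated (Phi Psi : functional) :=
  forall m x u (f : conf b m -> R), (forall c, 0 <= f c) -> Phi m x u f <= Psi m x u f.

Definition convex_functional (Phi : functional) :=
  forall m x u (J : finType) (w : J -> R) (f : J -> conf b m -> R),
  (forall j, 0 <= w j) -> (forall j c, 0 <= f j c) ->
  Phi m x u (fun c => \sum_j w j * f j c) <= \sum_j w j * Phi m x u (f j).

Lemma lift_le Phi Psi : dominated Phi Psi -> dominated (lift Phi) (lift Psi).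
Proof.
move=> le [|m] x u f f0 //=; apply: fmean_le => // a.
by apply: pmean_le => [i c|d]; [exact: nuc_gt0|apply: ler_sum => i _; exact: le].
Qed.

Lemma lift_nonneg Phi : nonneg Phi -> nonneg (lift Phi).
Proof.
move=> le [|m] x u f f0 //=; apply: fmean_ge0 => // a.
by apply: pmean_ge0 => [i c|d]; [exact: nuc_gt0|apply: sumr_ge0 => i _; exact: le].
Qed.

Lemma tot_nonneg k Phi : nonneg Phi -> nonneg (tot k Phi).
Proof.
move=> P0; elim: k => [|k IH] m x u f f0 //=.
by rewrite addr_ge0 ?P0 // lift_nonneg.
Qed.

Lemma all_tot_nonneg Phi : nonneg Phi -> nonneg (all_tot Phi).
Proof.
move=> P0; elim=> [|m IH] x u f f0; first exact: P0.
rewrite /= addr_ge0 ?P0 // fmean_ge0 // => a.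
by apply: pmean_ge0 => [i c|d]; [exact: nuc_gt0|apply: sumr_ge0 => i _; exact: IH].
Qed.

Lemma tot_le_all k Phi : nonneg Phi -> dominated (tot k Phi) (all_tot Phi).
Proof.
move=> P0; elim: k => [|k IH] m x u f f0 /=; first exact: all_tot_nonneg.
by rewrite all_totE lerD2l lift_le.
Qed.

Lemma all_tot_le Phi Psi : dominated Phi Psi -> dominated (all_tot Phi) (all_tot Psi).
Proof.
move=> le; elim=> [|m IH] x u f f0; first exact: le.
rewrite /= lerD ?le //; apply: fmean_le => // a.
by apply: pmean_le => [i c|d]; [exact: nuc_gt0|apply: ler_sum => i _; exact: IH].
Qed.

Lemma all_totD Phi Psi m x u f :
  all_tot (fun m x u f => Phi m x u f + Psi m x u f) x u f =
  all_tot Phi x u f + @all_tot Psi m x u f.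
Proof.
elim: m x u f => [|m IH] x u f //=; rewrite [in RHS]addrACA; congr (_ + _).
rewrite -big_split /=; apply: eq_bigr => a _; rewrite -mulrDr -pmeanD; congr (_ * _).
apply: eq_bigr => d _; congr (_ * _); rewrite -big_split /=.
by apply: eq_bigr => i _; exact: IH.
Qed.

Lemma all_totZ r Phi m x u f :
  all_tot (fun m x u f => r * Phi m x u f) x u f = r * @all_tot Phi m x u f.
Proof.
elim: m x u f => [|m IH] x u f //=; rewrite mulrDr; congr (_ + _).
rewrite /fmean mulr_sumr; apply: eq_bigr => a _; rewrite /= mulrCA -[in RHS]pmeanZ; congr (_ * _).
apply: eq_bigr => d _; congr (_ * _); rewrite mulr_sumr.
by apply: eq_bigr => i _; exact: IH.
Qed.

(** Every vertex other than the root is the child of exactly one vertex. *)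
Lemma all_tot_lift Phi m x u f : all_tot (lift Phi) x u f = @lift (all_tot Phi) m x u f.
Proof.
elim: m x u f => [|m IH] x u f //=.
rewrite -big_split /=; apply: eq_bigr => a _; rewrite -mulrDr -pmeanD; congr (_ * _).
apply: eq_bigr => d _; congr (_ * _); rewrite -big_split /=.
by apply: eq_bigr => i _; rewrite IH -all_totE.
Qed.

(* Every vertex is at depth < k below at most k vertices. *)
Lemma all_tot_tot k Phi : nonneg Phi ->
  dominated (all_tot (tot k Phi)) (fun m x u f => k%:R * all_tot Phi x u f).
Proof.
move=> P0; elim: k => [|k IH] m x u f f0.
  suff -> : all_tot (tot 0 Phi) x u f = 0 by rewrite mul0r.
  elim: m x u f {f0} => [|m IH] x u f //=.
  rewrite add0r /fmean big1 // => a _; rewrite /pmean big1 ?mulr0 // => d _.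
  by rewrite big1 ?mulr0 // => i _; exact: IH.
rewrite /= all_totD all_tot_lift -natr1 mulrDl mul1r addrC lerD2r.
apply: le_trans (IH _ _ _ _ f0); rewrite [leRHS]all_totE lerDr.
exact: tot_nonneg.
Qed.

Lemma lift_convex Phi : convex_functional Phi -> convex_functional (lift Phi).
Proof.
move=> cv [|m] x u J w f w0 f0 /=.
  by rewrite big1 // => j _; rewrite mulr0.
rewrite /fmean; under [leRHS]eq_bigr do rewrite mulr_sumr.
rewrite exchange_big; apply: ler_sum => a _ /=.
under [leRHS]eq_bigr do rewrite mulrCA.
rewrite -mulr_sumr ler_pM2l // /pmean.
under [leRHS]eq_bigr do rewrite mulr_sumr.
rewrite exchange_big; apply: ler_sum => d _ /=.
under [leRHS]eq_bigr do rewrite mulrCA.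
rewrite -mulr_sumr ler_pM2l; last by apply: pnu_gt0 => *; exact: nuc_gt0.
under [leRHS]eq_bigr do rewrite mulr_sumr.
rewrite exchange_big; apply: ler_sum => i _ /=.
exact: cv.
Qed.

Definition root_ent : functional := fun m =>
  match m return seq 'I_b -> option bool -> (conf b m -> R) -> R with
  | 0 => fun _ _ _ => 0
  | m'.+1 => fun x u f =>
      fent (pk m' x u) (fun a => pmean (nuc x a) (fun d => f (a, d)))
  end.

Lemma root_ent_nonneg : nonneg root_ent.
Proof.
move=> [|m] x u f f0 //=; apply: fent_ge0 => // [|a].
  by rewrite big_bool; exact: pk_sum1.
by apply: pmean_ge0 => // *; exact: nuc_gt0.
Qed.

Lemma root_ent_convex : convex_functional root_ent.
Proof.
move=> [|m] x u J w f w0 f0 /=; first by rewrite big1 // => j _; rewrite mulr0.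
rewrite [X in fent _ X](_ : _ =
  (fun a => \sum_j w j * pmean (nuc x a) (fun d => f j (a, d)))).
  apply: fent_convex => // j a.
  by apply: pmean_ge0 => // *; exact: nuc_gt0.
apply/funext => a; rewrite pmean_sum; apply: eq_bigr => j _; exact: pmeanZ.
Qed.

Lemma tot_convex k Phi : convex_functional Phi -> convex_functional (tot k Phi).
Proof.
move=> cv; elim: k => [|k IH] m x u J w f w0 f0 /=.
  by rewrite big1 // => j _; rewrite mulr0.
under [leRHS]eq_bigr do rewrite mulrDr.
by rewrite big_split lerD ?cv //; apply: lift_convex.
Qed.

Fixpoint same_top (k m : nat) : conf b m -> conf b m -> Prop :=
  match k, m return conf b m -> conf b m -> Prop with
  | k'.+1, m'.+1 => fun c d => c.1 = d.1 /\ forall i, same_top k' (c.2 i) (d.2 i)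
  | _, _ => fun _ _ => True
  end.

Lemma same_top_refl k m (c : conf b m) : same_top k c c.
Proof. by elim: k m c => [|k IH] [|m] c //=; split=> // i; exact: IH. Qed.

(** A test function that sees only the first [k] levels pays only for the entropies at depth less
    than [k]. Given the root spin the subtrees are independent, and [product_chain] applies with the
    induction hypothesis; the root spin is then treated by [fent_var]. For [k = m] and [g = f] this
    bounds the whole entropy by the sum over all vertices. *)
Lemma chain_rule k m x u (f g : conf b m -> R) :
  (forall c d, same_top k c d -> g c = g d) ->
  (forall c, 0 <= f c) -> (forall c, 0 <= g c) -> (forall c, 0 < f c -> 0 < g c) ->
  Ex x u (fun c => f c * ln (g c)) <= tot k root_ent x u f + Ex x u f * ln (Ex x u g).
Proof.
have const m' x' u' (f' g' : conf b m' -> R) : (forall c d, g' c = g' d) ->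
    Ex x' u' (fun c => f' c * ln (g' c)) = Ex x' u' f' * ln (Ex x' u' g').
  move=> gc; rewrite /Ex /fmean mulr_suml; apply: eq_bigr => c _.
  rewrite mulrA; congr (_ * ln _).
  rewrite (eq_bigr (fun d => nu x' u' d * g' c)) => [|d _]; last by rewrite (gc d c).
  by rewrite -mulr_suml nu_sum1 mul1r.
elim: k m x u f g => [|k IH] [|m] x u f g gk f0 g0 fg /=.
- by rewrite add0r const // => c d; exact: gk.
- by rewrite add0r const // => c d; exact: gk.
- by rewrite !add0r const // => c d; exact: gk.
set F := fun a => pmean (nuc x a) (fun d => f (a, d)).
pose G a := pmean (nuc x a) (fun d => g (a, d)).
have F0 a : 0 <= F a by apply: pmean_ge0 => // *; exact: nuc_gt0.
have G0 a : 0 <= G a by apply: pmean_ge0 => // *; exact: nuc_gt0.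
rewrite ExS.
apply: le_trans (_ : fmean (pk m x u) (fun a => pmean (nuc x a) (fun d =>
   \sum_i tot k root_ent (i :: x) (Some a) (fun e => f (a, upd d i e))) + F a * ln (G a)) <= _).
  apply: fmean_le => // a.
  apply: (@product_chain _ _ _ _ (@nuc_gt0 _ _ _) (@nuc_sum1 _ _ _)
    (fun i => tot k root_ent (i :: x) (Some a)) (@same_top k m) _ _
    (fun d => f (a, d)) (fun d => g (a, d))) => //.
  - by move=> i J w h w0 h0; apply: tot_convex => //; exact: root_ent_convex.
  - by move=> i h1 h2 c2 h10 h20 h12; exact: IH.
  - move=> d i e e' ee'; apply: gk => /=; split=> // j; rewrite !ffunE.
    by case: eqP => // _; exact: same_top_refl.
  - by move=> d; exact: fg.
rewrite (_ : fmean _ _ = lift (tot k root_ent) x u f +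
    fmean (pk m x u) (fun a => F a * ln (G a))); last first.
  by rewrite /fmean -big_split /=; apply: eq_bigr => a _; rewrite -mulrDr.
rewrite [X in _ <= X + _]addrC -addrA lerD2l !ExS.
apply: fent_var => // a Fa; rewrite /G.
have [d fd] : exists d, 0 < f (a, d).
  apply/existsP; rewrite -[X in is_true X]negbK; apply/negP.
  rewrite negb_exists => /forallP H'; move: Fa; rewrite /F /pmean big1 ?ltxx // => d _.
  by have := H' d; rewrite -leNgt => fd; rewrite (@le_anti _ _ (f (a, d)) 0) ?mulr0 // fd f0.
apply: (@fmean_gt0 _ _ (pnu (nuc x a)) _ (fun d => g (a, d)) d) => // [e|].
  by apply: pnu_gt0 => *; exact: nuc_gt0.
exact: fg.
Qed.

End TreeChain.

(** * Push-forwards, and independence under product measures *)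

Section PushForward.
Variables (R : realType).

Definition push (X Y : finType) (rho : X -> R) (pi : X -> Y) (y : Y) : R :=
  \sum_(x | pi x == y) rho x.

Lemma sum_push (X Y : finType) (rho : X -> R) (pi : X -> Y) (phi : Y -> R) :
  \sum_x rho x * phi (pi x) = \sum_y push rho pi y * phi y.
Proof.
rewrite (partition_big pi xpredT) //=; apply: eq_bigr => y _.
by rewrite mulr_suml; apply: eq_bigr => x /eqP ->.
Qed.

Lemma push_pnu (I X Y : finType) (rho : I -> X -> R) (pi : X -> Y) (e : {ffun I -> Y}) :
  push (pnu rho) (fun d : {ffun I -> X} => [ffun i => pi (d i)]) e =
  \prod_i push (rho i) pi (e i).
Proof.
rewrite /push (bigA_distr_big_dep (fun i x => pi x == e i)).
apply: eq_bigl => d; apply/eqP/familyP => [<- i|H].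
  by apply/eqP; rewrite ffunE.
by apply/ffunP => i; rewrite ffunE; apply/eqP; have := H i.
Qed.

End PushForward.

Section ProductIndep.
Variables (R : realType) (I X : finType) (nu : I -> X -> R).
Hypothesis nu_sum1 : forall i, \sum_x nu i x = 1.

Lemma pmean_prod (h : I -> X -> R) :
  pmean nu (fun d => \prod_i h i (d i)) = \prod_i fmean (nu i) (h i).
Proof.
rewrite /fmean bigA_distr_bigA; apply: eq_bigr => d _.
by rewrite /pnu -big_split.
Qed.

Lemma pmean_coord i (h : X -> R) : pmean nu (fun d => h (d i)) = fmean (nu i) h.
Proof.
pose H j := if j == i then h else fun=> 1.
have H1 j : j != i -> fmean (nu j) (H j) = 1.
  by move=> /negbTE ji; rewrite /H ji /fmean; under eq_bigr do rewrite mulr1.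
transitivity (pmean nu (fun d => \prod_j H j (d j))).
  apply: eq_bigr => d _; congr (_ * _); rewrite (bigD1 i) //= big1 ?mulr1 /H ?eqxx //.
  by move=> j /negbTE ->.
rewrite pmean_prod (bigD1 i) //= big1 ?mulr1 /H ?eqxx // => j ji; exact: H1.
Qed.

Lemma pmean_coord2 i j (h g : X -> R) : i != j ->
  pmean nu (fun d => h (d i) * g (d j)) = fmean (nu i) h * fmean (nu j) g.
Proof.
move=> ij; pose H k := if k == i then h else if k == j then g else fun=> 1.
have Hi : H i = h by rewrite /H eqxx.
have Hj : H j = g by rewrite /H eq_sym (negbTE ij) eqxx.
have Hk k : (k != i) && (k != j) -> H k = fun=> 1.
  by case/andP => /negbTE ki /negbTE kj; rewrite /H ki kj.
have ji : j != i by rewrite eq_sym.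
transitivity (pmean nu (fun d => \prod_k H k (d k))).
  apply: eq_bigr => d _; congr (_ * _); rewrite (bigD1 i) //= (bigD1 j) //=.
  by rewrite big1 ?mulr1 ?Hi ?Hj // => k /Hk ->.
rewrite pmean_prod (bigD1 i) //= (bigD1 j) //= big1 ?mulr1 ?Hi ?Hj // => k /Hk ->.
by rewrite /fmean; under eq_bigr do rewrite mulr1.
Qed.

End ProductIndep.

(** * Scalar inequalities for exponential moments and Hellinger distances *)

Section RealLemmas.
Variables (R : realType).
Implicit Types x z u w s t a p al ga D : R.

Lemma expR_le_quadratic x : expR x <= 1 + x + x ^+ 2 * expR `|x|.
Proof.
have H : expR x - 1 <= x * expR x.
  have := expR_ge1Dx (- x); rewrite -(ler_pM2r (expR_gt0 x)) -expRD addNr expR0.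
  by rewrite mulrDl mul1r mulNr => H; lra.
have [x0|x0] := leP 0 x.
  rewrite ger0_norm //; have := ler_wpM2l x0 H; rewrite mulrA -expr2 mulrBr mulr1.
  by have := expR_ge1Dx x; nra.
rewrite ltr0_norm //; have E1 : 1 <= expR (- x) by rewrite -expR0 ler_expR oppr_ge0 ltW.
have : expR x - 1 - x <= x ^+ 2.
  have := expR_ge1Dx x; have : x * expR x <= x * (1 + x) by rewrite ler_wnM2l ?expR_ge1Dx // ltW.
  by rewrite mulrDr mulr1 -expr2; lra.
have : x ^+ 2 <= x ^+ 2 * expR (- x) by rewrite ler_peMr // sqr_ge0.
by lra.
Qed.

(** For [|s| >= K / kappa] the bound holds pointwise, since [|s * V| <= K * |s| <= kappa * s ^+ 2].
    For smaller [s] the zero mean removes the linear term of [expR_le_quadratic]; hence the exponent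
    [K / kappa] in the hypothesis. *)
Lemma mgf_le (Y : finType) (p V : Y -> R) (K kappa : R) :
  (forall y, 0 < p y) -> \sum_y p y = 1 -> fmean p V = 0 ->
  (forall y, `|V y| <= K) -> 0 < kappa ->
  fmean p (fun y => V y ^+ 2 * expR (K / kappa * `|V y|)) <= kappa ->
  forall s, fmean p (fun y => expR (s * V y)) <= expR (kappa * s ^+ 2).
Proof.
move=> p0 p1 V0 VK k0 H s.
have [sK|sK] := leP (K / kappa) `|s|.
  have -> : expR (kappa * s ^+ 2) = fmean p (fun=> expR (kappa * s ^+ 2)).
    by rewrite /fmean -mulr_suml p1 mul1r.
  apply: fmean_le => // y; rewrite ler_expR; apply: le_trans (ler_norm _) _.
  rewrite normrM -[s ^+ 2]real_normK ?num_real // expr2.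
  rewrite [leRHS]mulrCA ler_wpM2l //; apply: le_trans (VK y) _.
  by move: sK; rewrite ler_pdivrMr // mulrC.
apply: le_trans (expR_ge1Dx _); rewrite [X in _ <= X]addrC mulrC.
apply: le_trans (_ : fmean p (fun y => 1 + s * V y +
    s ^+ 2 * (V y ^+ 2 * expR (K / kappa * `|V y|))) <= _).
  apply: fmean_le => // y; apply: le_trans (expR_le_quadratic _) _.
  rewrite lerD2l exprMn -[leLHS]mulrA ler_wpM2l ?sqr_ge0 // ler_wpM2l ?sqr_ge0 //.
  by rewrite ler_expR normrM ler_wpM2r // ltW.
have -> : fmean p (fun y => 1 + s * V y + s ^+ 2 * (V y ^+ 2 * expR (K / kappa * `|V y|))) =
   \sum_y p y + s * fmean p V + s ^+ 2 * fmean p (fun y => V y ^+ 2 * expR (K / kappa * `|V y|)).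
  by rewrite /fmean !mulr_sumr -!big_split; apply: eq_bigr => y _ /=; ring.
rewrite p1 V0 mulr0 addr0 [leRHS]addrC lerD2l.
by rewrite ler_wpM2l // sqr_ge0.
Qed.

Lemma bhattacharyya_le1 al ga : 0 <= al <= 1 -> 0 <= ga <= 1 ->
  (Num.sqrt (al * ga) + Num.sqrt ((1 - al) * (1 - ga))) ^+ 2 <= 1.
Proof.
move=> /andP[a0 a1] /andP[g0 g1]; set p := Num.sqrt _; set s := Num.sqrt _.
have pE : p ^+ 2 = al * ga by rewrite sqr_sqrtr // mulr_ge0.
have sE : s ^+ 2 = (1 - al) * (1 - ga) by rewrite sqr_sqrtr // mulr_ge0 // subr_ge0.
have : (2 * (p * s)) ^+ 2 <= (al * (1 - ga) + (1 - al) * ga) ^+ 2.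
  by rewrite !exprMn pE sE; have := sqr_ge0 (al - ga); nra.
have H0 : 0 <= al * (1 - ga) + (1 - al) * ga.
  by apply: addr_ge0; apply: mulr_ge0; rewrite ?subr_ge0.
rewrite ler_sqr ?nnegrE //; last by rewrite !mulr_ge0 // sqrtr_ge0.
by rewrite sqrrD pE sE; lra.
Qed.

(* The contraction coefficient [1 - D ^ 2] of the squared Hellinger distance
   under a binary channel with rows (al, 1 - al) and (ga, 1 - ga). *)
Lemma hellinger_channel al ga u w p s D : 0 <= al <= 1 -> 0 <= ga <= 1 ->
  0 <= u -> 0 <= w ->
  p = Num.sqrt (al * ga) -> s = Num.sqrt ((1 - al) * (1 - ga)) -> D = p + s ->
  p * D * u + (1 - D ^+ 2) * Num.sqrt (u * w) + s * D * w <=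
  Num.sqrt ((al * u + (1 - al) * w) * (ga * u + (1 - ga) * w)).
Proof.
move=> al01 ga01 u0 w0 pE sE DE.
have D1 : 0 <= 1 - D ^+ 2 by rewrite subr_ge0 DE pE sE bhattacharyya_le1.
move: al01 ga01 => /andP[a0 a1] /andP[g0 g1].
have {}pE : p ^+ 2 = al * ga by rewrite pE sqr_sqrtr // mulr_ge0.
have {}sE : s ^+ 2 = (1 - al) * (1 - ga).
  by rewrite sE sqr_sqrtr // mulr_ge0 // subr_ge0.
rewrite sqrtrM //; set x := Num.sqrt u; set z := Num.sqrt w.
have xE : u = x ^+ 2 by rewrite sqr_sqrtr.
have zE : w = z ^+ 2 by rewrite sqr_sqrtr.
apply: le_trans (ler_norm _) _; rewrite -sqrtr_sqr ler_wsqrtr //.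
rewrite xE zE -subr_ge0.
have -> : (al * x ^+ 2 + (1 - al) * z ^+ 2) * (ga * x ^+ 2 + (1 - ga) * z ^+ 2) =
  p ^+ 2 * x ^+ 4 + (1 - p ^+ 2 - s ^+ 2) * (x * z) ^+ 2 + s ^+ 2 * z ^+ 4.
  by rewrite pE sE; ring.
have -> : p ^+ 2 * x ^+ 4 + (1 - p ^+ 2 - s ^+ 2) * (x * z) ^+ 2 + s ^+ 2 * z ^+ 4 -
  (p * D * x ^+ 2 + (1 - D ^+ 2) * (x * z) + s * D * z ^+ 2) ^+ 2 =
  (1 - D ^+ 2) * ((x - z) * (p * x - s * z)) ^+ 2 by rewrite DE; ring.
by rewrite mulr_ge0 // sqr_ge0.
Qed.

Lemma sqrt_mul_le_half u w : 0 <= u -> 0 <= w -> Num.sqrt (u * w) <= (u + w) / 2.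
Proof.
move=> u0 w0; rewrite sqrtrM //.
have := sqr_ge0 (Num.sqrt u - Num.sqrt w).
by rewrite sqrrB !sqr_sqrtr //; lra.
Qed.

(** This turns Hellinger decay into tail bounds: a point whose log-likelihood ratio exceeds [a]
    contributes at least a fixed fraction of its mass to the squared Hellinger distance. *)
Lemma sqrt_gap a u w : 0 < a -> 0 < u -> 0 < w -> a < `|ln (u / w)| ->
  Num.max u w * (1 - expR (- (a / 2))) ^+ 2 <= (Num.sqrt u - Num.sqrt w) ^+ 2.
Proof.
have key u' w' : 0 < a -> 0 < u' -> 0 < w' -> a < ln (u' / w') ->
    u' * (1 - expR (- (a / 2))) ^+ 2 <= (Num.sqrt u' - Num.sqrt w') ^+ 2.
  move=> a0 u0 w0 H.
  have H1 : w' <= u' * expR (- (a / 2)) ^+ 2.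
    rewrite -expRM_natl (_ : 2%:R * - (a / 2) = - a); last by field.
    move: H; rewrite -ltr_expR lnK ?posrE ?divr_gt0 // ltr_pdivlMr // => /ltW.
    by rewrite expRN ler_pdivlMr ?expR_gt0 // mulrC.
  have e1 : expR (- (a / 2)) <= 1 by rewrite -expR0 ler_expR oppr_le0 divr_ge0 // ltW.
  have : Num.sqrt w' <= Num.sqrt u' * expR (- (a / 2)).
    apply: le_trans (ler_wsqrtr H1) _.
    by rewrite sqrtrM ?(ltW u0) // sqrtr_sqr ger0_norm ?expR_ge0.
  move=> H2; rewrite -{1}[u']sqr_sqrtr ?(ltW u0) // -exprMn.
  rewrite ler_sqr ?nnegrE; last 2 first.
  - by rewrite mulr_ge0 ?sqrtr_ge0 // subr_ge0.
  - by rewrite subr_ge0; apply: le_trans H2 _; rewrite ler_piMr ?sqrtr_ge0.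
  by rewrite mulrBr mulr1 lerB.
move=> a0 u0 w0; have [uw|uw] := leP w u.
  rewrite ger0_norm; first exact: key.
  by rewrite ln_ge0 // ler_pdivlMr // mul1r.
rewrite -[leRHS]sqrrN opprB ltr0_norm; last by rewrite ln_lt0 // divr_gt0 //= ltr_pdivrMr // mul1r.
rewrite ln_div ?posrE // opprB -ln_div ?posrE //. by apply: key.
Qed.

Lemma norm_sub_le_ln u w : 0 < u -> 0 < w -> `|u - w| <= Num.max u w * `|ln (u / w)|.
Proof.
have key u' w' : 0 < u' -> 0 < w' -> w' <= u' -> u' - w' <= u' * ln (u' / w').
  move=> u0 w0 wu; have := ln_le_sub1 (divr_gt0 w0 u0).
  rewrite ln_div ?posrE // ln_div ?posrE // => H.
  have -> : u' - w' = u' * (1 - w' / u') by field; rewrite gt_eqF.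
  by rewrite ler_pM2l //; lra.
move=> u0 w0; have [uw|uw] := leP w u.
  by rewrite !ger0_norm ?subr_ge0 ?key // ln_ge0 // ler_pdivlMr // mul1r.
rewrite ltr0_norm ?subr_lt0 // ltr0_norm; last by rewrite ln_lt0 // divr_gt0 //= ltr_pdivrMr //
  mul1r.
by rewrite ln_div ?posrE // !opprB -ln_div ?posrE // key // ltW.
Qed.

Lemma exists_natM_expr_le t (e : R) : 0 <= t < 1 -> 0 < e ->
  exists k : nat, (k%:R + 2) * t ^+ k <= e.
Proof.
move=> /andP[t0 t1] e0.
pose r := Num.sqrt t.
have r0 : 0 <= r by exact: sqrtr_ge0.
have r1 : r < 1 by rewrite -sqrtr1 ltr_sqrt.
have rt : t = r ^+ 2 by rewrite sqr_sqrtr.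
(* One factor [r ^+ k] absorbs [k%:R + 2]; the other one, from [t = r ^+ 2], tends to zero. *)
have bern k : (k%:R + 2) * r ^+ k * (1 - r) <= 3.
  have H j : (j%:R * (1 - r) + r) * r ^+ j <= 1.
    elim: j => [|j IH]; first by rewrite mul0r add0r mulr1 ltW.
    have rj : r ^+ j <= 1 by rewrite exprn_ile1 // ltW.
    have rj0 : 0 <= r ^+ j by exact: exprn_ge0.
    have H1 := ler_wpM2l r0 IH.
    have ryj : r * r ^+ j <= 1 by rewrite mulr_ile1 // ltW.
    have r10 : 0 <= 1 - r by rewrite subr_ge0 ltW.
    have H2 := ler_wpM2l r10 ryj.
    rewrite -natr1 exprS; lra.
  have := H k; have rk : r ^+ k <= 1 by rewrite exprn_ile1 // ltW.
  have rk0 : 0 <= r ^+ k by exact: exprn_ge0.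
  have H1 : 0 <= r * r ^+ k by rewrite mulr_ge0.
  by lra.
have [k _ /(_ k (leqnn k)) Hk] : (\forall k \near \oo%classic, `|0 - r ^+ k| < e * (1 - r) /
  3)%classic.
  have /cvgrPdist_lt H : ((fun n => r ^+ n) @ \oo --> (0 : R))%classic.
    by apply: cvg_expr; rewrite ger0_norm.
  apply: H.
  by rewrite divr_gt0 // mulr_gt0 // subr_gt0.
exists k; rewrite rt -exprM mulnC exprM expr2 mulrA.
move: Hk; rewrite sub0r normrN ger0_norm ?exprn_ge0 // => Hk.
have r1' : 0 < 1 - r by rewrite subr_gt0.
rewrite -(ler_pM2r r1') mulrAC.
apply: le_trans (_ : 3 * r ^+ k <= _); first by rewrite ler_wpM2r ?exprn_ge0 // bern.
by lra.
Qed.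

End RealLemmas.

(** * The posterior of the root given the spins at depth k *)

Fixpoint leafc (b k : nat) : finType :=
  if k is k'.+1 then {ffun 'I_b -> leafc b k'} : finType else bool : finType.

Section Observation.
Variables (R : realType) (b : nat).
Variable pk : nat -> seq 'I_b -> option bool -> bool -> R.
Variable pmin : R.
Hypothesis pmin_gt0 : 0 < pmin.
Hypothesis pk_ge : forall m x u a, pmin <= pk m x u a.
Hypothesis pk_sum1 : forall m x u, pk m x u true + pk m x u false = 1.

Let pk_gt0 m x u a : 0 < pk m x u a. Proof. exact: lt_le_trans (pk_ge _ _ _ _). Qed.

Let sum_pk m x u : \sum_a pk m x u a = 1.
Proof. by rewrite big_bool; exact: pk_sum1. Qed.

Let pk_le1 m x u a : pk m x u a <= 1.
Proof.
by have := pk_sum1 m x u; have := pk_gt0 m x u (~~ a); case: a => /=; lra.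
Qed.

(* The likelihood of the spins [xi] at depth [k] below the vertex [x], at height
   [m], given that the parent of [x] is in state [u]. *)
Fixpoint lq (k m : nat) (x : seq 'I_b) (u : option bool) : leafc b k -> R :=
  match k return leafc b k -> R with
  | 0 => fun xi => pk m x u xi
  | k'.+1 => fun xi => fmean (pk m x u)
      (fun a => pnu (fun i => lq m.-1 (i :: x) (Some a)) xi)
  end.

(** Conditions on the spin of [x] itself, where [lq] conditions on its parent. Note the shift: these
    are spins at depth [k.+1], and their law is a product over the children. *)
Definition lqs (k m : nat) (x : seq 'I_b) (a : bool) (xi : leafc b k.+1) : R :=
  pnu (fun i => @lq k m.-1 (i :: x) (Some a)) xi.

Lemma lqS k m x u xi : @lq k.+1 m x u xi =
  pk m x u true * @lqs k m x true xi + pk m x u false * lqs m x false xi.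
Proof. by rewrite /= /fmean big_bool. Qed.

Lemma lq_gt0 k m x u xi : 0 < @lq k m x u xi.
Proof.
elim: k m x u xi => [|k IH] m x u xi //=.
have H a : 0 < pnu (fun i => @lq k m.-1 (i :: x) (Some a)) xi by exact: pnu_gt0.
by apply: (fmean_gt0 (pk_gt0 m x u) _ (H true)) => // a; exact: ltW.
Qed.

Lemma lqs_gt0 k m x a xi : 0 < @lqs k m x a xi.
Proof. by apply: pnu_gt0 => *; exact: lq_gt0. Qed.

Lemma fmean_lqS k m x u phi : fmean (@lq k.+1 m x u) phi =
  fmean (pk m x u) (fun a => fmean (@lqs k m x a) phi).
Proof.
rewrite /fmean /= /fmean; under eq_bigr do rewrite mulr_suml.
rewrite exchange_big; apply: eq_bigr => a _; rewrite mulr_sumr.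
by apply: eq_bigr => xi _; rewrite mulrA.
Qed.

Lemma lq_sum1 k m x u : \sum_xi @lq k m x u xi = 1.
Proof.
elim: k m x u => [|k IH] m x u /=; first exact: sum_pk.
rewrite /fmean exchange_big /= -[RHS](sum_pk m x u); apply: eq_bigr => a _.
by rewrite -mulr_sumr pnu_sum1 ?mulr1.
Qed.

Lemma lqs_sum1 k m x a : \sum_xi @lqs k m x a xi = 1.
Proof. by rewrite pnu_sum1 // => i; exact: lq_sum1. Qed.

Lemma lqs_le_lq k m x u a xi : pmin * @lqs k m x a xi <= @lq k.+1 m x u xi.
Proof.
rewrite lqS; have := lqs_gt0 m x true xi; have := lqs_gt0 m x false xi.
have := pk_ge m x u true; have := pk_ge m x u false; have := pmin_gt0.
by case: a => *; nra.
Qed.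

Lemma lq_ratio k m x u v xi : pmin * @lq k m x u xi <= @lq k m x v xi.
Proof.
have H a : pmin * pk m x u a <= pk m x v a.
  by apply: le_trans (pk_ge m x v a); rewrite ler_piMr // ltW.
case: k xi => [|k] xi //; rewrite !lqS mulrDr !mulrA.
by apply: lerD; rewrite ler_pM2r ?lqs_gt0.
Qed.

Definition lr (k m : nat) (x : seq 'I_b) (xi : leafc b k) : R :=
  ln (lq m x (Some true) xi / lq m x (Some false) xi).

Lemma lr_bound k m x xi : `|@lr k m x xi| <= - ln pmin.
Proof.
have H u v : ln (lq m x u xi / lq m x v xi) <= - ln pmin.
  rewrite -lnV ?posrE // ler_ln ?posrE ?divr_gt0 ?lq_gt0 ?invr_gt0 //.
  by rewrite ler_pdivrMr ?lq_gt0 // ler_pdivlMl // lq_ratio.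
rewrite ler_norml H andbT lerNl; apply: le_trans (H (Some false) (Some true)).
by rewrite /lr -lnV ?posrE ?divr_gt0 ?lq_gt0 // invf_div.
Qed.

(** One minus the Bhattacharyya coefficient, which is multiplicative over independent subtrees;
    hence the subadditivity in [hellinger_lqs]. *)
Definition hellinger (k m : nat) (x : seq 'I_b) : R :=
  1 - \sum_xi Num.sqrt (@lq k m x (Some true) xi * lq m x (Some false) xi).

Lemma hellinger_ge0 k m x : 0 <= hellinger k m x.
Proof.
rewrite subr_ge0; apply: le_trans (_ : \sum_xi (@lq k m x (Some true) xi + lq m x (Some false)
  xi) / 2 <= _).
  by apply: ler_sum => xi _; apply: sqrt_mul_le_half; exact/ltW/lq_gt0.
by rewrite -mulr_suml big_split /= !lq_sum1; lra.
Qed.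

Lemma hellinger_le1 k m x : hellinger k m x <= 1.
Proof. by rewrite lerBlDl lerDr sumr_ge0 // => xi _; exact: sqrtr_ge0. Qed.

Lemma sqrt_prod (I : finType) (f : I -> R) : (forall i, 0 <= f i) ->
  Num.sqrt (\prod_i f i) = \prod_i Num.sqrt (f i).
Proof.
move=> f0; suff [_ ->] : 0 <= \prod_i f i /\ Num.sqrt (\prod_i f i) = \prod_i Num.sqrt (f i) by [].
by elim/big_rec2: _ => [|i y1 y2 _ [y0 IH]]; rewrite ?sqrtr1 // mulr_ge0 // sqrtrM // IH.
Qed.

Lemma one_sub_prod_le (I : finType) (f : I -> R) : (forall i, 0 <= f i <= 1) ->
  1 - \prod_i f i <= \sum_i (1 - f i).
Proof.
move=> f01; suff [_] : 0 <= \prod_i f i <= 1 /\ 1 - \prod_i f i <= \sum_i (1 - f i) by [].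
elim/big_rec2: _ => [|i y1 y2 _ [/andP[h0 h1] IH]]; first by rewrite subrr lexx ler01.
have /andP[a0 a1] := f01 i; split; first by rewrite mulr_ge0 //= mulr_ile1.
by have : 0 <= (1 - f i) * (1 - y2); [rewrite mulr_ge0 // subr_ge0|lra].
Qed.

Lemma hellinger_lqs k m x :
  1 - \sum_xi Num.sqrt (@lqs k m x true xi * lqs m x false xi) <=
  \sum_i hellinger k m.-1 (i :: x).
Proof.
pose BC i := 1 - hellinger k m.-1 (i :: x).
have -> : \sum_xi Num.sqrt (@lqs k m x true xi * lqs m x false xi) = \prod_i BC i.
  rewrite /BC /hellinger; under [RHS]eq_bigr do rewrite opprB addrC subrK.
  rewrite bigA_distr_bigA; apply: eq_bigr => xi _.
  rewrite /lqs /pnu -big_split /= sqrt_prod // => i.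
  by rewrite mulr_ge0 // ltW // lq_gt0.
apply: le_trans (one_sub_prod_le _) _ => [i|].
  by rewrite /BC lerBlDl lerDr hellinger_ge0 subr_ge0 hellinger_le1.
by apply: ler_sum => i _; rewrite /BC opprB addrC subrK.
Qed.

Definition overlap m x : R :=
  Num.sqrt (pk m x (Some true) true * pk m x (Some false) true) +
  Num.sqrt (pk m x (Some true) false * pk m x (Some false) false).

Lemma overlap_le1 m x : overlap m x ^+ 2 <= 1.
Proof.
have E u : pk m x u false = 1 - pk m x u true by rewrite -(pk_sum1 m x u); ring.
by rewrite /overlap !E bhattacharyya_le1 // pk_le1 ltW.
Qed.

Lemma hellinger_step k m x : hellinger k.+1 m x <=
  (1 - overlap m x ^+ 2) * \sum_i hellinger k m.-1 (i :: x).
Proof.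
apply: le_trans (ler_wpM2l _ (hellinger_lqs k m x)); last first.
  by rewrite subr_ge0 overlap_le1.
have E u : pk m x u false = 1 - pk m x u true by rewrite -(pk_sum1 m x u); ring.
have pk01 u : 0 <= pk m x u true <= 1 by rewrite pk_le1 ltW.
set p := Num.sqrt (pk m x (Some true) true * pk m x (Some false) true).
set s := Num.sqrt (pk m x (Some true) false * pk m x (Some false) false).
have key := @hellinger_channel R _ _ _ _ p s (p + s) (pk01 (Some true)) (pk01 (Some false))
  (ltW (lqs_gt0 m x true _)) (ltW (lqs_gt0 m x false _)) (erefl _) _ (erefl _).
rewrite /hellinger lerBlDr.
apply: le_trans (_ : (1 - overlap m x ^+ 2) * (1 - \sum_xi Num.sqrt (@lqs k m x true xi * lqs m
  x false xi)) +
   \sum_xi (p * (p + s) * @lqs k m x true xi + (1 - (p + s) ^+ 2) *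
     Num.sqrt (lqs m x true xi * lqs m x false xi) + s * (p + s) * lqs m x false xi) <= _);
       last first.
  rewrite lerD2l; apply: ler_sum => xi _; rewrite !lqS !E.
  by apply: key; rewrite /s !E.
(* The masses [p * (p + s)] and [s * (p + s)] add up to the squared overlap, so the expression
   equals one. *)
rewrite !big_split /= -!mulr_sumr !lqs_sum1 /overlap -/p -/s le_eqVlt.
by apply/orP; left; apply/eqP; ring.
Qed.

Variables (lam t : R) (k0 : nat).
Hypothesis lam01 : 0 < lam < 1.
Hypothesis t01 : 0 <= t < 1.
Hypothesis contraction : forall m x, (k0 <= m)%N ->
  b%:R * (1 - overlap m x ^+ 2) <= lam.

(** Near the boundary, at heights below [k0], no contraction is available; there [k <= m < k0], and
    the factor [lam ^+ k0] in the denominator makes the trivial bound 1 sufficient. *)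
Lemma hellinger_decay k m x : (k <= m)%N -> hellinger k m x <= lam ^+ k / lam ^+ k0.
Proof.
have /andP[l0 l1] := lam01.
have l0k j : 0 < lam ^+ j by exact: exprn_gt0.
elim: k m x => [|k IH] m x km.
  apply: le_trans (hellinger_le1 _ _ _) _; rewrite ler_pdivlMr // mul1r expr0.
  by rewrite exprn_ile1 // ltW.
have [k0m|mk0] := leqP k0 m; last first.
  apply: le_trans (hellinger_le1 _ _ _) _; rewrite ler_pdivlMr // mul1r.
  by apply: ler_wiXn2l; rewrite ?ltW //; lia.
apply: le_trans (hellinger_step _ _ _) _.
apply: le_trans (_ : (1 - overlap m x ^+ 2) * \sum_(i < b) (lam ^+ k / lam ^+ k0) <= _).
  rewrite ler_wpM2l // ?subr_ge0 ?overlap_le1 //; apply: ler_sum => i _.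
  by apply: IH; lia.
rewrite sumr_const card_ord -[_ *+ b]mulr_natl mulrA [lam ^+ k.+1]exprS -[leRHS]mulrA.
rewrite [X in X <= _](_ : _ = (b%:R * (1 - overlap m x ^+ 2)) * (lam ^+ k / lam ^+ k0)); last
  by ring.
by rewrite ler_wpM2r ?contraction // ltW // divr_gt0.
Qed.

Hypothesis lip : forall m x l,
  `|ln ((pk m x (Some true) true * expR l + pk m x (Some true) false) /
        (pk m x (Some false) true * expR l + pk m x (Some false) false))| <= t * `|l|.

Lemma ln_lqs k m x (xi : leafc b k.+1) :
  ln (lqs m x true xi / lqs m x false xi) = \sum_i lr m.-1 (i :: x) (xi i).
Proof.
rewrite /lqs /pnu -prodf_div /lr.
suff [_ ->] : 0 < \prod_i (lq m.-1 (i :: x) (Some true) (xi i) / lq m.-1 (i :: x) (Some false)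
  (xi i)) /\
  ln (\prod_i (lq m.-1 (i :: x) (Some true) (xi i) / lq m.-1 (i :: x) (Some false) (xi i))) =
  \sum_i ln (lq m.-1 (i :: x) (Some true) (xi i) / lq m.-1 (i :: x) (Some false) (xi i)) by [].
elim/big_rec2: _ => [|i y1 y2 _ [y0 IH]]; first by rewrite ln1.
have q0 : 0 < lq m.-1 (i :: x) (Some true) (xi i) / lq m.-1 (i :: x) (Some false) (xi i).
  by rewrite divr_gt0 // lq_gt0.
by rewrite mulr_gt0 // lnM ?posrE // IH.
Qed.

(** Given the spin of [x], the log-likelihood ratios of the children add up ([ln_lqs]); the edge to
    the parent then contracts the sum, by [lip]. *)
Lemma lr_step k m x (xi : leafc b k.+1) :
  `|lr m x xi| <= t * \sum_i `|lr m.-1 (i :: x) (xi i)|.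
Proof.
have /andP[t0 _] := t01.
apply: le_trans (_ : t * `|\sum_i lr m.-1 (i :: x) (xi i)| <= _); last first.
  by rewrite ler_wpM2l // ler_norm_sum.
rewrite -ln_lqs; apply: le_trans (lip m x _).
have qt := lqs_gt0 m x true xi; have qf := lqs_gt0 m x false xi.
rewrite lnK ?posrE ?divr_gt0 // /lr !lqS; set q1 := lqs m x true xi in qt *.
set q2 := lqs m x false xi in qf *.
rewrite le_eqVlt; apply/orP; left; apply/eqP; congr (`|ln _|).
have H u : 0 < pk m x u true * q1 + pk m x u false * q2 by rewrite addr_gt0 // mulr_gt0.
field; rewrite !(gt_eqF (H _)) gt_eqF //=.
Qed.

Definition tail (k m : nat) (x : seq 'I_b) (u : option bool) (a : R) : R :=
  fmean (@lq k m x u) (fun xi => (a < `|lr m x xi|)%R%:R).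

Lemma tail_le1 k m x u a : tail k m x u a <= 1.
Proof.
rewrite -(lq_sum1 k m x u); apply: ler_sum => xi _.
rewrite ler_piMr //; first exact/ltW/lq_gt0.
by case: (_ < _)%R; rewrite ?ler01 ?lexx.
Qed.

Definition tail_bound (rho a : R) : Prop := exists2 C, 0 <= C &
  forall k m x s, (k <= m)%N -> tail k m x (Some s) a <= C * rho ^+ k.

Lemma tail_bound_le rho a a' : a <= a' -> tail_bound rho a -> tail_bound rho a'.
Proof.
move=> aa' [C C0 H]; exists C => // k m x s km; apply: le_trans (H _ _ _ _ km).
apply: fmean_le => [xi|xi]; first exact: lq_gt0.
have [h|] := ltP a' `|lr m x xi|; last by rewrite ler0n.
by rewrite (le_lt_trans aa' h).
Qed.

Lemma tail_hellinger a : 0 < a -> tail_bound lam a.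
Proof.
move=> a0; have /andP[l0 l1] := lam01; set g := (1 - expR (- (a / 2))) ^+ 2.
have g0 : 0 < g.
  rewrite exprn_gt0 // subr_gt0 -[ltRHS]expR0 ltr_expR oppr_lt0.
  by rewrite divr_gt0.
exists (2 / g / lam ^+ k0); first by
  apply: divr_ge0; [apply: divr_ge0 => //; exact: ltW|exact/ltW/exprn_gt0].
move=> k m x s km.
have -> : 2 / g / lam ^+ k0 * lam ^+ k = (2 * (lam ^+ k / lam ^+ k0)) / g by ring.
rewrite ler_pdivlMr //; apply: le_trans (_ : 2 * hellinger k m x <= _); last first.
  by rewrite ler_pM2l // hellinger_decay.
have -> : 2 * hellinger k m x =
    \sum_xi (Num.sqrt (@lq k m x (Some true) xi) - Num.sqrt (lq m x (Some false) xi)) ^+ 2.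
  rewrite /hellinger mulrBr mulr1 mulr_sumr.
  rewrite -[X in X - _](_ : \sum_xi @lq k m x (Some true) xi + \sum_xi @lq k m x (Some false)
    xi = 2); last first.
    by rewrite !lq_sum1; lra.
  rewrite -big_split -sumrB; apply: eq_bigr => xi _ /=.
  rewrite sqrrB !sqr_sqrtr ?ltW ?lq_gt0 // sqrtrM ?ltW ?lq_gt0 //; ring.
rewrite /tail /fmean mulr_suml; apply: ler_sum => xi _.
have [h|_] := ltP a `|lr m x xi|; last by rewrite mulr0 mul0r sqr_ge0.
rewrite mulr1; apply: le_trans (sqrt_gap a0 (lq_gt0 _ _ _ _) (lq_gt0 _ _ _ _) h).
rewrite ler_pM2r // le_max; case: s; rewrite lexx ?orbT //.
Qed.

(** If no child had a ratio above [a] and at most one had a ratio above [d], then [lr_step] would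
    bound the ratio at [x] by [t * a + t * b%:R * d]. So some child exceeds [a], or two children
    exceed [d]; the latter has probability of order [rho ^+ k] squared by conditional
    independence. *)
Lemma tail_double rho a d : 0 < rho <= 1 -> 0 <= a -> 0 < d ->
  tail_bound rho d -> tail_bound (rho ^+ 2) a ->
  tail_bound (rho ^+ 2) (t * a + t * b%:R * d).
Proof.
move=> /andP[r0 r1] a0 d0 [C1 C10 H1] [C2 C20 H2]; have /andP[t0 _] := t01.
set C3 := b%:R * C2 + b%:R * b%:R * (C1 * C1).
have C30 : 0 <= C3 by rewrite addr_ge0 // !mulr_ge0.
(* The 1 covers depth zero; dividing by [rho ^+ 2] makes up for the level lost in passing to the
   children. *)
exists (1 + C3 / rho ^+ 2); first by rewrite addr_ge0 // divr_ge0 // sqr_ge0.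
move=> [|k] m x s km; last have km' : (k <= m.-1)%N by rewrite -ltnS (ltn_predK km).
  apply: le_trans (tail_le1 _ _ _ _ _) _; rewrite mulr1 lerDl divr_ge0 //.
  exact: sqr_ge0.
apply: le_trans (_ : C3 * rho ^+ 2 ^+ k <= _); last first.
  have -> : (1 + C3 / rho ^+ 2) * rho ^+ 2 ^+ k.+1 =
      rho ^+ 2 ^+ k.+1 + C3 * rho ^+ 2 ^+ k.
    by rewrite ![rho ^+ 2 ^+ k.+1]exprS; field; rewrite gt_eqF.
  by rewrite lerDr exprn_ge0 // sqr_ge0.
pose ind c i (xi : leafc b k.+1) : R := (c < `|lr m.-1 (i :: x) (xi i)|)%R%:R.
have ind0 c i xi : 0 <= ind c i xi by rewrite ler0n.
rewrite /tail fmean_lqS.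
have -> : C3 * rho ^+ 2 ^+ k = fmean (pk m x (Some s)) (fun=> C3 * rho ^+ 2 ^+ k).
  by rewrite /fmean -mulr_suml sum_pk mul1r.
apply: fmean_le => // e.
apply: le_trans (_ : fmean (@lqs k m x e) (fun xi => \sum_i ind a i xi +
    \sum_i \sum_(j | i != j) ind d i xi * ind d j xi) <= _).
  apply: fmean_le => [xi|xi]; first exact: lqs_gt0.
  have S1 : 0 <= \sum_i ind a i xi by exact: sumr_ge0.
  have S2' i : 0 <= \sum_(j | i != j) ind d i xi * ind d j xi.
    by apply: sumr_ge0 => j _; rewrite mulr_ge0.
  have S2 : 0 <= \sum_i \sum_(j | i != j) ind d i xi * ind d j xi by exact: sumr_ge0.
  have [h|_] := ltP; last by rewrite addr_ge0.
  have [/existsP[i hi]|/existsPn na] := boolP [exists i, a < `|lr m.-1 (i :: x) (xi i)|].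
    rewrite -[leLHS]addr0 lerD // (bigD1 i) //= {1}/ind hi lerDl.
    by apply: sumr_ge0 => j _; rewrite ind0.
  have [/existsP[i hi]|/existsPn nd] := boolP [exists i, d < `|lr m.-1 (i :: x) (xi i)|].
    have [/existsP[j /andP[ij hj]]|/existsPn nj] :=
      boolP [exists j, (i != j) && (d < `|lr m.-1 (j :: x) (xi j)|)].
      rewrite -[leLHS]add0r lerD // (bigD1 i) //= (bigD1 j) //= {1 2}/ind hi hj mulr1.
      rewrite -addrA lerDl addr_ge0 //; first by apply: sumr_ge0 => l _; rewrite mulr_ge0.
      exact: sumr_ge0.
    exfalso; move: h; apply/negP; rewrite -leNgt; apply: le_trans (lr_step m x xi) _.
    rewrite -mulrA -mulrDr ler_wpM2l // (bigD1 i) //= lerD //; first by rewrite leNgt na.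
    apply: le_trans (_ : \sum_(j < b | j != i) d <= _).
      apply: ler_sum => j ji; have := nj j; rewrite eq_sym ji /= -leNgt; exact.
    rewrite sumr_const -[X in X <= _]mulr_natl ler_wpM2r ?(ltW d0) // ler_nat.
    by apply: leq_trans (max_card _) _; rewrite card_ord.
  exfalso; move: h; apply/negP; rewrite -leNgt; apply: le_trans (lr_step m x xi) _.
  rewrite -mulrA -mulrDr ler_wpM2l // -[leLHS]add0r lerD //.
  apply: le_trans (_ : \sum_(j < b) d <= _).
    by apply: ler_sum => j _; rewrite leNgt nd.
  by rewrite sumr_const card_ord -[X in X <= _]mulr_natl.
change (pmean (fun i => @lq k m.-1 (i :: x) (Some e)) (fun xi => \sum_i ind a i xi +
    \sum_i \sum_(j | i != j) ind d i xi * ind d j xi) <= C3 * rho ^+ 2 ^+ k).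
rewrite pmeanD !pmean_sum /C3 mulrDl; apply: lerD.
  apply: le_trans (_ : \sum_(i < b) C2 * rho ^+ 2 ^+ k <= _); last first.
    by rewrite sumr_const card_ord -[X in X <= _]mulr_natl mulrA.
  apply: ler_sum => i _; rewrite /ind (@pmean_coord _ _ _ _ _ i (fun z => (a < `|lr m.-1 (i ::
    x) z|)%R%:R)).
    exact: H2.
  by move=> j; exact: lq_sum1.
apply: le_trans (_ : \sum_(i < b) \sum_(j < b) (C1 * rho ^+ k) * (C1 * rho ^+ k) <= _); last first.
  rewrite !sumr_const card_ord -[X in X <= _]mulr_natl -[X in _ * X <= _]mulr_natl.
  by rewrite le_eqVlt; apply/orP; left; apply/eqP; rewrite exprAC expr2; ring.
have T0 c i : 0 <= tail k m.-1 (i :: x) (Some e) c.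
  by apply: fmean_ge0 => xi; [exact: lq_gt0|rewrite ler0n].
apply: ler_sum => i _; rewrite pmean_sum big_mkcond; apply: ler_sum => j _.
have CC : 0 <= C1 * rho ^+ k * (C1 * rho ^+ k).
  by rewrite !mulr_ge0 // exprn_ge0 // ltW.
case: ifP => // ij; rewrite /ind.
rewrite (@pmean_coord2 _ _ _ _ _ i j (fun z => (d < `|lr m.-1 (i :: x) z|)%R%:R)
   (fun z => (d < `|lr m.-1 (j :: x) z|)%R%:R)) //; last by move=> l; exact: lq_sum1.
apply: ler_pM; rewrite -/(tail _ _ _ _ _) ?T0 //; exact: H1.
Qed.

Lemma tail_square rho : 0 < rho <= 1 -> (forall a, 0 < a -> tail_bound rho a) ->
  forall a, 0 < a -> tail_bound (rho ^+ 2) a.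
Proof.
move=> rho01 H a a0; have /andP[t0 t1] := t01.
(* Above the a priori bound of [lr_bound], so the tail at level [G] is zero. *)
set G := 1 - ln pmin.
have G0 : 0 < G.
  have : ln pmin <= 0 by apply: ln_le0; apply: le_trans (pk_ge 0 [::] None true) (pk_le1 _ _ _ _).
  by rewrite /G; lra.
set r := (1 + t) / 2.
have r0 : 0 < r by rewrite /r; lra.
have tr : t < r by rewrite /r; lra.
have r1 : r < 1 by rewrite /r; lra.
have base i : tail_bound (rho ^+ 2) (r ^+ i * G).
  elim: i => [|i IH].
    exists 0 => // k m x s km; rewrite mul0r mul1r.
    rewrite /tail /fmean big1 // => xi _.
    have := lr_bound m x xi; rewrite /G.
    have [h|_ _] := ltP; last by rewrite mulr0.
    by move=> h'; exfalso; lra.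
  have rG : 0 < r ^+ i * G by rewrite mulr_gt0 // exprn_gt0.
  (* Small enough for [tail_double] to lower the level from [r ^+ i * G] to [r ^+ i.+1 * G]. *)
  set d := (r - t) * (r ^+ i * G) / (t * b%:R + 1).
  have tb0 : 0 <= t * b%:R by rewrite mulr_ge0.
  have tb1 : 0 < t * b%:R + 1 by rewrite ltr_wpDl.
  have d0 : 0 < d by rewrite divr_gt0 // mulr_gt0 // subr_gt0.
  have := tail_double rho01 (ltW rG) d0 (H _ d0) IH; apply: tail_bound_le.
  have : t * b%:R * d <= (r - t) * (r ^+ i * G).
    rewrite /d mulrA ler_pdivrMr // mulrC ler_wpM2l ?lerDl //.
    by rewrite mulr_ge0 // ?subr_ge0 ltW.
  by rewrite exprS -mulrA; lra.
have r01 : 0 <= r < 1 by rewrite r1 ltW.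
have [i Hi] := exists_natM_expr_le r01 (divr_gt0 a0 G0).
apply: tail_bound_le (base i); rewrite -ler_pdivlMr //.
apply: le_trans Hi; rewrite ler_peMl ?exprn_ge0 ?ltW //.
by have : (0:R) <= i%:R by []; lra.
Qed.

Lemma tail_pow j a : 0 < a -> tail_bound (lam ^+ (2 ^ j)) a.
Proof.
have /andP[l0 l1] := lam01.
elim: j a => [|j IH] a a0; first by rewrite expr1; exact: tail_hellinger.
rewrite expnSr exprM; apply: tail_square => //.
by rewrite exprn_gt0 //= exprn_ile1 // ltW.
Qed.

(** By Bayes' rule, the conditional expectation of [root_sign] (defined below) given the spins at
    depth [k.+1]: the weights of [root_sign] cancel the prior probabilities of the two root
    spins. *)
Definition posterior (k m : nat) (x : seq 'I_b) (u : option bool) (xi : leafc b k.+1) : R :=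
  (lqs m x true xi - lqs m x false xi) / lq m x u xi.

Lemma posterior_mul k m x u (xi : leafc b k.+1) :
  lq m x u xi * posterior m x u xi = lqs m x true xi - lqs m x false xi.
Proof. by rewrite /posterior mulrC divfK // gt_eqF // lq_gt0. Qed.

Lemma posterior_mean0 k m x u : fmean (@lq k.+1 m x u) (posterior m x u) = 0.
Proof.
rewrite /fmean; under eq_bigr do rewrite posterior_mul.
by rewrite sumrB !lqs_sum1 subrr.
Qed.

Lemma max_lqs_le k m x u (xi : leafc b k.+1) :
  Num.max (lqs m x true xi) (lqs m x false xi) <= lq m x u xi / pmin.
Proof. by rewrite ge_max !ler_pdivlMr // ![_ * pmin]mulrC !lqs_le_lq. Qed.

Lemma posterior_le_ln k m x u (xi : leafc b k.+1) :
  `|posterior m x u xi| <= `|ln (lqs m x true xi / lqs m x false xi)| / pmin.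
Proof.
have q0 : 0 < lq m x u xi by exact: lq_gt0.
rewrite /posterior normrM normfV (gtr0_norm q0) ler_pdivrMr //.
apply: le_trans (norm_sub_le_ln (lqs_gt0 _ _ _ _) (lqs_gt0 _ _ _ _)) _.
apply: le_trans (ler_wpM2r (normr_ge0 _) (max_lqs_le m x u xi)) _.
by rewrite le_eqVlt; apply/orP; left; apply/eqP; ring.
Qed.

Lemma posterior_bound k m x u (xi : leafc b k.+1) : `|posterior m x u xi| <= pmin^-1.
Proof.
have q0 : 0 < lq m x u xi by exact: lq_gt0.
rewrite /posterior normrM normfV (gtr0_norm q0) ler_pdivrMr // mulrC.
apply: le_trans (max_lqs_le m x u xi); rewrite le_max.
have := lqs_gt0 m x true xi; have := lqs_gt0 m x false xi => h1 h2.
by rewrite !ler_norml; case: (leP (lqs m x false xi) (lqs m x true xi)) => h; apply/orP;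
  [left|right]; lra.
Qed.

(** A chi-square quantity bounded by a Hellinger distance: [q1 - q2] factors through square roots,
    and the factor with the plus sign has square at most [2 * (q1 + q2)], hence at most [4 / pmin]
    times [lq m x u xi]. *)
Lemma posterior_var k m x u : fmean (@lq k.+1 m x u) (fun xi => posterior m x u xi ^+ 2) <=
  8 / pmin * \sum_i hellinger k m.-1 (i :: x).
Proof.
apply: le_trans (_ : 8 / pmin * (1 - \sum_xi Num.sqrt (@lqs k m x true xi * lqs m x false xi))
  <= _); last first.
  by rewrite ler_wpM2l ?hellinger_lqs // divr_ge0 // ltW.
apply: le_trans (_ : \sum_xi 4 / pmin * (Num.sqrt (@lqs k m x true xi) - Num.sqrt (lqs m x
  false xi)) ^+ 2 <= _); last first.
  rewrite -mulr_sumr; have -> : 8 / pmin = 4 / pmin * 2 by field; rewrite gt_eqF.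
  rewrite -[leRHS]mulrA ler_wpM2l ?divr_ge0 ?(ltW pmin_gt0) //.
  rewrite mulrBr mulr1 mulr_sumr -[X in X - _](_ : \sum_xi @lqs k m x true xi + \sum_xi @lqs k
    m x false xi = 2); last first.
    by rewrite !lqs_sum1; lra.
  rewrite -big_split -sumrB; apply: ler_sum => xi _ /=.
  have h1 := lqs_gt0 m x true xi; have h2 := lqs_gt0 m x false xi.
  by rewrite sqrrB !sqr_sqrtr ?(ltW h1) ?(ltW h2) // sqrtrM ?(ltW h1) //; lra.
apply: ler_sum => xi _.
have h1 := lqs_gt0 m x true xi; have h2 := lqs_gt0 m x false xi.
have q0 : 0 < lq m x u xi by exact: lq_gt0.
set q1 := lqs m x true xi in h1 *; set q2 := lqs m x false xi in h2 *.
have -> : lq m x u xi * posterior m x u xi ^+ 2 = (q1 - q2) ^+ 2 / lq m x u xi.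
  by rewrite /posterior -/q1 -/q2; field; rewrite gt_eqF.
rewrite ler_pdivrMr //.
have -> : (q1 - q2) ^+ 2 = (Num.sqrt q1 - Num.sqrt q2) ^+ 2 * (Num.sqrt q1 + Num.sqrt q2) ^+ 2.
  rewrite -exprMn; congr (_ ^+ 2).
  by rewrite -subr_sqr !sqr_sqrtr ?ltW.
rewrite [leRHS]mulrAC [leRHS]mulrC ler_wpM2l ?sqr_ge0 //.
apply: le_trans (_ : 2 * (q1 + q2) <= _).
  rewrite sqrrD !sqr_sqrtr ?(ltW h1) ?(ltW h2) //; have := sqrt_mul_le_half (ltW h1) (ltW h2).
  by rewrite sqrtrM ?(ltW h1) //; lra.
rewrite mulrAC ler_pdivlMr //.
have := lqs_le_lq m x u true xi; have := lqs_le_lq m x u false xi.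
by rewrite -/q1 -/q2; lra.
Qed.

(** The posterior is at most a sum of [b] log-likelihood ratios divided by [pmin]; a union bound
    over the children gives the level [d * pmin / b%:R]. *)
Lemma posterior_tail k m x u d : (0 < b)%N -> 0 < d ->
  fmean (@lq k.+1 m x u) (fun xi => (d < `|posterior m x u xi|)%R%:R) <=
  fmean (pk m x u) (fun a => \sum_i tail k m.-1 (i :: x) (Some a) (d * pmin / b%:R)).
Proof.
move=> b0 d0; rewrite fmean_lqS; apply: fmean_le => // a.
pose ind i (xi : leafc b k.+1) : R :=
  (d * pmin / b%:R < `|lr m.-1 (i :: x) (xi i)|)%R%:R.
have bR : (0:R) < b%:R by rewrite ltr0n.
have ind0 i xi : 0 <= ind i xi by rewrite ler0n.
apply: le_trans (_ : fmean (@lqs k m x a) (fun xi => \sum_i ind i xi) <= _).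
  apply: fmean_le => xi; first exact: lqs_gt0.
  have [h|_] := ltP; last exact: sumr_ge0.
  have [/existsP[i hi]|/existsPn na] :=
    boolP [exists i, d * pmin / b%:R < `|lr m.-1 (i :: x) (xi i)|].
    by rewrite (bigD1 i) //= {1}/ind hi lerDl sumr_ge0.
  exfalso; move: h; apply/negP; rewrite -leNgt; apply: le_trans (posterior_le_ln _ _ _ _) _.
  rewrite ler_pdivrMr // ln_lqs; apply: le_trans (ler_norm_sum _ _ _) _.
  apply: le_trans (_ : \sum_(i < b) d * pmin / b%:R <= _).
    by apply: ler_sum => i _; rewrite leNgt na.
  by rewrite sumr_const card_ord -[X in X <= _]mulr_natr divfK // gt_eqF.
change (pmean (fun i => @lq k m.-1 (i :: x) (Some a)) (fun xi => \sum_i ind i xi) <=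
  \sum_i tail k m.-1 (i :: x) (Some a) (d * pmin / b%:R)).
rewrite pmean_sum; apply: ler_sum => i _.
rewrite /ind (@pmean_coord _ _ _ _ _ i (fun z => (d * pmin / b%:R < `|lr m.-1 (i :: x)
  z|)%R%:R)) //.
by move=> j; exact: lq_sum1.
Qed.

(* Sub-Gaussian with variance proxy [o(1/k)]: the second moment decays
   exponentially in k, and so does the tail, at an arbitrarily large rate. *)
Lemma posterior_mgf : (0 < b)%N -> exists k, forall m x u s, (k < m)%N ->
  fmean (@lq k.+1 m x u) (fun xi => expR (s * posterior m x u xi)) <=
  expR ((4 * (k%:R + 2))^-1 * s ^+ 2).
Proof.
move=> b0; have /andP[l0 l1] := lam01.
set K := pmin^-1; have K0 : 0 < K by rewrite invr_gt0.
set mu := (1 + lam) / 2.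
have mu0 : 0 < mu by rewrite /mu; lra.
have mu1 : mu < 1 by rewrite /mu; lra.
have lmu : lam < mu by rewrite /mu; lra.
(* Where the posterior is at most [d], the exponential weight is at most [(mu / lam) ^+ (k + 2)];
   against the second moment of order [lam ^+ k] this leaves a multiple of [mu ^+ k]. *)
set d := ln (mu / lam) / (4 * K).
have d0 : 0 < d by rewrite divr_gt0 ?mulr_gt0 // ln_gt0 // ltr_pdivlMr // mul1r.
(* Where the posterior exceeds [d], the weight is only bounded by [expR (4 * K * K) ^+ (k + 2)]; [j]
   doublings of the rate beat this growth. *)
have [j Hj] : exists j, expR (4 * K * K) * lam ^+ (2 ^ j) <= mu.
  have l01' : 0 <= lam < 1 by rewrite l1 ltW.
  have [j Hj] := exists_natM_expr_le l01' (divr_gt0 mu0 (expR_gt0 (4 * K * K))).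
  exists j; rewrite mulrC -ler_pdivlMr ?expR_gt0 //; apply: le_trans Hj.
  apply: le_trans (_ : lam ^+ j <= _).
    apply: ler_wiXn2l; [exact: ltW|exact: ltW|]; exact/ltnW/ltn_expl.
  rewrite ler_peMl ?exprn_ge0 ?(ltW l0) //.
  by have : (0:R) <= j%:R by []; lra.
set rho := lam ^+ (2 ^ j) in Hj.
have rho0 : 0 < rho by rewrite exprn_gt0.
have d'0 : 0 < d * pmin / b%:R by rewrite divr_gt0 ?(mulr_gt0 d0) ?ltr0n.
have [C2 C20 HC2] := tail_pow j d'0.
set C1 := 8 * K * (b%:R / lam ^+ k0).
have C10 : 0 <= C1.
  by apply: mulr_ge0; [apply: mulr_ge0 => //; exact: ltW|apply: divr_ge0 => //;
    exact/ltW/exprn_gt0].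
set D1 := C1 * (mu / lam) ^+ 2.
have D10 : 0 <= D1 by rewrite mulr_ge0 // sqr_ge0.
set D2 := K ^+ 2 * (b%:R * C2) * expR (4 * K * K) ^+ 2.
have D20 : 0 <= D2.
  apply: mulr_ge0; last exact: sqr_ge0.
  by apply: mulr_ge0; [exact: sqr_ge0|apply: mulr_ge0].
have mu01 : 0 <= mu < 1 by rewrite mu1 ltW.
have DD : 0 < 4 * (D1 + D2 + 1) by rewrite mulr_gt0 // ltr_wpDl // addr_ge0.
have [k Hk] := exists_natM_expr_le mu01 (divr_gt0 ltr01 DD).
exists k => m x u s km.
have km' : (k <= m.-1)%N by rewrite -ltnS (ltn_predK km).
set kap := (4 * (k%:R + 2))^-1.
have k20 : 0 < k%:R + 2 :> R by rewrite ltr_wpDl.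
have kap0 : 0 < kap by rewrite invr_gt0 mulr_gt0.
apply: (mgf_le (K := K)) => //.
- by move=> xi; exact: lq_gt0.
- exact: lq_sum1.
- exact: posterior_mean0.
- by move=> xi; exact: posterior_bound.
have s0E : K / kap = (4 * K) * (k + 2)%:R.
  by rewrite /kap invrK natrD; ring.
apply: le_trans (_ : fmean (@lq k.+1 m x u) (fun xi => expR (K / kap * d) * posterior m x u xi
  ^+ 2 +
    K ^+ 2 * expR (K / kap * K) * (d < `|posterior m x u xi|)%R%:R) <= _).
  apply: fmean_le => xi; first exact: lq_gt0.
  have Kk : 0 <= K / kap by rewrite divr_ge0 // ltW.
  have [h|h] := ltP d `|posterior m x u xi|.
    apply: le_trans (_ : K ^+ 2 * expR (K / kap * K) <= _); last first.
      by rewrite mulr1 lerDr mulr_ge0 ?expR_ge0 ?sqr_ge0.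
    have hb := posterior_bound m x u xi.
    apply: ler_pM; rewrite ?sqr_ge0 ?expR_ge0 // ?ler_expR ?ler_wpM2l //.
    by rewrite -[leLHS]real_normK ?num_real // ler_sqr ?nnegrE // ltW.
  rewrite mulr0 addr0 mulrC ler_wpM2r ?sqr_ge0 // ler_expR ler_wpM2l //.
have -> : fmean (@lq k.+1 m x u) (fun xi => expR (K / kap * d) * posterior m x u xi ^+ 2 +
    K ^+ 2 * expR (K / kap * K) * (d < `|posterior m x u xi|)%R%:R) =
  expR (K / kap * d) * fmean (@lq k.+1 m x u) (fun xi => posterior m x u xi ^+ 2) +
  K ^+ 2 * expR (K / kap * K) * fmean (@lq k.+1 m x u) (fun xi => (d < `|posterior m x u xi|)%R%:R).
  by rewrite /fmean !mulr_sumr -big_split; apply: eq_bigr => xi _ /=; ring.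
have E1 : expR (K / kap * d) = (mu / lam) ^+ (k + 2).
  rewrite s0E /d mulrAC (_ : 4 * K * (ln (mu / lam) / (4 * K)) = ln (mu / lam)); last first.
    by field; rewrite gt_eqF.
  by rewrite expRM_natr lnK // posrE divr_gt0.
have E2 : expR (K / kap * K) = expR (4 * K * K) ^+ (k + 2).
  by rewrite s0E mulrAC expRM_natr.
have V1 : fmean (@lq k.+1 m x u) (fun xi => posterior m x u xi ^+ 2) <= C1 * lam ^+ k.
  apply: le_trans (posterior_var k m x u) _; rewrite /C1 -!mulrA ler_wpM2l //.
  rewrite ler_wpM2l ?(ltW K0) //.
  apply: le_trans (_ : \sum_(i < b) (lam ^+ k / lam ^+ k0) <= _).
    by apply: ler_sum => i _; exact: hellinger_decay.
  rewrite sumr_const card_ord -[X in X <= _]mulr_natl.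
  by rewrite ler_wpM2l // mulrC.
have V2 : fmean (@lq k.+1 m x u) (fun xi => (d < `|posterior m x u xi|)%R%:R) <= b%:R * C2 *
  rho ^+ k.
  apply: le_trans (posterior_tail k m x u b0 d0) _.
  have -> : b%:R * C2 * rho ^+ k = fmean (pk m x u) (fun=> b%:R * C2 * rho ^+ k).
    by rewrite /fmean -mulr_suml sum_pk mul1r.
  apply: fmean_le => // a.
  apply: le_trans (_ : \sum_(i < b) C2 * rho ^+ k <= _).
    by apply: ler_sum => i _; exact: HC2.
  by rewrite sumr_const card_ord -[X in X <= _]mulr_natl mulrA.
apply: le_trans (lerD (ler_wpM2l _ V1) (ler_wpM2l _ V2)) _.
- exact: expR_ge0.
- by apply: mulr_ge0; [exact: sqr_ge0|exact: expR_ge0].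
rewrite E1 E2.
have -> : (mu / lam) ^+ (k + 2) * (C1 * lam ^+ k) = D1 * mu ^+ k.
  rewrite exprD /D1 expr_div_n [in RHS]expr_div_n; field.
  by rewrite ?gt_eqF ?exprn_gt0.
have -> : K ^+ 2 * expR (4 * K * K) ^+ (k + 2) * (b%:R * C2 * rho ^+ k) =
    D2 * (expR (4 * K * K) * rho) ^+ k.
  by rewrite exprD exprMn /D2; ring.
apply: le_trans (_ : D1 * mu ^+ k + D2 * mu ^+ k <= _).
  rewrite lerD2l ler_wpM2l // lerXn2r ?nnegrE ?(ltW mu0) //.
  by rewrite mulr_ge0 ?expR_ge0 ?(ltW rho0).
rewrite -mulrDl /kap invfM -ler_pdivrMr ?invr_gt0 // invrK.
apply: le_trans (_ : (D1 + D2 + 1) * ((k%:R + 2) * mu ^+ k) <= _).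
  rewrite mulrAC -mulrA ler_wpM2r ?lerDl // mulr_ge0 ?(ltW k20) //.
  by rewrite exprn_ge0 // ltW.
apply: le_trans (ler_wpM2l _ Hk) _; first by rewrite addr_ge0 // addr_ge0.
rewrite le_eqVlt; apply/orP; left; apply/eqP; field.
by rewrite gt_eqF // ltr_wpDl // addr_ge0.
Qed.

End Observation.

(** * Overwriting the coordinates of a product one at a time *)

Section ProductSet.
Variables (R : realType) (I X : finType) (nu : I -> X -> R) (S : X -> X) (C : R).
Hypothesis nu_gt0 : forall i x, 0 < nu i x.
Hypothesis nu_sum1 : forall i, \sum_x nu i x = 1.
Hypothesis C_ge1 : 1 <= C.
Hypothesis S_dom : forall i x, push (nu i) S x <= C * nu i x.

Let set1 i (d : {ffun I -> X}) := upd d i (S (d i)).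

Fixpoint setseq (s : seq I) (d : {ffun I -> X}) : {ffun I -> X} :=
  if s is i :: s' then setseq s' (set1 i d) else d.

Lemma setseqE s d j : uniq s -> setseq s d j = if j \in s then S (d j) else d j.
Proof.
elim: s d => //= i s IH d /andP[is_ us]; rewrite IH // /set1 !ffunE inE.
by case: eqP => [->|_] //=; rewrite (negbTE is_).
Qed.

Lemma pmean_set1 i (G : {ffun I -> X} -> R) : (forall d, 0 <= G d) ->
  pmean nu (fun d => G (set1 i d)) <= C * pmean nu G.
Proof.
move=> G0; rewrite -(pmean_resample nu_sum1 i) -[in leRHS](pmean_resample nu_sum1 i).
rewrite -pmeanZ; apply: pmean_le => // d.
rewrite (eq_bigr (fun e => nu i e * G (upd d i (S e)))) => [|e _]; last first.
  by rewrite /set1 upd_upd ffunE eqxx.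
rewrite (sum_push _ S (fun y => G (upd d i y))) mulr_sumr; apply: ler_sum => y _.
by rewrite mulrA ler_wpM2r.
Qed.

(** Telescoping: each coordinate costs a factor 2 from the square of a sum and, as later differences
    are taken at a point already changed, a factor [C] from [pmean_set1]. *)
Lemma pmean_setseq (s : seq I) (F : {ffun I -> X} -> R) :
  pmean nu (fun d => (F d - F (setseq s d)) ^+ 2) <=
  (2 * C) ^+ size s * \sum_(i <- s) pmean nu (fun d => (F d - F (set1 i d)) ^+ 2).
Proof.
elim: s => [|i s IH] /=.
  rewrite big_nil mulr0 /pmean big1 // => d _; by rewrite subrr expr0n mulr0.
have sq0 G : 0 <= pmean nu (fun d => (F d - F (G d)) ^+ 2).
  by apply: pmean_ge0 => // d; exact: sqr_ge0.
apply: le_trans (_ : 2 * pmean nu (fun d => (F d - F (set1 i d)) ^+ 2) +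
  2 * pmean nu (fun d => (F (set1 i d) - F (setseq s (set1 i d))) ^+ 2) <= _).
  rewrite -!pmeanZ -pmeanD; apply: pmean_le => // d.
  set a := F d; set e := F (set1 i d); set c := F _.
  by have := sqr_ge0 (a - e - (e - c)); rewrite !expr2; lra.
have H := pmean_set1 i (G := fun d => (F d - F (setseq s d)) ^+ 2) (fun d => sqr_ge0 _).
rewrite big_cons; set A := pmean nu (fun d => (F d - F (set1 i d)) ^+ 2).
set S0 := \sum_(j <- s) _ in IH *.
have C0 : 0 <= C by apply: le_trans C_ge1.
have S00 : 0 <= S0 by apply: sumr_ge0 => j _; exact: sq0.
have A0 : 0 <= A by exact: sq0.
have P1 : 1 <= (2 * C) ^+ size s by rewrite exprn_ege1 //; have := C_ge1; lra.
have H2 := ler_wpM2l C0 IH.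
have H3 : 2 * pmean nu (fun d => (F (set1 i d) - F (setseq s (set1 i d))) ^+ 2) <=
   (2 * C) ^+ (size s).+1 * S0.
  apply: le_trans (ler_wpM2l _ H) _ => //.
  by rewrite exprS -!mulrA ler_wpM2l.
rewrite mulrDr; apply: lerD => //; rewrite ler_wpM2r // exprS.
by apply: le_trans (_ : 2 * 1 * 1 <= _); [lra|apply: ler_pM => //; have := C_ge1; lra].
Qed.

Lemma pmean_setall (F : {ffun I -> X} -> R) :
  pmean nu (fun d => (F d - F [ffun i => S (d i)]) ^+ 2) <=
  (2 * C) ^+ #|I| * pmean nu (fun d => \sum_i
     fmean (nu i) (fun e => (F (upd d i e) - F (upd d i (S e))) ^+ 2)).
Proof.
have E (d : {ffun I -> X}) : [ffun i => S (d i)] = setseq (enum I) d.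
  by apply/ffunP => i; rewrite setseqE ?enum_uniq // mem_enum ffunE.
have := pmean_setseq (enum I) F; rewrite -cardE big_enum /= => H.
rewrite (_ : (fun d : {ffun I -> X} => (F d - F [ffun i => S (d i)]) ^+ 2) =
  fun d => (F d - F (setseq (enum I) d)) ^+ 2); last first.
  by apply/funext => d; rewrite E.
apply: le_trans H _; rewrite pmean_sum le_eqVlt; apply/orP; left; apply/eqP.
congr (_ * _); apply: eq_bigr => i _.
rewrite -(pmean_resample nu_sum1 i); apply: eq_bigr => d _; congr (_ * _).
by apply: eq_bigr => e _; rewrite /set1 upd_upd ffunE eqxx.
Qed.

End ProductSet.

Fixpoint plus_conf (b m : nat) : conf b m :=
  match m return conf b m with
  | 0 => tt
  | m'.+1 => (true, [ffun=> plus_conf b m'])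
  end.

(** The value of [leaf] on trees too shallow to have spins at depth [k]. *)
Fixpoint dflt_leafc (b k : nat) : leafc b k :=
  match k return leafc b k with
  | 0 => true
  | k'.+1 => [ffun=> dflt_leafc b k']
  end.

Fixpoint leaf (b k m : nat) : conf b m -> leafc b k :=
  match m return conf b m -> leafc b k with
  | 0 => fun _ => dflt_leafc b k
  | m'.+1 => match k return conf b m'.+1 -> leafc b k with
    | 0 => fun c => c.1
    | k'.+1 => fun c => [ffun i => @leaf b k' m' (c.2 i)]
    end
  end.

(** Forgets the first [k] levels, so that a function of [set_top k c] is a function of the spins at
    depth at least [k]. *)
Fixpoint set_top (b k m : nat) : conf b m -> conf b m :=
  match k, m return conf b m -> conf b m with
  | k'.+1, m'.+1 => fun c => (true, [ffun i => @set_top b k' m' (c.2 i)])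
  | _, _ => fun c => c
  end.

Arguments leaf {b} k {m} c.
Arguments set_top {b} k {m} c.

Definition flip (b m : nat) : conf b m -> conf b m :=
  match m return conf b m -> conf b m with
  | 0 => id
  | m'.+1 => fun c => (~~ c.1, c.2)
  end.

Arguments flip {b m} c.

(** * The log-Sobolev inequality for contracting chains *)

Section RootInequality.
Variables (R : realType) (b : nat).
Variable pk : nat -> seq 'I_b -> option bool -> bool -> R.
Variable pmin : R.
Hypothesis pmin_gt0 : 0 < pmin.
Hypothesis pk_ge : forall m x u a, pmin <= pk m x u a.
Hypothesis pk_sum1 : forall m x u, pk m x u true + pk m x u false = 1.

Let pk_gt0 m x u a : 0 < pk m x u a. Proof. exact: lt_le_trans (pk_ge _ _ _ _). Qed.

Let sum_pk m x u : \sum_a pk m x u a = 1.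
Proof. by rewrite big_bool; exact: pk_sum1. Qed.

Let pk_le1 m x u a : pk m x u a <= 1.
Proof.
by have := pk_sum1 m x u; have := pk_gt0 m x u (~~ a); case: a => /=; lra.
Qed.

Let pmin_le1 : pmin <= 1. Proof. exact: le_trans (pk_ge 0 [::] None true) (pk_le1 _ _ _ _). Qed.

Local Notation nu := (nu pk).
Local Notation nuc := (nuc pk).
Local Notation Ex := (Ex pk).

Lemma leaf_set_top k m (c : conf b m) : leaf k (set_top k c) = leaf k c.
Proof.
elim: k m c => [|k IH] [|m] c //=.
by apply/ffunP => i; rewrite !ffunE IH.
Qed.

Lemma leaf_same_top k m (c d : conf b m) : same_top k.+1 c d -> leaf k c = leaf k d.
Proof.
elim: k m c d => [|k IH] [|m] c d //=; first by case.
by case=> _ H; apply/ffunP => i; rewrite !ffunE; apply: IH; exact: H.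
Qed.

Lemma same_top_eq m (c d : conf b m) : same_top m c d -> c = d.
Proof.
elim: m c d => [|m IH] [] // => [[]|a c] [] // a' c' /= [<- H].
by congr (_, _); apply/ffunP => i; apply: IH; exact: H.
Qed.

Lemma set_top_const k m (c d : conf b m) : (m <= k)%N -> set_top k c = set_top k d.
Proof.
elim: k m c d => [|k IH] [|m] c d //=; try by case: c; case: d.
by move=> mk; congr (_, _); apply/ffunP => i; rewrite !ffunE; exact: IH.
Qed.

Lemma sum_confS_cond m (P : pred (conf b m.+1)) (F : conf b m.+1 -> R) :
  \sum_(c | P c) F c = \sum_a \sum_(d | P (a, d)) F (a, d).
Proof.
by rewrite (pair_big_dep xpredT (fun a d => P (a, d))); apply: eq_big => -[].
Qed.

Lemma push_leaf k m x u (xi : leafc b k) : (k <= m)%N ->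
  push (@nu m.+1 x u) (leaf k) xi = lq pk m x u xi.
Proof.
elim: k m x u xi => [|k IH] m x u xi km.
  rewrite /push sum_confS_cond /= (bigD1 xi) //= [X in _ + X]big1; last first.
    by move=> a /negbTE ax; rewrite big_pred0 // => d; rewrite ax.
  rewrite addr0 (eq_bigl xpredT) => [|d]; last by rewrite eqxx.
  by rewrite -mulr_sumr pnu_sum1 ?mulr1 // => i; exact: nu_sum1.
case: m km => // m km; rewrite /push sum_confS_cond; apply: eq_bigr => a _.
rewrite /= -mulr_sumr; congr (_ * _).
rewrite -/(push (pnu (fun i => @nu m.+1 (i :: x) (Some a)))
  (fun d : {ffun 'I_b -> conf b m.+1} => [ffun i => leaf k (d i)]) xi) push_pnu.
by apply: eq_bigr => i _; exact: IH.
Qed.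

(* The law of the configuration below depth k given the spins at depth k. *)
Fixpoint low (k m : nat) : seq 'I_b -> conf b m -> R :=
  match m return seq 'I_b -> conf b m -> R with
  | 0 => fun _ _ => 1
  | m'.+1 => match k return seq 'I_b -> conf b m'.+1 -> R with
    | 0 => fun x c => pnu (X := conf b m') (nuc x c.1) c.2
    | k'.+1 => fun x c => c.1%:R * pnu (X := conf b m') (fun i => low k' (i :: x)) c.2
    end
  end.

(** The root weight [w] may be signed: [root_sign_posterior] takes the values 1 and -1. *)
Lemma push_set_topS k m x (w : bool -> R) (e0 : bool) (d : {ffun 'I_b -> conf b m.+1}) :
  (k <= m)%N ->
  (forall y u e, push (@nu m.+1 y u) (set_top k) e = low k y e * lq pk m y u (leaf k e)) ->
  push (fun c : conf b m.+2 => w c.1 * pnu (X := conf b m.+1) (nuc x c.1) c.2) (set_top k.+1)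
    ((e0, d) : conf b m.+2) =
  low k.+1 x ((e0, d) : conf b m.+2) *
  (w true * lqs pk m.+1 x true (leaf k.+1 ((e0, d) : conf b m.+2) : leafc b k.+1) +
   w false * lqs pk m.+1 x false (leaf k.+1 ((e0, d) : conf b m.+2) : leafc b k.+1)).
Proof.
move=> km IH; case: e0; last first.
  by rewrite /push big1 /= ?mul0r // => c /eqP.
rewrite /push sum_confS_cond /= mul1r.
have H a : \sum_(d0 : {ffun 'I_b -> conf b m.+1} |
      (true, [ffun i => set_top k (d0 i)]) == (true, d) :> conf b m.+2)
    w a * pnu (nuc x a) d0 =
    w a * (pnu (fun i => low k (i :: x)) d * lqs pk m.+1 x a (leaf k.+1 ((true, d) : conf b
      m.+2) : leafc b k.+1)).
  rewrite -mulr_sumr; congr (_ * _).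
  rewrite (eq_bigl (fun d0 : {ffun 'I_b -> conf b m.+1} => [ffun i => set_top k (d0 i)] == d));
    last first.
    by move=> d0; rewrite xpair_eqE eqxx.
  rewrite -/(push (pnu (nuc x a))
    (fun d : {ffun 'I_b -> conf b m.+1} => [ffun i => set_top k (d i)]) d) push_pnu.
  rewrite /lqs /pnu -big_split; apply: eq_bigr => i _ /=.
  by rewrite ffunE; exact: IH.
by rewrite big_bool /= !H; ring.
Qed.

(** The Markov property: the parent state [u] enters the law of the spins at depth at least [k] only
    through the likelihood of those at depth [k]. *)
Lemma push_set_top k m x u (d : conf b m.+1) : (k <= m)%N ->
  push (nu x u) (set_top k) d = low k x d * lq pk m x u (leaf k d).
Proof.
elim: k m x u d => [|k IH] m x u d km.
  by rewrite /push /= big_pred1_eq mulrC.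
case: m d km => // m [e d] km; rewrite lqS.
by rewrite -(@push_set_topS k m x (pk m.+1 x u) e d) // => y v e'; exact: IH.
Qed.

Lemma nu_ratio m x u v (c : conf b m) : pmin * nu x u c <= nu x v c.
Proof.
case: m c => [|m] c /=; first by rewrite mulr1.
rewrite mulrA ler_pM2r; last by apply: pnu_gt0 => *; exact: nu_gt0.
by apply: le_trans (pk_ge m x v c.1); rewrite ler_piMr // ltW.
Qed.

Lemma pnu_ratio m x a a' (d : {ffun 'I_b -> conf b m}) :
  pmin ^+ b * pnu (nuc x a) d <= pnu (nuc x a') d.
Proof.
rewrite -{1}[b]card_ord -prodr_const /pnu -big_split /=.
apply: ler_prod => i _; rewrite nu_ratio andbT mulr_ge0 ?(ltW pmin_gt0) //.
exact/ltW/nu_gt0.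
Qed.

(** Bounds the density of the law of [set_top k c]. Of the factors [pmin], [b] are for the children,
    whose parent spin is changed, and one is for the forced root spin. *)
Fixpoint cdom (k : nat) : R := if k is k'.+1 then cdom k' ^+ b / pmin ^+ b.+1 else 1.

Lemma cdom_ge1 k : 1 <= cdom k.
Proof.
elim: k => //= k IH; rewrite ler_pdivlMr ?exprn_gt0 // mul1r.
apply: le_trans (_ : 1 <= _); first by rewrite exprn_ile1 // ltW.
by rewrite exprn_ege1.
Qed.

Lemma push_set_top_le k m x u (d : conf b m) :
  push (nu x u) (set_top k) d <= cdom k * nu x u d.
Proof.
have nu0 := @nu_gt0 _ _ _ pk_gt0.
elim: k m x u d => [|k IH] m x u d; first by rewrite /push /= big_pred1_eq mul1r.
case: m d => [|m] d.
  by rewrite /push /= big_pred1_eq mulr1; exact: (cdom_ge1 k.+1).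
suff key (e : bool) (d0 : {ffun 'I_b -> conf b m}) :
    push (nu x u) (set_top k.+1) ((e, d0) : conf b m.+1) <=
    cdom k.+1 * nu x u ((e, d0) : conf b m.+1) by case: d => e d; exact: key.
move: d0 => {}d; case: e; last first.
  rewrite /push big1 => [|c /eqP //]; apply: mulr_ge0; last exact/ltW/nu0.
  exact: le_trans (cdom_ge1 _).
have H a : \sum_(d0 : {ffun 'I_b -> conf b m} |
      (true, [ffun i => set_top k (d0 i)]) == (true, d) :> conf b m.+1)
    pk m x u a * pnu (nuc x a) d0 <= pk m x u a * (cdom k ^+ b / pmin ^+ b * pnu (nuc x true) d).
  rewrite -mulr_sumr ler_pM2l //.
  rewrite (eq_bigl (fun d0 : {ffun 'I_b -> conf b m} => [ffun i => set_top k (d0 i)] == d));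
    last first.
    by move=> d0; rewrite xpair_eqE eqxx.
  rewrite -/(push (pnu (nuc x a))
    (fun d : {ffun 'I_b -> conf b m} => [ffun i => set_top k (d i)]) d) push_pnu.
  apply: le_trans (_ : cdom k ^+ b * pnu (nuc x a) d <= _).
    have -> : cdom k ^+ b = \prod_(i < b) cdom k by rewrite prodr_const card_ord.
    rewrite /pnu -big_split /=; apply: ler_prod => i _; rewrite IH andbT.
    by apply: sumr_ge0 => c _; exact/ltW/nu0.
  rewrite -mulrA ler_wpM2l ?exprn_ge0 //; first exact: le_trans (cdom_ge1 _).
  by rewrite mulrC ler_pdivlMr ?exprn_gt0 // mulrC pnu_ratio.
rewrite /push sum_confS_cond big_bool; apply: le_trans (lerD (H true) (H false)) _.
rewrite -mulrDl pk_sum1 mul1r.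
have P0 : 0 <= pnu (nuc x true) d by apply/ltW/pnu_gt0 => *; exact: nu0.
have A0 : 0 <= cdom k ^+ b / pmin ^+ b.
  by apply: divr_ge0; apply: exprn_ge0; [exact: le_trans (cdom_ge1 _)|exact: ltW].
have -> : cdom k.+1 * nu x u ((true, d) : conf b m.+1) =
    cdom k ^+ b / pmin ^+ b * pnu (nuc x true) d * (pk m x u true / pmin).
  by rewrite /= exprS invfM /nuc; ring.
apply: ler_peMr; first exact: mulr_ge0 A0 P0.
by rewrite ler_pdivlMr // mul1r.
Qed.

Lemma Ex_set_top_le k m x u (G : conf b m -> R) : (forall c, 0 <= G c) ->
  Ex x u (fun c => G (set_top k c)) <= cdom k * Ex x u G.
Proof.
move=> G0; rewrite /Ex /fmean sum_push mulr_sumr; apply: ler_sum => d _.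
by rewrite mulrA ler_wpM2r // push_set_top_le.
Qed.

Definition root_grad : functional R b := fun m x u f =>
  Ex x u (fun c => (Num.sqrt (f c) - Num.sqrt (f (flip c))) ^+ 2).

Lemma root_grad_nonneg : nonneg root_grad.
Proof. by move=> m x u f f0; apply: Ex_ge0 => // c; exact: sqr_ge0. Qed.

Fixpoint dset (k : nat) : R :=
  if k is k'.+1 then 2 + 2 / pmin ^+ b.+1 * ((2 * cdom k') ^+ b * dset k') else 0.

Lemma dset_ge0 k : 0 <= dset k.
Proof.
elim: k => //= k IH; rewrite addr_ge0 // mulr_ge0 //.
  by rewrite divr_ge0 // exprn_ge0 // ltW.
by rewrite mulr_ge0 // exprn_ge0 // mulr_ge0 //; exact: le_trans (cdom_ge1 _).
Qed.

(** The root is flipped if necessary, then the subtrees of the children are overwritten one by one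
    ([pmean_setall]); only single-spin gradients at depth less than [k] appear. *)
Lemma set_top_var k m x u (f : conf b m -> R) : (forall c, 0 <= f c) ->
  Ex x u (fun c => (Num.sqrt (f c) - Num.sqrt (f (set_top k c))) ^+ 2) <=
  dset k * tot pk k root_grad x u f.
Proof.
have nuc0 m' x' a i := @nuc_gt0 _ _ _ pk_gt0 m' x' a i.
have tot0 k' := tot_nonneg pk_gt0 k' root_grad_nonneg.
elim: k m x u f => [|k IH] m x u f f0.
  by rewrite mul0r /Ex /fmean big1 // => c _; rewrite subrr expr0n mulr0.
case: m f f0 => [|m] f f0.
  rewrite {1}/Ex /fmean big1 => [|c _]; last by rewrite subrr expr0n mulr0.
  by apply: mulr_ge0; [exact: dset_ge0|exact: (tot0 k.+1)].
pose F c := Num.sqrt (f c).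
pose H a (d : {ffun 'I_b -> conf b m}) := (F (a, d) - F (a, [ffun i => set_top k (d i)])) ^+ 2.
have H0 a d : 0 <= H a d by exact: sqr_ge0.
have E1 : Ex x u (fun c => (Num.sqrt (f c) - Num.sqrt (f (set_top k.+1 c))) ^+ 2) <=
    2 * root_grad x u f + 2 * Ex x u (fun c : conf b m.+1 => H true c.2).
  rewrite /root_grad /Ex /fmean !mulr_sumr -big_split; apply: ler_sum => -[a d] _ /=.
  have n0 := ltW (nu_gt0 pk_gt0 x u ((a, d) : conf b m.+1)).
  rewrite [in leRHS]mulrCA [X in _ <= _ + X]mulrCA -mulrDr ler_wpM2l //.
  rewrite /H /F; set e := Num.sqrt (f (true, d)); set g := Num.sqrt (f (true, _)).
  case: a n0 => n0 /=; rewrite -/e.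
    have := sqr_ge0 (e - Num.sqrt (f (false, d))); have := sqr_ge0 (e - g); lra.
  set z := Num.sqrt _; have := sqr_ge0 ((z - e) - (e - g)); rewrite !expr2; lra.
apply: le_trans E1 _.
(* Once the root is set to [true], the subtrees still follow the law given the old root spin. The
   change of law costs [pmin ^+ b], and keeping only the term [true] of the mean costs one more
   [pmin]. *)
have E2 : Ex x u (fun c : conf b m.+1 => H true c.2) <=
    (pmin ^+ b.+1)^-1 * fmean (pk m x u) (fun a => pmean (nuc x a) (H a)).
  rewrite ExS.
  apply: le_trans (_ : (pmin ^+ b)^-1 * pmean (nuc x true) (H true) <= _).
    have -> : (pmin ^+ b)^-1 * pmean (nuc x true) (H true) =
        fmean (pk m x u) (fun=> (pmin ^+ b)^-1 * pmean (nuc x true) (H true)).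
      by rewrite /fmean -mulr_suml sum_pk mul1r.
    apply: fmean_le => // a; rewrite /pmean mulr_sumr; apply: ler_sum => d _ /=.
    by rewrite [leRHS]mulrA ler_wpM2r // ler_pdivlMl ?exprn_gt0 // pnu_ratio.
  rewrite exprS invfM [_^-1 * _^-1]mulrC -mulrA ler_wpM2l ?invr_ge0 ?exprn_ge0 ?(ltW pmin_gt0) //.
  rewrite ler_pdivlMl // /fmean big_bool /=.
  apply: le_trans (_ : pk m x u true * pmean (nuc x true) (H true) <= _).
    by rewrite ler_wpM2r // pmean_ge0 // => *; exact: nuc0.
  by rewrite lerDl mulr_ge0 ?(ltW (pk_gt0 _ _ _ _)) // pmean_ge0 // => *; exact: nuc0.
have E3 : fmean (pk m x u) (fun a => pmean (nuc x a) (H a)) <=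
    (2 * cdom k) ^+ b * dset k * lift pk (tot pk k root_grad) x u f.
  rewrite /= /fmean mulr_sumr; apply: ler_sum => a _ /=.
  rewrite [leRHS]mulrCA ler_pM2l // /H.
  have := @pmean_setall R _ _ (nuc x a) (@set_top b k m) (cdom k) (nuc0 _ _ _)
    (fun i => @nuc_sum1 _ _ _ pk_sum1 m x a i) (cdom_ge1 k)
    (fun i c => @push_set_top_le k m (i :: x) (Some a) c) (fun d => F (a, d)).
  move/le_trans; apply.
  rewrite card_ord -mulrA ler_wpM2l ?exprn_ge0 //.
    by rewrite mulr_ge0 //; exact: le_trans (cdom_ge1 _).
  rewrite -pmeanZ; apply: pmean_le => [i c|d]; first exact: nuc0.
  rewrite mulr_sumr; apply: ler_sum => i _.
  exact: (IH m (i :: x) (Some a) (fun e => f (a, upd d i e))).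
have L0 : 0 <= lift pk (tot pk k root_grad) x u f by apply: lift_nonneg.
have G0 : 0 <= root_grad x u f by exact: root_grad_nonneg.
set T := lift pk (tot pk k root_grad) x u f in E3 L0 *.
set Q := root_grad x u f in G0 *.
set c1 := (pmin ^+ b.+1)^-1 in E2 *.
have c10 : 0 <= c1 by rewrite invr_ge0 exprn_ge0 // ltW.
set D := (2 * cdom k) ^+ b * dset k in E3 *.
have D0 : 0 <= D.
  rewrite mulr_ge0 ?dset_ge0 // exprn_ge0 // mulr_ge0 //; exact: le_trans (cdom_ge1 _).
have E4 := ler_wpM2l c10 E3.
have -> : dset k.+1 * tot pk k.+1 root_grad x u f = (2 + 2 * c1 * D) * (Q + T).
  by [].
have := mulr_ge0 (mulr_ge0 c10 D0) G0.
have : Ex x u (fun c : conf b m.+1 => H true c.2) <= c1 * (D * T) by exact: le_trans E2 E4.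
lra.
Qed.

Lemma fmean_CS (I : finType) (p u v : I -> R) : (forall i, 0 < p i) ->
  fmean p (fun i => u i * v i) ^+ 2 <=
  fmean p (fun i => u i ^+ 2) * fmean p (fun i => v i ^+ 2).
Proof.
move=> p0; set A := fmean p (fun i => u i ^+ 2); set B := fmean p (fun i => v i ^+ 2).
set D := fmean p _.
have B0 : 0 <= B by apply: fmean_ge0 => // i; exact: sqr_ge0.
have [Bz|Bn] := eqVneq B 0.
  have v0 i : v i = 0.
    by have /eqP := fmean_eq0 p0 (fun i => sqr_ge0 (v i)) Bz i; rewrite sqrf_eq0 => /eqP.
  rewrite Bz mulr0 /D /fmean big1 ?expr0n // => i _; by rewrite v0 !mulr0.
have Bp : 0 < B by rewrite lt_def Bn.
have : 0 <= fmean p (fun i => (B * u i - D * v i) ^+ 2).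
  by apply: fmean_ge0 => // i; exact: sqr_ge0.
have sq y z : fmean p (fun i => (y * u i - z * v i) ^+ 2) =
    y * y * A - 2 * y * z * D + z * z * B.
  rewrite /A /D /B /fmean !mulr_sumr -sumrB -big_split.
  by apply: eq_bigr => i _ /=; ring.
rewrite sq.
have -> : B * B * A - 2 * B * D * D + D * D * B = B * (A * B - D ^+ 2) by ring.
by rewrite pmulr_rge0 // subr_ge0.
Qed.

(** The function whose pairing with [f] is the difference of the two conditional means of [f] given
    the root spin, see [root_signE]. *)
Definition root_sign m x u (c : conf b m.+1) : R :=
  if c.1 then (pk m x u true)^-1 else - (pk m x u false)^-1.

Lemma root_signE m x u (f : conf b m.+1 -> R) :
  Ex x u (fun c => root_sign x u c * f c) =
  pmean (nuc x true) (fun d => f (true, d)) - pmean (nuc x false) (fun d => f (false, d)).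
Proof.
rewrite ExS /fmean big_bool /= /root_sign /= !pmeanZ.
by field; rewrite !gt_eqF.
Qed.

Lemma root_sign_bound m x u (c : conf b m.+1) : `|root_sign x u c| <= pmin^-1.
Proof.
rewrite /root_sign; case: c.1; rewrite ?normrN ger0_norm ?invr_ge0 ?(ltW (pk_gt0 _ _ _ _)) //;
  by rewrite lef_pV2 ?posrE.
Qed.

(** By [fent_bool_le] it suffices to bound the mean of [root_sign * f]. As [root_sign] and [V] agree
    against functions of [set_top k c], this mean is [A + B], where [A] pairs [V] with [f] and [B]
    involves only the change of [f] under [set_top k]. The variational principle with
    [g = expR (s * V)] bounds [A] by entropies; Cauchy-Schwarz bounds [B] by [W]. *)
Lemma root_ent_le k l m x u kappa (V f : conf b m.+1 -> R) :
  0 < kappa -> (forall c, 0 <= f c) ->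
  (forall F : conf b m.+1 -> R, Ex x u (fun c => root_sign x u c * F (set_top k c)) =
     Ex x u (fun c => V c * F (set_top k c))) ->
  (forall c, `|V c| <= pmin^-1) ->
  (forall s, Ex x u (fun c => expR (s * V c)) <= expR (kappa * s ^+ 2)) ->
  (forall c d, same_top l c d -> V c = V d) ->
  root_ent pk x u f <= 2 * kappa * tot pk l (root_ent pk) x u f +
    4 * pmin^-1 ^+ 2 * (1 + cdom k) *
    Ex x u (fun c => (Num.sqrt (f c) - Num.sqrt (f (set_top k c))) ^+ 2).
Proof.
move=> kap0 f0 JV VK mgf Vl.
set T := tot _ _ _ _ _ _; set W := Ex x u (fun c => _ ^+ 2).
have nu0 := @nu_gt0 _ _ _ pk_gt0 m.+1 x u.
have T0 : 0 <= T by apply: tot_nonneg => //; exact: root_ent_nonneg.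
have W0 : 0 <= W by apply: Ex_ge0 => // c; exact: sqr_ge0.
have cd0 : 0 <= 1 + cdom k by rewrite addr_ge0 //; exact: le_trans (cdom_ge1 _).
set K := pmin^-1 in VK *.
have K0 : 0 < K by rewrite invr_gt0.
pose fb a := pmean (nuc x a) (fun d => f (a, d)).
have fb0 a : 0 <= fb a by apply: pmean_ge0 => // *; exact: nuc_gt0.
have ME : fmean (pk m x u) fb = Ex x u f by rewrite ExS.
have RHS0 : 0 <= 2 * kappa * T + 4 * K ^+ 2 * (1 + cdom k) * W.
  by apply: addr_ge0; apply: mulr_ge0 => //; apply: mulr_ge0 => //;
    [exact: ltW | apply: mulr_ge0 => //; exact: sqr_ge0].
have [M0|Mn] := eqVneq (Ex x u f) 0.
  have fz a : fb a = 0 by apply: (fmean_eq0 (pk_gt0 m x u) fb0); rewrite ME.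
  apply: le_trans RHS0; rewrite /= /fent -/fb ME M0 mul0r subr0 /fmean big1 // => a _.
  by rewrite -/(fb a) fz mul0r mulr0.
have M0 : 0 < Ex x u f by rewrite lt_def Mn Ex_ge0.
set M := Ex x u f in ME M0 *.
have := fent_bool_le (pk_gt0 m x u) (pk_sum1 m x u) fb0; rewrite ME => /(_ M0) H.
apply: le_trans H _; rewrite ler_pdivrMr //.
set F := fun c => Num.sqrt (f c).
have FE c : F c ^+ 2 = f c by rewrite sqr_sqrtr.
have DE : fb true - fb false = Ex x u (fun c => V c * f c) +
    Ex x u (fun c => (root_sign x u c - V c) * (f c - f (set_top k c))).
  rewrite -(root_signE x u); apply/eqP; rewrite -subr_eq0; apply/eqP.
  transitivity (Ex x u (fun c => root_sign x u c * f (set_top k c)) -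
                Ex x u (fun c => V c * f (set_top k c))); last by rewrite JV subrr.
  rewrite /Ex /fmean -!sumrB -big_split -sumrB; apply: eq_bigr => c _ /=; ring.
set A := Ex x u (fun c => V c * f c) in DE.
set B := Ex x u (fun c => _ * (_ - _)) in DE.
have HA : A ^+ 2 <= 4 * kappa * M * T.
  have var s : s * A <= T + M * (kappa * s ^+ 2).
    have := @chain_rule R b pk pk_gt0 pk_sum1 l m.+1 x u f (fun c => expR (s * V c)).
    have -> : Ex x u (fun c => f c * ln (expR (s * V c))) = s * A.
      rewrite /A /Ex /fmean mulr_sumr; apply: eq_bigr => c _; rewrite expRK; ring.
    move=> /(_ _ f0 _ _) H; apply: le_trans (H _ _ _) _.
    - by move=> c d cd; rewrite (Vl c d cd).
    - by move=> c; exact: expR_ge0.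
    - by move=> c _; exact: expR_gt0.
    rewrite lerD2l ler_pM2l // -[leRHS]expRK ler_ln ?posrE ?expR_gt0 //.
    apply: (fmean_gt0 nu0 _ (expR_gt0 (s * V (plus_conf b m.+1)))) => c.
    exact: expR_ge0.
  have kM : 0 < 4 * kappa * M by rewrite !mulr_gt0.
  (* The optimal [s]. *)
  have := var (A / (2 * kappa * M)).
  have -> : A / (2 * kappa * M) * A = 2 * (A ^+ 2 / (4 * kappa * M)).
    by field; rewrite !gt_eqF.
  have -> : M * (kappa * (A / (2 * kappa * M)) ^+ 2) = A ^+ 2 / (4 * kappa * M).
    by field; rewrite !gt_eqF.
  by move=> H'; rewrite mulrC -ler_pdivrMr //; lra.
have HB : B ^+ 2 <= 8 * K ^+ 2 * (1 + cdom k) * W * M.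
  have B1 : `|B| <= 2 * K * Ex x u (fun c => `|F c - F (set_top k c)| * (F c + F (set_top k c))).
    rewrite /B /Ex /fmean mulr_sumr; apply: le_trans (ler_norm_sum _ _ _) _.
    apply: ler_sum => c _; rewrite normrM (ger0_norm (ltW (nu0 c))).
    rewrite [leRHS]mulrCA ler_pM2l // normrM.
    apply: ler_pM => //.
      apply: le_trans (ler_normB _ _) _; have := root_sign_bound x u c; have := VK c.
      by rewrite -/K; lra.
    rewrite -2!FE subr_sqr normrM [X in _ * X <= _]ger0_norm // addr_ge0 // sqrtr_ge0 //.
  set E1 := Ex x u _ in B1.
  have CS : E1 ^+ 2 <= W * (2 * (1 + cdom k) * M).
    apply: le_trans (fmean_CS _ _ nu0) _; apply: ler_pM.
    - by apply: fmean_ge0 => // c; exact: sqr_ge0.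
    - by apply: fmean_ge0 => // c; exact: sqr_ge0.
    - rewrite le_eqVlt; apply/orP; left; apply/eqP; apply: eq_bigr => c _.
      by rewrite real_normK ?num_real.
    apply: le_trans (_ : 2 * (Ex x u f + Ex x u (fun c => f (set_top k c))) <= _).
      rewrite /Ex /fmean -big_split mulr_sumr; apply: ler_sum => c _ /=.
      rewrite -mulrDr [leRHS]mulrCA (ler_pM2l (nu0 c)) -(FE c) -(FE (set_top k c)).
      by have := sqr_ge0 (F c - F (set_top k c)); rewrite !expr2; lra.
    by rewrite -mulrA ler_pM2l // mulrDl mul1r lerD2l Ex_set_top_le.
  have E10 : 0 <= E1.
    apply: fmean_ge0 => // c; rewrite mulr_ge0 // addr_ge0 // sqrtr_ge0 //.
  rewrite -[B ^+ 2]real_normK ?num_real //.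
  apply: le_trans (_ : (2 * K * E1) ^+ 2 <= _).
    by rewrite ler_sqr ?nnegrE // !mulr_ge0 // ltW.
  rewrite exprMn; apply: le_trans (ler_wpM2l (sqr_ge0 _) CS) _.
  by rewrite le_eqVlt; apply/orP; left; apply/eqP; ring.
have pq : pk m x u true * pk m x u false <= 1 / 4.
  by have := sqr_ge0 (pk m x u true - pk m x u false); have := pk_sum1 m x u; nra.
rewrite DE; apply: le_trans (ler_wpM2r (sqr_ge0 _) pq) _.
have AB : (A + B) ^+ 2 <= 2 * A ^+ 2 + 2 * B ^+ 2.
  by have := sqr_ge0 (A - B); rewrite !expr2; lra.
by rewrite mulrDl; lra.
Qed.

Variables (lam t : R) (k0 : nat).
Hypothesis lam01 : 0 < lam < 1.
Hypothesis t01 : 0 <= t < 1.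
Hypothesis contraction : forall m x, (k0 <= m)%N ->
  b%:R * (1 - overlap pk m x ^+ 2) <= lam.
Hypothesis lip : forall m x l,
  `|ln ((pk m x (Some true) true * expR l + pk m x (Some true) false) /
        (pk m x (Some false) true * expR l + pk m x (Some false) false))| <= t * `|l|.

(** By the Markov property, conditioning on all spins at depth at least [k.+1] amounts to
    conditioning on those at depth [k.+1]. *)
Lemma root_sign_posterior k m x u (F : conf b m.+1 -> R) : (k < m)%N ->
  Ex x u (fun c => root_sign x u c * F (set_top k.+1 c)) =
  Ex x u (fun c => posterior pk m x u (leaf k.+1 c : leafc b k.+1) * F (set_top k.+1 c)).
Proof.
move=> km; pose w a : R := if a then 1 else -1.
transitivity (\sum_d push (fun c : conf b m.+1 => w c.1 * pnu (X := conf b m) (nuc x c.1) c.2)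
    (set_top k.+1) d * F d).
  rewrite -sum_push; apply: eq_bigr => -[a c] _; rewrite mulrA; congr (_ * _).
  rewrite /= /root_sign /w /=; case: a; rewrite mulrAC ?mulrN ?mulfV ?gt_eqF //.
transitivity (\sum_d push (nu x u) (set_top k.+1) d *
    (posterior pk m x u (leaf k.+1 d : leafc b k.+1) * F d)); last first.
  by rewrite -sum_push; apply: eq_bigr => c _; rewrite leaf_set_top.
case: m km F x => // m km F x; apply: eq_bigr => -[e d] _.
rewrite push_set_top // mulrA; congr (_ * _).
rewrite -mulrA (posterior_mul pmin_gt0 pk_ge) push_set_topS //; last by move=> y v e'; exact:
  push_set_top.
by rewrite /w mul1r mulN1r.
Qed.

Lemma root_ent_le_uniform : (0 < b)%N -> exists k C, 0 <= C /\
  forall m x u (f : conf b m -> R), (forall c, 0 <= f c) ->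
  root_ent pk x u f <= (2 * (k%:R + 2))^-1 * tot pk k.+2 (root_ent pk) x u f +
                       C * tot pk k.+1 root_grad x u f.
Proof.
move=> b0; have [k Hk] := posterior_mgf pmin_gt0 pk_ge pk_sum1 lam01 t01 contraction lip b0.
have cd0 : 0 <= 1 + cdom k.+1 by rewrite addr_ge0 //; exact: le_trans (cdom_ge1 _).
have K2 : 0 <= 4 * pmin^-1 ^+ 2 * (1 + cdom k.+1).
  by apply: mulr_ge0 => //; apply: mulr_ge0 => //; exact: sqr_ge0.
exists k, (4 * pmin^-1 ^+ 2 * (1 + cdom k.+1) * dset k.+1); split.
  by rewrite mulr_ge0 // dset_ge0.
have k20 : 0 < k%:R + 2 :> R by rewrite ltr_wpDl.
have kap0 : 0 < (4 * (k%:R + 2) : R)^-1 by rewrite invr_gt0 mulr_gt0.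
move=> [|m] x u f f0.
  apply: addr_ge0; apply: mulr_ge0.
  - by rewrite invr_ge0 ltW // mulr_gt0.
  - by apply: (tot_nonneg pk_gt0 k.+2 (root_ent_nonneg pk_gt0 pk_sum1)).
  - by rewrite mulr_ge0 // dset_ge0.
  - by apply: (tot_nonneg pk_gt0 k.+1 root_grad_nonneg).
have [V [JV VK mgf Vl]] : exists V : conf b m.+1 -> R, [/\
  (forall F : conf b m.+1 -> R, Ex x u (fun c => root_sign x u c * F (set_top k.+1 c)) =
     Ex x u (fun c => V c * F (set_top k.+1 c))),
  (forall c, `|V c| <= pmin^-1),
  (forall s, Ex x u (fun c => expR (s * V c)) <= expR ((4 * (k%:R + 2))^-1 * s ^+ 2)) &
  (forall c d, same_top k.+2 c d -> V c = V d)].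
  have [km|mk] := ltnP k m.
    exists (fun c => posterior pk m x u (leaf k.+1 c : leafc b k.+1)); split.
    - by move=> F; exact: root_sign_posterior.
    - by move=> c; exact: posterior_bound.
    - move=> s; rewrite /Ex /fmean.
      rewrite (sum_push (nu x u) (leaf k.+1) (fun xi : leafc b k.+1 => expR (s * posterior pk m
        x u xi))).
      rewrite (eq_bigr (fun xi => lq pk m x u xi * expR (s * posterior pk m x u xi))) => [|xi _].
        exact: Hk.
      by rewrite push_leaf.
    - by move=> c d /leaf_same_top ->.
  (* With at most [k.+1] levels, [set_top k.+1] erases everything, and [root_sign] has mean zero. *)
  exists (fun=> 0); split=> //.
  - move=> F; have FE c d : F (set_top k.+1 c) = F (set_top k.+1 d).
      by rewrite (set_top_const c d).
    rewrite (_ : (fun c => _ * F _) =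
      fun c => root_sign x u c * F (set_top k.+1 (plus_conf b m.+1))).
      rewrite root_signE !pmean_cst ?subrr => [|i|i]; try exact: nuc_sum1.
      by rewrite /Ex /fmean big1 // => c _; rewrite mul0r mulr0.
    by apply/funext => c; rewrite (FE c (plus_conf b m.+1)).
  - by move=> c; rewrite normr0 invr_ge0 ltW.
  - move=> s; rewrite /Ex /fmean.
    rewrite (eq_bigr (fun c => nu x u c * 1)) => [|c _]; last by rewrite mulr0 expR0.
    rewrite -mulr_suml (nu_sum1 pk_sum1) mul1r -[X in X <= _]expR0 ler_expR.
    by apply: mulr_ge0; [exact: ltW kap0|exact: sqr_ge0].
apply: le_trans (root_ent_le kap0 f0 JV VK mgf Vl) _; apply: lerD.
  have -> : 2 * (4 * (k%:R + 2))^-1 = (2 * (k%:R + 2))^-1 :> R.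
    by field; rewrite gt_eqF.
  by [].
by rewrite -[leRHS]mulrA ler_wpM2l // set_top_var.
Qed.

(* The entropy terms on the right of [root_ent_le_uniform] are absorbed: each
   vertex is at depth < k + 2 below at most k + 2 vertices. *)
Lemma tree_log_sobolev : (0 < b)%N -> exists C, 0 < C /\
  forall m x u (f : conf b m -> R), (forall c, 0 <= f c) ->
  fent (nu x u) f <= C * all_tot pk root_grad x u f.
Proof.
move=> b0; have [k [C [C0 H]]] := root_ent_le_uniform b0.
have k20 : 0 < k%:R + 2 :> R by rewrite ltr_wpDl.
exists (2 * (C * k.+1%:R) + 1); split.
  by rewrite ltr_wpDl // mulr_ge0 // mulr_ge0.
move=> m x u f f0.
have ent0 := root_ent_nonneg pk_gt0 pk_sum1.
have G0 : 0 <= all_tot pk root_grad x u f by exact: (all_tot_nonneg pk_gt0 root_grad_nonneg).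
apply: le_trans (_ : all_tot pk (root_ent pk) x u f <= _).
  have := @chain_rule R b pk pk_gt0 pk_sum1 m m x u f f _ f0 f0 (fun c => id).
  move=> /(_ (fun c d cd => congr1 f (same_top_eq cd))) H1.
  rewrite /fent lerBlDr; apply: le_trans H1 _; rewrite lerD2r.
  exact: (tot_le_all pk_gt0 _ ent0).
set S := all_tot pk (root_ent pk) x u f; set G := all_tot _ _ _ _ _ in G0 *.
(* The [k.+2] overlapping entropy sums, with this prefactor, amount to half of [S]. *)
suff : S <= (2 * (k%:R + 2))^-1 * ((k.+2)%:R * S) + C * (k.+1%:R * G).
  have -> : (2 * (k%:R + 2))^-1 * (k.+2%:R * S) = 2^-1 * S.
    by rewrite -addn2 natrD; field; rewrite gt_eqF.
  by lra.
apply: le_trans (all_tot_le pk_gt0 H x u f0) _.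
rewrite all_totD !all_totZ; apply: lerD.
  rewrite ler_wpM2l ?invr_ge0 ?mulr_ge0 ?(ltW k20) //.
  exact: (@all_tot_tot R b pk pk_gt0 k.+2 _ ent0 m x u f f0).
rewrite ler_wpM2l //.
exact: (@all_tot_tot R b pk pk_gt0 k.+1 _ root_grad_nonneg m x u f f0).
Qed.

End RootInequality.

(** * The Bethe recursion *)

Section IsingScalar.
Variable R : realType.
Implicit Types x y z c beta : R.

Definition ch y : R := expR y + expR (- y).

Lemma ch_gt0 y : 0 < ch y.
Proof. by rewrite addr_gt0 ?expR_gt0. Qed.

Lemma ch_ge2 y : 2 <= ch y.
Proof.
have := sqr_ge0 (expR (y / 2) - expR (- (y / 2))).
rewrite sqrrB -!expRM_natl -expRD subrr expR0 /ch.
have -> : 2 * (y / 2) = y by field.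
have -> : 2 * - (y / 2) = - y by field.
by lra.
Qed.

Lemma expR_double y : expR (2 * y) = expR y ^+ 2.
Proof. exact: expRM_natl. Qed.

Lemma chM y z : ch y * ch z = ch (y + z) + ch (y - z).
Proof.
rewrite /ch mulrDl !mulrDr -!expRD opprD opprB [- y + z]addrC.
by ring.
Qed.

Lemma is_derive_ln_ch c x :
  is_derive x 1 (fun z => ln (ch (z + c))) ((expR (x + c) - expR (- (x + c))) / ch (x + c)).
Proof.
have D1 : is_derive x 1 (fun z => z + c : R) 1.
  have := is_deriveD (is_derive_id x 1) (is_derive_cst c x 1); by rewrite addr0.
have D2 : is_derive x 1 (fun z => expR (z + c)) (expR (x + c)).
  have := @is_derive1_comp R expR (fun z => z + c) x _ _ (is_derive_expR _) D1.
  by rewrite mulr1.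
have D3 : is_derive x 1 (fun z => - (z + c)) (-1).
  exact: is_deriveN D1.
have D4 : is_derive x 1 (fun z => expR (- (z + c))) (- expR (- (x + c))).
  have := @is_derive1_comp R expR (fun z => - (z + c)) x _ _ (is_derive_expR _) D3.
  by rewrite mulrN1.
have D5 : is_derive x 1 (fun z => ch (z + c)) (expR (x + c) - expR (- (x + c))).
  exact: is_deriveD D2 D4.
have D6 : is_derive (ch (x + c)) 1 (@ln R) (ch (x + c))^-1 by apply: is_derive1_ln; exact: ch_gt0.
by have := @is_derive1_comp R (@ln R) (fun z => ch (z + c)) x _ _ D6 D5; rewrite mulrC.
Qed.

Section Beta.
Variable beta : R.
Hypothesis beta_ge0 : 0 <= beta.

(** As [ch] is twice the hyperbolic cosine, this is artanh(tanh(beta) * tanh(z)), the field that a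
    spin with field [z] transmits through an edge. *)
Definition msgf z : R := (ln (ch (z + beta)) - ln (ch (z - beta))) / 2.

Definition tnh : R := (expR beta - expR (- beta)) / ch beta.

(** The derivative of [msgf], equal to sinh(2 * beta) / (cosh(2 * z) + cosh(2 * beta)); its maximum,
    at [z = 0], is tanh(beta). *)
Definition theta z : R := (expR (2 * beta) - expR (- (2 * beta))) / (ch (2 * z) + ch (2 * beta)).

Let den_gt0 z : 0 < ch (2 * z) + ch (2 * beta).
Proof. by rewrite addr_gt0 ?ch_gt0. Qed.

Lemma theta_ge0 z : 0 <= theta z.
Proof.
rewrite divr_ge0 ?(ltW (den_gt0 z)) // subr_ge0 ler_expR; have := beta_ge0; lra.
Qed.

Lemma tnh_ge0 : 0 <= tnh.
Proof.
rewrite divr_ge0 ?(ltW (ch_gt0 _)) // subr_ge0 ler_expR; have := beta_ge0; lra.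
Qed.

Lemma tnh_lt1 : tnh < 1.
Proof.
rewrite ltr_pdivrMr ?ch_gt0 // mul1r /ch; have := expR_gt0 (- beta); lra.
Qed.

Lemma theta_le_tnh z : theta z <= tnh.
Proof.
rewrite /theta /tnh ler_pdivrMr // mulrAC ler_pdivlMr ?ch_gt0 //.
apply: le_trans (_ : (expR beta - expR (- beta)) * (2 + ch (2 * beta)) <= _).
  rewrite /ch !expRN !expR_double le_eqVlt; apply/orP; left; apply/eqP; field.
  by rewrite gt_eqF ?expR_gt0.
by rewrite ler_wpM2l ?lerD2r ?ch_ge2 // subr_ge0 ler_expR; have := beta_ge0; lra.
Qed.

Lemma is_derive_msgf x : is_derive x 1 msgf (theta x).
Proof.
have D := is_deriveB (is_derive_ln_ch beta x) (is_derive_ln_ch (- beta) x).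
have D' := is_deriveZ 2^-1 D.
rewrite (_ : msgf = 2^-1 *: ((fun z => ln (ch (z + beta))) - (fun z => ln (ch (z - beta)))));
  last first.
  by apply/funext => z; rewrite /msgf mulrC.
rewrite (_ : theta x = 2^-1 *: ((expR (x + beta) - expR (- (x + beta))) / ch (x + beta) -
  (expR (x - beta) - expR (- (x - beta))) / ch (x - beta))) //.
transitivity (2^-1 * ((expR (x + beta) - expR (- (x + beta))) / ch (x + beta) -
  (expR (x - beta) - expR (- (x - beta))) / ch (x - beta))); last by [].
have e0 : 0 < expR beta by exact: expR_gt0.
have x0 : 0 < expR x by exact: expR_gt0.
rewrite /theta /ch !expRN !expR_double !expRD !expRN.
set e := expR beta in e0 *; set y := expR x in x0 *.
have yy := mulr_gt0 x0 x0; have ee := mulr_gt0 e0 e0; have ye := mulr_gt0 x0 e0.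
field; apply/and5P; split; rewrite gt_eqF //; first by rewrite addr_gt0.
  by rewrite addr_gt0 // mulr_gt0.
by rewrite addr_gt0 // mulr_gt0 ?exprn_gt0 // addr_gt0 // exprn_gt0.
Qed.

Lemma msgf_MVT y z : y < z ->
  exists2 c, y < c < z & msgf z - msgf y = theta c * (z - y).
Proof.
move=> yz; have [|c cyz E] := @MVT R msgf theta y z yz (fun x _ => is_derive_msgf x).
  by apply: derivable_within_continuous => x _; have [] := is_derive_msgf x.
by exists c => //; move: cyz; rewrite in_itv.
Qed.

Lemma msgf_mono y z : y <= z -> msgf y <= msgf z.
Proof.
rewrite le_eqVlt => /orP[/eqP->//|yz]; have [c _ E] := msgf_MVT yz.
by rewrite -subr_ge0 E mulr_ge0 ?theta_ge0 // subr_ge0 ltW.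
Qed.

Lemma msgf_lip y z : `|msgf y - msgf z| <= tnh * `|y - z|.
Proof.
wlog yz : y z / z < y.
  move=> H; have [/H//|yz|->] := ltgtP z y; last by rewrite !subrr normr0 mulr0.
  by rewrite distrC [leRHS](_ : _ = tnh * `|z - y|) ?H // distrC.
have [c _ E] := msgf_MVT yz.
by rewrite E normrM (ger0_norm (theta_ge0 _)) ler_wpM2r // theta_le_tnh.
Qed.

Lemma msgfN z : msgf (- z) = - msgf z.
Proof.
have chN y : ch (- y) = ch y by rewrite /ch opprK addrC.
have E1 : ch (- z + beta) = ch (z - beta) by rewrite -chN opprD opprK.
have E2 : ch (- z - beta) = ch (z + beta) by rewrite -chN opprB opprK addrC.
by rewrite /msgf E1 E2; lra.
Qed.

Lemma msgf_le z : msgf z <= beta.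
Proof.
rewrite /msgf ler_pdivrMr // lerBlDr -ler_expR expRD !lnK ?posrE ?ch_gt0 //.
rewrite /ch mulrDr -!expRD lerD ?ler_expR //; first by lra.
by have := beta_ge0; lra.
Qed.

Lemma msgf_lt z : 0 < beta -> msgf z < beta.
Proof.
move=> b0; rewrite /msgf ltr_pdivrMr // ltrBlDr -ltr_expR expRD !lnK ?posrE ?ch_gt0 //.
rewrite /ch mulrDr -!expRD ler_ltD ?ler_expR ?ltr_expR //; lra.
Qed.

Lemma msgf_norm z : `|msgf z| <= beta.
Proof. by rewrite ler_norml msgf_le andbT lerNl -msgfN msgf_le. Qed.

Lemma theta_cont z : {for z, continuous theta}.
Proof.
rewrite /theta /ch.
apply: (@continuousM R R (fun=> expR (2 * beta) - expR (- (2 * beta)))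
  (fun z => (expR (2 * z) + expR (- (2 * z)) + (expR (2 * beta) + expR (- (2 * beta))))^-1)).
  exact: cst_continuous.
apply: continuousV; first by rewrite gt_eqF // den_gt0.
apply: continuousD; last exact: cst_continuous.
have c2 : {for z, continuous (fun z : R => 2 * z)}.
  by apply: (@continuousM R R (fun=> 2) id); [exact: cst_continuous|].
apply: continuousD; apply: continuous_comp => //; try exact: continuous_expR.
exact: continuousN.
Qed.

Lemma theta_near z e : 0 < e -> exists2 d, 0 < d &
  forall y, `|y - z| < d -> `|theta y - theta z| < e.
Proof.
move=> e0; have /cvgrPdist_lt /(_ e e0) := @theta_cont z.
move=> /nbhs_ballP[d /= d0 H]; exists d => // y yz.
by rewrite distrC; apply: H; rewrite /ball /= distrC.
Qed.

Section Iteration.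
Variables (b : nat) (H : R).
Hypothesis b_gt0 : (0 < b)%N.

Definition bethe z : R := H + b%:R * msgf z.

Fixpoint zplus (m : nat) : R := if m is m'.+1 then bethe (zplus m') else H + b%:R * beta.

Lemma bethe_mono y z : y <= z -> bethe y <= bethe z.
Proof. by move=> yz; rewrite lerD2l ler_wpM2l // msgf_mono. Qed.

Lemma bethe_lip y z : `|bethe y - bethe z| <= b%:R * tnh * `|y - z|.
Proof.
rewrite /bethe opprD addrACA subrr add0r -mulrBr normrM ger0_norm // -mulrA.
by rewrite ler_wpM2l // msgf_lip.
Qed.

Lemma zplus_decr m : zplus m.+1 <= zplus m.
Proof.
elim: m => [|m IH]; last exact: bethe_mono.
by rewrite lerD2l ler_wpM2l // msgf_le.
Qed.

(** The slope bound holds because the sequence comes from above: if the slope of [bethe] at [z]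
    exceeded one, a point [y] slightly above [z] would satisfy [y < bethe y], and by monotonicity
    the sequence could never drop below [y]. *)
Lemma zplus_limit : exists z, [/\ bethe z = z, forall m, z <= zplus m,
  forall e, 0 < e -> exists M, forall m, (M <= m)%N -> zplus m < z + e &
  b%:R * theta z <= 1].
Proof.
have lb m : H - b%:R * beta <= zplus m.
  have bb : 0 <= b%:R * beta by rewrite mulr_ge0.
  case: m => [|m] /=; first by lra.
  rewrite lerD2l -mulrN ler_wpM2l //.
  by have := msgf_norm (zplus m); rewrite ler_norml => /andP[].
have nonincr : nonincreasing_seq zplus.
  by apply/nonincreasing_seqP => m; exact: zplus_decr.
have has_lb : has_lbound (range zplus).
  by exists (H - b%:R * beta) => _ [m _ <-].
have cv := nonincreasing_cvgn nonincr has_lb.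
set z := inf _ in cv; exists z.
have zle m : z <= zplus m by apply: ge_inf => //; exists m.
have lim e : 0 < e -> exists M, forall m, (M <= m)%N -> zplus m < z + e.
  move=> e0; move/cvgrPdist_lt : cv => /(_ e e0) [M _ HM]; exists M => m /HM.
  by rewrite distrC ltr_norml => /andP[_]; lra.
have fix_z : bethe z = z.
  have bt0 : 0 <= b%:R * tnh by rewrite mulr_ge0 ?tnh_ge0.
  apply/eqP; rewrite eq_le; apply/andP; split; apply/ler_addgt0Pr => e e0.
    have [M HM] := lim _ e0; apply: le_trans (ltW (HM M.+1 (leqnSn _))).
    exact: bethe_mono (zle M).
  have d0 : 0 < e / (b%:R * tnh + 1) by rewrite divr_gt0 // ltr_wpDl.
  have [M HM] := lim _ d0; apply: le_trans (zle M.+1) _.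
  have := bethe_lip (zplus M) z; rewrite ler_norml => /andP[_].
  rewrite ger0_norm ?subr_ge0 ?zle // => h1.
  have h2 : (b%:R * tnh) * (zplus M - z) <= e.
    apply: le_trans (_ : (b%:R * tnh) * (e / (b%:R * tnh + 1)) <= _).
      by rewrite ler_wpM2l //; have := HM M (leqnn _); lra.
    rewrite mulrCA ler_piMr ?(ltW e0) // ler_pdivrMr ?ltr_wpDl //; lra.
  by rewrite /=; lra.
split=> //.
rewrite leNgt; apply/negP => th1.
have b0 : 0 < beta.
  rewrite lt_def beta_ge0 andbT; apply: contraTneq th1 => be0.
  by rewrite /theta be0 mulr0 oppr0 subrr mul0r mulr0 -leNgt.
have bR : 0 < b%:R :> R by rewrite ltr0n.
have e0 : 0 < (b%:R * theta z - 1) / b%:R by rewrite divr_gt0 // subr_gt0.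
have [d d0 Hd] := theta_near z e0.
have z0 : z < zplus 0 by rewrite -fix_z /= /bethe ltrD2l ltr_pM2l // msgf_lt.
(* The minimum with [zplus 0] starts the induction that keeps the sequence above [y]. *)
pose y := Num.min (z + d / 2) (zplus 0).
have zy : z < y by rewrite lt_min z0 andbT ltrDl divr_gt0.
have Fy : y < bethe y.
  have [c /andP[zc cy] E] := msgf_MVT zy.
  have cd : `|c - z| < d.
    rewrite gtr0_norm ?subr_gt0 // ltrBlDl; apply: lt_trans cy _.
    by rewrite gt_min; apply/orP; left; lra.
  have tc : 1 < b%:R * theta c.
    have := Hd c cd; rewrite ltr_norml => /andP[h _].
    move: h; rewrite ltrNl opprB ltr_pdivlMr // mulrBl mulrC [theta c * _]mulrC; lra.
  have -> : bethe y = z + b%:R * theta c * (y - z).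
    by rewrite -{1}fix_z /bethe -mulrA -E; ring.
  rewrite -ltrBlDl -[ltLHS]mul1r ltr_pM2r // subr_gt0 //.
have zm m : y <= zplus m.
  elim: m => [|m IH]; first by rewrite ge_min lexx orbT.
  by apply: le_trans (ltW Fy) _; exact: bethe_mono.
have yz0 : 0 < y - z by rewrite subr_gt0.
have [M HM] := lim _ yz0; have := HM M (leqnn _); have := zm M; lra.
Qed.

End Iteration.
End Beta.
End IsingScalar.

(** * Effective fields on the tree and their contraction coefficient *)

Section IsingTree.
Variables (R : realType) (b : nat) (beta h : R) (tau : config b).
Hypothesis b_ge2 : (2 <= b)%N.
Hypothesis beta_ge0 : 0 <= beta.

Let H := beta * h.
Let b_gt0 : (0 < b)%N. Proof. exact: leq_trans b_ge2. Qed.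

(* [msg m y] is half the log-odds that the branch at [y], of height [m - 1],
   contributes to the parent of [y]; [zfield m x] is half the log-odds of the
   spin at the vertex [x] of height [m] when its parent is ignored. *)
Fixpoint msg (m : nat) (y : vertex b) : R :=
  if m is m'.+1 then msgf beta (H + \sum_(i < b) msg m' (i :: y))
  else beta * spin R (tau y).

Definition zfield (m : nat) (x : vertex b) : R := H + \sum_(i < b) msg m (i :: x).

Definition fld (u : option bool) : R := if u is Some a then beta * spin R a else 0.

Definition ising_pk (m : nat) (x : vertex b) (u : option bool) (a : bool) : R :=
  expR ((zfield m x + fld u) * spin R a) / ch (zfield m x + fld u).

Lemma msg_norm m y : `|msg m y| <= beta.
Proof.
case: m => [|m] /=; last exact: msgf_norm.
by rewrite /spin; case: (tau y); rewrite ?mulrN1 ?normrN ?mulr1 ger0_norm.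
Qed.

Lemma zfield_le m x : zfield m x <= zplus beta b H m.
Proof.
elim: m x => [|m IH] x; rewrite /= lerD2l mulr_natl -[b in _ *+ b]card_ord -sumr_const;
  apply: ler_sum => i _.
  by have := msg_norm 0 (i :: x); rewrite ler_norml => /andP[].
by apply: msgf_mono => //; exact: IH.
Qed.

(** The lowest fields come from the minus boundary; as [msgf] is odd, they are the negatives of the
    highest fields for [- H]. *)
Lemma zfield_ge m x : - zplus beta b (- H) m <= zfield m x.
Proof.
elim: m x => [|m IH] x; rewrite /= opprD opprK lerD2l -mulrN mulr_natl
    -[b in _ *+ b]card_ord -sumr_const; apply: ler_sum => i _.
  by have := msg_norm 0 (i :: x); rewrite ler_norml => /andP[].
by rewrite -msgfN; apply: msgf_mono => //; exact: IH.
Qed.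

Lemma zfield_plus m x : (forall y, tau y = true) -> zfield m x = zplus beta b H m.
Proof.
move=> tp; elim: m x => [|m IH] x; rewrite /= /zfield; congr (_ + _);
  rewrite mulr_natl -[b in _ *+ b]card_ord -sumr_const; apply: eq_bigr => i _ /=.
  by rewrite tp /spin mulr1.
by rewrite -/(zfield m (i :: x)) IH.
Qed.

Lemma pk_sum1 m x u : ising_pk m x u true + ising_pk m x u false = 1.
Proof.
by rewrite /ising_pk -mulrDl /spin mulr1 mulrN1 divff // gt_eqF // ch_gt0.
Qed.

Definition pk_min : R := expR (- (`|H| + b%:R * beta + beta)) / (2 * expR (`|H| + b%:R * beta +
  beta)).

Lemma pk_min_gt0 : 0 < pk_min.
Proof. by rewrite divr_gt0 ?mulr_gt0 ?expR_gt0. Qed.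

Lemma pk_ge m x u a : pk_min <= ising_pk m x u a.
Proof.
have fB : `|fld u| <= beta.
  rewrite /fld /spin; case: u => [[]|]; rewrite ?mulr1 ?mulrN1 ?normrN ?normr0 //;
    by rewrite ger0_norm.
set y := zfield m x + fld u; set B := `|H| + b%:R * beta + beta.
have yB : `|y| <= B.
  apply: le_trans (ler_normD _ _) _; apply: lerD.
    apply: le_trans (ler_normD _ _) _; rewrite lerD2l.
    apply: le_trans (ler_norm_sum _ _ _) _.
    rewrite mulr_natl -[b in _ *+ b]card_ord -sumr_const; apply: ler_sum => i _.
    exact: msg_norm.
  exact: fB.
move: yB; rewrite ler_norml => /andP[y1 y2].
rewrite /ising_pk /pk_min -/y -/B; apply: ler_pM; rewrite ?invr_ge0 ?mulr_ge0 ?expR_ge0 //.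
  by rewrite ler_expR /spin; case: a; lra.
rewrite lef_pV2 ?posrE ?ch_gt0 ?mulr_gt0 ?expR_gt0 //.
rewrite mulr_natl mulr2n /ch lerD // ler_expR; lra.
Qed.

Lemma pk_overlap m x :
  1 - overlap ising_pk m x ^+ 2 = tnh beta * theta beta (zfield m x).
Proof.
set z := zfield m x.
have c1 := ch_gt0 (z + beta); have c2 := ch_gt0 (z - beta).
pose X := ch (z + beta) * ch (z - beta).
have X0 : 0 < X by rewrite mulr_gt0.
have S a : ising_pk m x (Some true) a * ising_pk m x (Some false) a = expR (z * spin R a) ^+ 2 / X.
  rewrite /ising_pk /fld [spin R true]/spin [spin R false]/spin mulr1 mulrN1 -/z mulrACA -invfM
    -/X -expRD -expRM_natl.
  by congr (expR _ / _); rewrite -mulrDl; ring.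
have ov : overlap ising_pk m x = ch z / Num.sqrt X.
  have sq A : 0 <= A -> Num.sqrt (A ^+ 2 / X) = A / Num.sqrt X.
    move=> A0; rewrite (@sqrtrM _ (A ^+ 2)) ?sqr_ge0 // sqrtr_sqr ger0_norm //.
    by rewrite sqrtrV // ltW.
  rewrite /overlap (S true) (S false) (sq _ (expR_ge0 _)) (sq _ (expR_ge0 _)).
  by rewrite -mulrDl /spin mulr1 mulrN1.
rewrite ov expr_div_n sqr_sqrtr ?(ltW X0) //.
have XE : X = ch (2 * z) + ch (2 * beta).
  by rewrite /X chM; congr (ch _ + ch _); ring.
have z2 : ch z ^+ 2 = ch (2 * z) + 2.
  have ch0 : ch 0 = 2 :> R by rewrite /ch oppr0 expR0; ring.
  by rewrite expr2 chM subrr ch0; congr (ch _ + _); ring.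
have den : 0 < ch (2 * z) + ch (2 * beta) by rewrite -XE.
have e0 := expR_gt0 beta.
rewrite z2 XE /tnh /theta.
have -> : 1 - (ch (2 * z) + 2) / (ch (2 * z) + ch (2 * beta)) =
  (ch (2 * beta) - 2) / (ch (2 * z) + ch (2 * beta)) by field; rewrite gt_eqF.
rewrite mulrA; congr (_ / _); rewrite /ch !expRN !expR_double.
set e := expR beta in e0 *; field.
by rewrite !gt_eqF // addr_gt0 // mulr_gt0.
Qed.

(** An observation of log-likelihood ratio [l] shifts the field of the vertex by [l / 2], so the
    ratio seen by the parent is twice an increment of [msgf]. *)
Lemma pk_lip m x l :
  `|ln ((ising_pk m x (Some true) true * expR l + ising_pk m x (Some true) false) /
        (ising_pk m x (Some false) true * expR l + ising_pk m x (Some false) false))| <= tnh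
          beta * `|l|.
Proof.
set z := zfield m x.
have E s : 0 <= 0 :> R -> ising_pk m x (Some s) true * expR l + ising_pk m x (Some s) false =
    expR (l / 2) * ch (z + l / 2 + beta * spin R s) / ch (z + beta * spin R s).
  move=> _; rewrite /ising_pk -/z /fld [spin R true]/spin [spin R false]/spin mulr1 mulrN1
    mulrAC -mulrDl; congr (_ / _).
  by rewrite /ch mulrDr -!expRD; congr (expR _ + expR _); field.
rewrite !E // /spin mulr1 mulrN1.
have -> : expR (l / 2) * ch (z + l / 2 + beta) / ch (z + beta) /
    (expR (l / 2) * ch (z + l / 2 - beta) / ch (z - beta)) =
    (ch (z + l / 2 + beta) / ch (z + l / 2 - beta)) / (ch (z + beta) / ch (z - beta)).
  have := expR_gt0 (l / 2); have := ch_gt0 (z + l / 2 - beta).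
  have := ch_gt0 (z + beta); have := ch_gt0 (z - beta) => *.
  by field; rewrite !gt_eqF.
rewrite !ln_div ?posrE ?divr_gt0 ?ch_gt0 //.
have -> : ln (ch (z + l / 2 + beta)) - ln (ch (z + l / 2 - beta)) -
   (ln (ch (z + beta)) - ln (ch (z - beta))) = 2 * (msgf beta (z + l / 2) - msgf beta z).
  by rewrite /msgf; field.
rewrite normrM ger0_norm //; apply: le_trans (ler_wpM2l _ (msgf_lip beta_ge0 _ _)) _ => //.
have -> : z + l / 2 - z = l / 2 by ring.
by rewrite normrM (@ger0_norm _ 2^-1) ?invr_ge0 //; lra.
Qed.

Definition contracting := exists lam k0, 0 < lam < 1 /\
  forall m x, (k0 <= m)%N -> b%:R * (1 - overlap ising_pk m x ^+ 2) <= lam.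

Let contracting_theta z (lo hi : nat -> R) :
  b%:R * theta beta z <= 1 -> (forall m x, lo m <= zfield m x <= hi m) ->
  (forall e, 0 < e -> exists M, forall m, (M <= m)%N -> hi m < z + e) ->
  (forall e, 0 < e -> exists M, forall m, (M <= m)%N -> z - e < lo m) -> contracting.
Proof.
move=> th1 lohi Hhi Hlo.
have t0 := tnh_ge0 beta_ge0; have t1 := tnh_lt1 beta.
have bR : 0 < b%:R :> R by rewrite ltr0n.
have e0 : 0 < (1 - tnh beta) / (2 * b%:R) by rewrite divr_gt0 ?subr_gt0 ?mulr_gt0.
have [d d0 Hd] := theta_near beta z e0.
have [M1 H1] := Hhi d d0; have [M2 H2] := Hlo d d0.
exists ((1 + tnh beta) / 2), (maxn M1 M2); split; first by lra.
move=> m x; rewrite geq_max => /andP[/H1 h1 /H2 h2].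
have /andP[l1 l2] := lohi m x.
have : `|zfield m x - z| < d by rewrite ltr_norml; apply/andP; split; lra.
move/Hd; rewrite ltr_norml => /andP[_].
rewrite -(ltr_pM2l bR) => h3; rewrite pk_overlap mulrCA.
have h4 : b%:R * ((1 - tnh beta) / (2 * b%:R)) = (1 - tnh beta) / 2 :> R.
  by field; rewrite gt_eqF.
have h5 : b%:R * theta beta (zfield m x) <= 1 + (1 - tnh beta) / 2.
  by move: h3; rewrite h4 mulrBr; lra.
apply: le_trans (ler_wpM2l t0 h5) _.
(* For [t = tnh beta] the claim [t * (1 + (1 - t) / 2) <= (1 + t) / 2] says that [(1 - t) ^+ 2] is
   nonnegative. *)
by have := sqr_ge0 (1 - tnh beta); rewrite expr2; nra.
Qed.

Lemma contracting_plus : (forall y, tau y = true) -> contracting.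
Proof.
move=> tp; have [z [_ zle lim th1]] := zplus_limit beta_ge0 H b_gt0.
apply: (contracting_theta th1 (lo := zplus beta b H) (hi := zplus beta b H)) => //.
  by move=> m x; rewrite zfield_plus // lexx.
by move=> e e0; exists 0%N => m _; have := zle m; lra.
Qed.

(** All fields lie between those of the minus and the plus boundary; both sequences converge to
    fixed points, which coincide here. *)
Lemma contracting_unique :
  (forall z1 z2, bethe beta b H z1 = z1 -> bethe beta b H z2 = z2 -> z1 = z2) ->
  contracting.
Proof.
move=> uniq; have [z [fz zle lim th1]] := zplus_limit beta_ge0 H b_gt0.
have [z' [fz' zle' lim' _]] := zplus_limit beta_ge0 (- H) b_gt0.
have zz : - z' = z.
  apply: uniq => //; rewrite /bethe msgfN -[in RHS]fz' /bethe; ring.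
apply: (contracting_theta th1 (lo := fun m => - zplus beta b (- H) m) (hi := zplus beta b H)) => //.
  by move=> m x; rewrite zfield_le zfield_ge.
by move=> e e0; have [M HM] := lim' e e0; exists M => m /HM; rewrite -zz; lra.
Qed.

Lemma contracting_beta1 : beta < beta1 R b -> contracting.
Proof.
move=> bb1.
have t0 := tnh_ge0 beta_ge0.
set s := Num.sqrt (b%:R : R).
have s1 : 1 < s by rewrite -[X in X < _]sqrtr1 ltr_sqrt ?ltr1n ?ltr0n.
have bE : b%:R = s ^+ 2 by rewrite sqr_sqrtr.
have ts : s * tnh beta < 1.
  have : expR (2 * beta) < (s + 1) / (s - 1).
    rewrite -[ltRHS]lnK ?posrE ?divr_gt0 ?subr_gt0 //; last by lra.
    by rewrite ltr_expR; move: bb1; rewrite /beta1 -/s; lra.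
  rewrite ltr_pdivlMr ?subr_gt0 // expR_double /tnh /ch expRN.
  have e0 := expR_gt0 beta; set e := expR beta in e0 * => h1.
  rewrite mulrA ltr_pdivrMr; last by rewrite addr_gt0 ?invr_gt0.
  rewrite -(ltr_pM2r e0) mul1r -mulrA mulrBl mulrDl mulVf ?gt_eqF //.
  by move: h1; rewrite expr2; lra.
(* The term [2^-1] keeps the rate positive when [beta = 0]. *)
set c := Num.max (s * tnh beta) 2^-1.
have c1 : c < 1 by rewrite gt_max ts /=; lra.
have c0 : 2^-1 <= c by rewrite le_max lexx orbT.
exists c, 0%N; split; first by rewrite c1 andbT; lra.
move=> m x _; rewrite pk_overlap bE.
have h1 : tnh beta * theta beta (zfield m x) <= tnh beta * tnh beta.
  by rewrite ler_wpM2l // theta_le_tnh.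
apply: le_trans (ler_wpM2l (sqr_ge0 s) h1) _.
have st0 : 0 <= s * tnh beta by rewrite mulr_ge0 // sqrtr_ge0.
apply: le_trans (_ : s * tnh beta <= _); last by rewrite le_max lexx.
have -> : s ^+ 2 * (tnh beta * tnh beta) = (s * tnh beta) * (s * tnh beta) by ring.
by rewrite ler_piMr // ltW.
Qed.

End IsingTree.

(** * Transfer to the Ising model *)

Section Gluing.

Variables (b : nat) (A : {fset vertex b}).

Lemma glue_in (xi : {ffun A -> bool}) s v (vA : v \in A) :
  Defs.glue xi s v = xi [` vA]%fset.
Proof. by rewrite /Defs.glue insubT. Qed.

Lemma glue_notin (xi : {ffun A -> bool}) s v : v \notin A -> Defs.glue xi s v = s v.
Proof. by move=> vA; rewrite /Defs.glue insubN. Qed.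

End Gluing.

(** * Finite subtrees in recursive form *)

Section Words.
Variable b : nat.
Implicit Types (r x : vertex b) (p : seq 'I_b) (m : nat).

Lemma mem_subtree r m x :
  reflect (exists2 s, (size s <= m)%N & x = s ++ r) (x \in subtree r m).
Proof.
apply: (iffP idP) => [/imfsetP[s _ ->]|[s sm ->]].
  by exists (val s) => //; exact: size_bseq.
by apply/imfsetP; exists (Bseq sm).
Qed.

Lemma mem_subtree_bd r m x :
  reflect (exists2 s, size s = m.+1 & x = s ++ r) (x \in subtree_bd r m).
Proof.
apply: (iffP idP) => [/imfset2P[i _ [s _ ->]]|[[|i s] //= [sm] ->]].
  by exists (i :: val s); rewrite //= size_tuple.
apply/imfset2P; exists i => //.
have sm' : size s == m by apply/eqP.
by exists (Tuple sm').
Qed.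

Lemma bd_subtree r m : bd r m (subtree r m) = subtree_bd r m.
Proof.
apply/fsetP => x; rewrite /bd /nbrs !inE; apply/idP/idP.
  by case/andP => /andP[/negbTE ->].
move=> xb; rewrite xb orbT andbT; have /mem_subtree_bd[[|i s] //= [sm] xE] := xb.
apply/andP; split.
  apply/negP => /mem_subtree[s' s'm]; rewrite xE => /(congr1 size).
  by rewrite /= !size_cat sm; move: s'm; lia.
apply/orP; left; apply/imfset2P; exists i => //; exists (s ++ r) => //.
by apply/mem_subtree; exists s; rewrite // sm.
Qed.

Fixpoint subtree_seq m r : seq (vertex b) :=
  r :: (if m is m'.+1 then flatten [seq subtree_seq m' (i :: r) | i <- enum 'I_b] else [::]).

Lemma mem_subtree_seq m r x :
  reflect (exists2 s, (size s <= m)%N & x = s ++ r) (x \in subtree_seq m r).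
Proof.
elim: m r x => [|m IH] r x /=.
  rewrite inE; apply: (iffP eqP) => [->|[s]]; first by exists [::].
  by rewrite leqn0 size_eq0 => /eqP ->.
rewrite inE; apply: (iffP orP) => [[/eqP ->|/flattenP[l /mapP[i _ ->] /IH[s sm ->]]]|[s sm ->]].
- by exists [::].
- by exists (rcons s i); rewrite ?size_rcons // cat_rcons.
case/lastP: s sm => [|s i]; first by left.
rewrite size_rcons ltnS => sm; right; apply/flattenP.
exists (subtree_seq m (i :: r)); first by apply/mapP; exists i; rewrite ?mem_enum.
by apply/IH; exists s => //; rewrite cat_rcons.
Qed.

Lemma uniq_flatten_map (I T : eqType) (f : I -> seq T) (l : seq I) :
  uniq l -> (forall i, uniq (f i)) ->
  (forall i j (x : T), x \in f i -> x \in f j -> i = j) -> uniq (flatten [seq f i | i <- l]).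
Proof.
move=> + fu fd; elim: l => //= i l IH /andP[il /IH fl].
rewrite cat_uniq fu fl andbT /=; apply/hasPn => x /flattenP[_ /mapP[j jl ->] xj].
by apply/negP => xi; move: il; rewrite (fd i j x xi xj) jl.
Qed.

Lemma uniq_subtree_seq m r : uniq (subtree_seq m r).
Proof.
elim: m r => //= m IH r; apply/andP; split.
  apply/negP => /flattenP[l /mapP[i _ ->] /mem_subtree_seq[s _ /(congr1 size)]].
  by rewrite size_cat /=; lia.
apply: uniq_flatten_map; [exact: enum_uniq|by []|].
move=> i j x /mem_subtree_seq[s _ ->] /mem_subtree_seq[s' _ E].
have ss : size s = size s' by move/(congr1 size): E; rewrite !size_cat /=; lia.
by move/eqP: E; rewrite eqseq_cat // => /andP[_ /eqP[]].
Qed.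

Section Sums.
Variable R : realType.

(** Sums over the words of length less than [m], by the same recursion as [conf]. Words are read
    from the root downwards, vertices upwards; hence the vertex [rev p ++ r] in what follows. *)
Fixpoint path_sum (m : nat) (G : seq 'I_b -> R) : R :=
  if m is m'.+1 then G [::] + \sum_(i < b) path_sum m' (fun p => G (i :: p)) else 0.

Lemma path_sumS m G :
  path_sum m.+1 G = G [::] + \sum_(i < b) path_sum m (fun p => G (i :: p)).
Proof. by []. Qed.

Lemma path_sum_ext m G G' : (forall p, (size p < m)%N -> G p = G' p) ->
  path_sum m G = path_sum m G'.
Proof.
elim: m G G' => //= m IH G G' GG'; rewrite GG' //; congr (_ + _).
by apply: eq_bigr => i _; apply: IH => p pm; exact: GG'.
Qed.

Lemma sum_subtree m r (G : vertex b -> R) :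
  \sum_(x <- subtree r m) G x = path_sum m.+1 (fun p => G (rev p ++ r)).
Proof.
rewrite (perm_big (subtree_seq m r)); last first.
  apply: uniq_perm; [exact: fset_uniq|exact: uniq_subtree_seq|move=> x].
  by apply/idP/idP => [/mem_subtree ?|/mem_subtree_seq ?];
    [exact/mem_subtree_seq|exact/mem_subtree].
elim: m r => [|m IH] r.
  by rewrite /= big_seq1 big1 ?addr0.
rewrite path_sumS [subtree_seq _ _]/= big_cons big_flatten big_map big_enum /=.
congr (_ + _); apply: eq_bigr => i _; rewrite IH.
rewrite -[RHS]/(path_sum m.+1 (fun p => G (rev (i :: p) ++ r))).
by apply: path_sum_ext => p _; rewrite rev_cons cat_rcons.
Qed.

Lemma path_sum_le m G G' : (forall p, (size p < m)%N -> G p <= G' p) ->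
  path_sum m G <= path_sum m G'.
Proof.
elim: m G G' => //= m IH G G' GG'; rewrite lerD ?GG' //.
by apply: ler_sum => i _; apply: IH => p pm; exact: GG'.
Qed.

Lemma path_sumZ m c G : path_sum m (fun p => c * G p) = c * path_sum m G.
Proof.
elim: m G => [|m IH] G /=; first by rewrite mulr0.
by rewrite mulrDr mulr_sumr; congr (_ + _); apply: eq_bigr => i _; exact: IH.
Qed.

End Sums.

Fixpoint read (m : nat) (c : conf b m) (p : seq 'I_b) {struct m} : bool :=
  match m return conf b m -> bool with
  | 0 => fun=> true
  | m'.+1 => fun c => if p is i :: p' then read (c.2 i) p' else c.1
  end c.

Fixpoint build (m : nat) (g : seq 'I_b -> bool) : conf b m :=
  match m return conf b m with
  | 0 => tt
  | m'.+1 => (g [::], [ffun i => build m' (fun p => g (i :: p))])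
  end.

Lemma read_build m g p : (size p < m)%N -> read (build m g) p = g p.
Proof.
elim: m g p => // m IH g [|i p] //= pm.
by rewrite ffunE IH.
Qed.

Lemma build_read m (c : conf b m) g : (forall p, (size p < m)%N -> g p = read c p) ->
  build m g = c.
Proof.
elim: m c g => [[]//|m IH] [a d] g H /=; congr (_, _); first exact: (H [::]).
by apply/ffunP => i; rewrite ffunE; apply: IH => p pm; exact: (H (i :: p)).
Qed.

Fixpoint flip_at (m : nat) (p : seq 'I_b) (c : conf b m) {struct m} : conf b m :=
  match m return conf b m -> conf b m with
  | 0 => id
  | m'.+1 => fun c => if p is i :: p' then (c.1, upd c.2 i (flip_at p' (c.2 i)))
                      else (~~ c.1, c.2)
  end c.

Lemma read_flip_at m (c : conf b m) p q : (size p < m)%N ->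
  read (flip_at p c) q = if q == p then ~~ read c q else read c q.
Proof.
elim: m c p q => // m IH c [|i p] [|j q] //= pm; rewrite ?if_same //.
rewrite eqseq_cons ffunE; case: (eqVneq j i) => [->|_] //=.
by rewrite IH.
Qed.

Variables (r : vertex b) (m : nat).

Definition to_Omega (c : conf b m.+1) : Omega r m :=
  [ffun v => read c (rev (take (size (val v) - size r) (val v)))].

Definition of_Omega (s : Omega r m) : conf b m.+1 :=
  build m.+1 (fun p => Defs.glue s (fun=> true) (rev p ++ r)).

Lemma glue_to_Omega c g p : (size p < m.+1)%N ->
  Defs.glue (to_Omega c) g (rev p ++ r) = read c p.
Proof.
move=> pm; have pT : rev p ++ r \in subtree r m.
  by apply/mem_subtree; exists (rev p); rewrite ?size_rev.
by rewrite (glue_in _ _ pT) ffunE /= size_cat addnK take_size_cat // revK.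
Qed.

Lemma to_OmegaK : cancel to_Omega of_Omega.
Proof. by move=> c; apply: build_read => p pm; rewrite glue_to_Omega. Qed.

Lemma of_OmegaK : cancel of_Omega to_Omega.
Proof.
move=> s; apply/ffunP => v; rewrite ffunE.
have /mem_subtree[w wm vE] := valP v.
have E : rev (rev (take (size (val v) - size r) (val v))) ++ r = val v.
  by rewrite revK vE size_cat addnK take_size_cat.
rewrite read_build; last by rewrite size_rev vE size_cat addnK take_size_cat.
rewrite E /Defs.glue valK //.
Qed.

Lemma sum_Omega (R : realType) (G : Omega r m -> R) :
  \sum_(s : Omega r m) G s = \sum_(c : conf b m.+1) G (to_Omega c).
Proof.
rewrite (reindex to_Omega) //; exists of_Omega => c _; [exact: to_OmegaK|exact: of_OmegaK].
Qed.

Definition flip_Omega (x : vertex b) (s : Omega r m) : Omega r m :=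
  [ffun v => if val v == x then ~~ s v else s v].

Lemma to_Omega_flip c p : (size p < m.+1)%N ->
  to_Omega (flip_at p c) = flip_Omega (rev p ++ r) (to_Omega c).
Proof.
move=> pm; apply/ffunP => v; rewrite !ffunE read_flip_at //.
have /mem_subtree[w wm ->] := valP v; rewrite size_cat addnK take_size_cat //.
congr (if _ then _ else _); apply/eqP/eqP => [<-|]; first by rewrite revK.
move=> E; have sz : size w = size (rev p) by move/(congr1 size): E; rewrite !size_cat => /addIn.
by move/eqP: E; rewrite eqseq_cat // => /andP[/eqP -> _]; rewrite revK.
Qed.

End Words.

(** The quotient in [csob] needs a positive entropy. By [ln y <= y - 1] at a ratio of square roots,
    the entropy is at least the mean squared distance of [Num.sqrt (f k)] from [Num.sqrt m]. *)
Lemma fent_gt0 (R : realType) (I : finType) (p f : I -> R) i j :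
  (forall i, 0 < p i) -> \sum_i p i = 1 -> (forall i, 0 <= f i) -> f i != f j ->
  0 < fent p f.
Proof.
move=> p0 p1 f0 fij; set m := fmean p f.
have m0 : 0 < m.
  rewrite lt_def fmean_ge0 // andbT; apply: contra_neq fij => mz.
  by rewrite !(fmean_eq0 p0 f0 mz).
have key k : (Num.sqrt (f k) - Num.sqrt m) ^+ 2 <= f k * ln (f k) - f k * ln m - f k + m.
  rewrite sqrrB !sqr_sqrtr ?(ltW m0) //.
  case: (ltgtP 0 (f k)) (f0 k) => // [fk _|<- _]; last first.
    by rewrite sqrtr0 !mul0r mul0rn; lra.
  set x := Num.sqrt (f k); set y := Num.sqrt m.
  have x0 : 0 < x by rewrite sqrtr_gt0.
  have y0 : 0 < y by rewrite sqrtr_gt0.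
  have fE : f k = x ^+ 2 by rewrite sqr_sqrtr // ltW.
  have mE : m = y ^+ 2 by rewrite sqr_sqrtr // ltW.
  have := ln_le_sub1 (divr_gt0 y0 x0); rewrite ln_div ?posrE // => h.
  rewrite fE mE !lnXn //.
  have := ler_wpM2l (sqr_ge0 x) h.
  have -> : x ^+ 2 * (y / x - 1) = x * y - x ^+ 2 by field; rewrite gt_eqF.
  rewrite -[ln x *+ 2]mulr_natl -[ln y *+ 2]mulr_natl -[_ *+ 2]mulr_natl; lra.
apply: lt_le_trans (_ : fmean p (fun k => (Num.sqrt (f k) - Num.sqrt m) ^+ 2) <= _); last first.
  apply: le_trans (fmean_le p0 key) _.
  have lin y z : fmean p (fun k => f k * ln (f k) - f k * y - f k + z) =
      fmean p (fun k => f k * ln (f k)) - fmean p f * y - fmean p f + z * \sum_k p k.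
    rewrite /fmean mulr_suml mulr_sumr -!sumrB -big_split.
    by apply: eq_bigr => k _ /=; ring.
  by rewrite lin p1 /fent -/m mulr1 subrK.
have sq0 k : 0 <= (Num.sqrt (f k) - Num.sqrt m) ^+ 2 by exact: sqr_ge0.
rewrite lt_def fmean_ge0 // andbT; apply: contra_neq fij => z.
have H k : f k = m.
  have /eqP := fmean_eq0 p0 sq0 z k; rewrite sqrf_eq0 subr_eq0 => /eqP E.
  by rewrite -[LHS]sqr_sqrtr // E sqr_sqrtr // ltW.
by rewrite !H.
Qed.

(** * The finite-volume Gibbs measure as a tree chain *)

Section Transfer.
Variables (R : realType) (b : nat) (beta h : R) (tau : config b).
Hypothesis b_ge2 : (2 <= b)%N.
Hypothesis beta_ge0 : 0 <= beta.

Local Notation pk := (ising_pk beta h tau).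

Let pk_gt0 m x u a : 0 < pk m x u a.
Proof. exact: lt_le_trans (pk_min_gt0 b beta h) (pk_ge h tau beta_ge0 _ _ _ _). Qed.

(** The term of a vertex first averages over its subtree with the rest fixed, then over the rest;
    [pmean_resample] merges the two averages. *)
Lemma all_tot_root_grad m x u (f : conf b m -> R) :
  all_tot pk (root_grad pk) x u f = path_sum m (fun p =>
    Ex pk x u (fun c => (Num.sqrt (f c) - Num.sqrt (f (flip_at p c))) ^+ 2)).
Proof.
elim: m x u f => [|m IH] x u f.
  by rewrite /= /root_grad /Ex /fmean big1 // => c _; rewrite subrr expr0n mulr0.
rewrite /=; congr (_ + _).
transitivity (fmean (pk m x u) (fun a => \sum_(i < b) path_sum m (fun p =>
   pmean (nuc pk x a) (fun d => (Num.sqrt (f (a, d)) -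
      Num.sqrt (f (a, upd d i (flip_at p (d i))))) ^+ 2)))).
  apply: eq_bigr => a _; congr (_ * _); rewrite pmean_sum; apply: eq_bigr => i _.
  have ps k (G : {ffun 'I_b -> conf b m} -> seq 'I_b -> R) :
     pmean (nuc pk x a) (fun d => path_sum k (fun p => G d p)) =
     path_sum k (fun p => pmean (nuc pk x a) (fun d => G d p)).
    elim: k G => [|k IHk] G /=.
      by rewrite /pmean big1 // => d _; rewrite mulr0.
    rewrite pmeanD pmean_sum; congr (_ + _); apply: eq_bigr => j _.
    exact: (IHk (fun d p => G d (j :: p))).
  pose G d p := Ex pk (i :: x) (Some a) (fun c =>
     (Num.sqrt (f (a, upd d i c)) - Num.sqrt (f (a, upd d i (flip_at p c)))) ^+ 2).
  transitivity (pmean (nuc pk x a) (fun d => path_sum m (fun p => G d p))).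
    by apply: eq_bigr => d _; rewrite IH.
  rewrite ps /G.
  apply: path_sum_ext => p _.
  rewrite -[RHS](pmean_resample (fun j => @nuc_sum1 _ _ _ (pk_sum1 beta h tau) m x a j) i).
  apply: eq_bigr => d _; congr (_ * _); apply: eq_bigr => e _.
  by rewrite upd_upd ffunE eqxx.
rewrite /fmean; under [LHS]eq_bigr => a _ do rewrite big_distrr /=.
rewrite exchange_big; apply: eq_bigr => i _ /=.
have ps k (w : bool -> R) (G : bool -> seq 'I_b -> R) : \sum_a w a * path_sum k (fun p => G a p) =
    path_sum k (fun p => \sum_a w a * G a p).
  elim: k G => [|k IHk] G /=; first by rewrite big1 // => a _; rewrite mulr0.
  under eq_bigr do rewrite mulrDr mulr_sumr.
  rewrite big_split exchange_big; congr (_ + _); apply: eq_bigr => j _.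
  exact: (IHk (fun a p => G a (j :: p))).
rewrite ps; apply: path_sum_ext => p _.
by rewrite ExS.
Qed.

Definition site_energy (g : config b) (x : vertex b) : R :=
  beta * (\sum_(i < b) spin R (g x) * spin R (g (i :: x)) + h * spin R (g x)).

Lemma energy_subtree r m (g : config b) :
  energy beta h (subtree r m) (subtree r m `|` bd r m (subtree r m))%fset g =
  path_sum m.+1 (fun p => site_energy g (rev p ++ r)).
Proof.
rewrite -sum_subtree /site_energy -mulr_sumr big_split -mulr_sumr /=; congr (_ * (_ + _)).
rewrite bd_subtree; set T := subtree r m; set B := subtree_bd r m.
have TB x : x \in T -> x \notin B.
  move=> /mem_subtree[s sm ->]; apply/negP => /mem_subtree_bd[s' s'm /(congr1 size)].
  by rewrite !size_cat s'm; move: sm; lia.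
have -> : \sum_(x <- (T `|` B)%fset) \sum_(i < b | i :: x \in (T `|` B)%fset)
    spin R (g x) * spin R (g (i :: x)) =
    \sum_(x <- (T `|` B)%fset | x \in T) \sum_(i < b) spin R (g x) * spin R (g (i :: x)).
  rewrite [RHS]big_mkcond /= ![in LHS]big_seq ![in RHS]big_seq; apply: eq_bigr => x.
  rewrite inE => /orP[xT|xB].
    rewrite xT; apply: eq_bigl => i; rewrite inE; have /mem_subtree[s sm ->] := xT.
    rewrite leq_eqVlt in sm; case/orP: sm => [/eqP sm|sm].
      by apply/orP; right; apply/mem_subtree_bd; exists (i :: s); rewrite //= sm.
    by apply/orP; left; apply/mem_subtree; exists (i :: s).
  rewrite (negbTE (contraL (TB x) xB)) big_pred0 // => i; rewrite inE.
  have /mem_subtree_bd[s sm ->] := xB.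
  apply/negbTE/negP => /orP[/mem_subtree[s' s'm /(congr1 size)]|/mem_subtree_bd[s' s'm /(congr1
    size)]].
    by rewrite /= !size_cat sm; move: s'm; lia.
  by rewrite /= !size_cat sm s'm; lia.
rewrite -[LHS]big_filter; apply: perm_big; apply: uniq_perm.
- by rewrite filter_uniq // fset_uniq.
- exact: fset_uniq.
by move=> x; rewrite mem_filter inE; case: (x \in T).
Qed.

(** Summing out a child of field [z] leaves a positive function of the parent spin [a], which is a
    constant times an exponential tilt; the tilt is [msgf beta z]. *)
Lemma ch_msgf z a : ch (z + beta * spin R a) =
  expR ((ln (ch (z + beta)) + ln (ch (z - beta))) / 2) * expR (msgf beta z * spin R a).
Proof.
rewrite -expRD /msgf /spin.
set A := ln (ch (z + beta)); set B := ln (ch (z - beta)); case: a.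
  have -> : (A + B) / 2 + (A - B) / 2 * 1 = A by field.
  by rewrite mulr1 lnK // posrE ch_gt0.
have -> : (A + B) / 2 + (A - B) / 2 * -1 = B by field.
by rewrite mulrN1 lnK // posrE ch_gt0.
Qed.

(** Branches are summed out from the leaves upwards. The partition function of a branch depends on
    the parent state only through the factor [ch], which [ch_msgf] turns into a field on the
    parent. *)
Lemma expR_energy m x : exists2 K, 0 < K & forall (g : config b) u (c : conf b m.+1),
  (forall p, (size p < m.+1)%N -> g (rev p ++ x) = read c p) ->
  (forall p, size p = m.+1 -> g (rev p ++ x) = tau (rev p ++ x)) ->
  expR (path_sum m.+1 (fun p => site_energy g (rev p ++ x)) + fld beta u * spin R (g x)) =
  K * ch (zfield beta h tau m x + fld beta u) * nu pk x u c.
Proof.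
elim: m x => [|m IH] x.
  exists 1 => // g u c gc gt; have gx : g x = c.1 by exact: (gc [::]).
  have gi i : g (i :: x) = tau (i :: x) by exact: (gt [:: i]).
  rewrite mul1r /= big1 // addr0 /pnu big1 // mulr1 /ising_pk.
  rewrite mulrCA mulfV ?gt_eqF ?ch_gt0 // mulr1; congr expR.
  rewrite /site_energy /zfield gx.
  under eq_bigr do rewrite gi.
  rewrite -mulr_sumr /= -mulr_sumr; ring.
have /choice [K HK] : forall i, exists K, 0 < K /\ forall (g : config b) u (c : conf b m.+1),
    (forall p, (size p < m.+1)%N -> g (rev p ++ i :: x) = read c p) ->
    (forall p, size p = m.+1 -> g (rev p ++ i :: x) = tau (rev p ++ i :: x)) ->
    expR (path_sum m.+1 (fun p => site_energy g (rev p ++ i :: x)) +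
          fld beta u * spin R (g (i :: x))) =
    K * ch (zfield beta h tau m (i :: x) + fld beta u) * nu pk (i :: x) u c.
  by move=> i; have [K K0 HK] := IH (i :: x); exists K.
pose z i := zfield beta h tau m (i :: x).
pose C i := expR ((ln (ch (z i + beta)) + ln (ch (z i - beta))) / 2).
exists (\prod_i (K i * C i)).
  by apply: prodr_gt0 => i _; rewrite mulr_gt0 ?expR_gt0 //; have [] := HK i.
move=> g u c gc gt; have gx : g x = c.1 by exact: (gc [::]).
pose cc : {ffun 'I_b -> conf b m.+1} := c.2.
have H i : expR (path_sum m.+1 (fun p => site_energy g (rev p ++ i :: x)) +
     fld beta (Some c.1) * spin R (g (i :: x))) =
   K i * C i * expR (msgf beta (z i) * spin R c.1) * nuc pk x c.1 i (cc i).
  have [_ HKi] := HK i; rewrite (HKi g (Some c.1) (cc i)).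
  - by rewrite [fld _ _]/= ch_msgf -/(z i) -/(C i) /nuc; ring.
  - by move=> p pm; have := gc (i :: p); rewrite rev_cons cat_rcons; apply.
  - by move=> p pm; have := gt (i :: p); rewrite rev_cons cat_rcons; apply; rewrite /= pm.
transitivity (expR ((beta * h + fld beta u) * spin R c.1) *
   \prod_i expR (path_sum m.+1 (fun p => site_energy g (rev p ++ i :: x)) +
     fld beta (Some c.1) * spin R (g (i :: x)))).
  rewrite -expR_sum -expRD; congr expR.
  have E : \sum_(i < b) path_sum m.+1 (fun p => site_energy g (rev (i :: p) ++ x)) =
      \sum_(i < b) path_sum m.+1 (fun p => site_energy g (rev p ++ i :: x)).
    apply: eq_bigr => i _; apply: path_sum_ext => p _.
    by rewrite rev_cons cat_rcons.
  rewrite path_sumS E.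
  rewrite [in RHS]big_split /= -mulr_sumr.
  by rewrite /site_energy gx -mulr_sumr; ring.
rewrite (eq_bigr _ (fun i _ => H i)) big_split big_split /= -expR_sum -mulr_suml.
rewrite /ising_pk -/(pnu _ cc) [X in _ * X = _]mulrC.
have c0 := ch_gt0 (zfield beta h tau m.+1 x + fld beta u).
have -> : expR ((zfield beta h tau m.+1 x + fld beta u) * spin R c.1) =
    expR ((beta * h + fld beta u) * spin R c.1) *
    expR ((\sum_(i < b) msgf beta (z i)) * spin R c.1).
  by rewrite -expRD; congr expR; rewrite /zfield; ring.
set P := pnu _ _; set c1 := ch _ in c0 *.
by field; rewrite gt_eqF.
Qed.

Section Tree.
Variables (r : vertex b) (m : nat).
Local Notation T := (subtree r m).

Lemma mu_Ex (F : Omega r m -> R) :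
  mu beta h tau F = Ex pk r None (fun c : conf b m.+1 => F (to_Omega r c)).
Proof.
have [K0 K00 HK0] : exists2 K, 0 < K & forall c : conf b m.+1,
    weight beta h tau T (to_Omega r c : Omega r m) = K * nu pk r None c.
  have [K K0 HK] := expR_energy m r.
  exists (K * ch (zfield beta h tau m r + 0)); first by rewrite mulr_gt0 // ch_gt0.
  move=> c; rewrite /weight energy_subtree -[0]/(fld beta None).
  rewrite -(HK (Defs.glue (to_Omega r c) tau) None c) /=; first by rewrite mul0r addr0.
    by move=> p pm; rewrite glue_to_Omega.
  move=> p pm; rewrite /Defs.glue insubN //; apply/negP => /mem_subtree[s sm /(congr1 size)].
  by rewrite !size_cat size_rev pm; move: sm; lia.
have ag (eta s : Omega r m) : agree_off T eta s.
  by apply/forallP => v; rewrite (valP v).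
rewrite /mu /mean sum_Omega; apply: eq_bigr => c _; congr (_ * _).
rewrite /gibbs ag (eq_bigl xpredT) => [|s]; last by rewrite ag.
rewrite sum_Omega (eq_bigr (fun c => K0 * nu pk r None c)) => [|d _]; last exact: HK0.
rewrite -mulr_sumr (nu_sum1 (pk_sum1 beta h tau)) mulr1 HK0.
by rewrite mulrC mulKf ?gt_eqF.
Qed.

Lemma entropy_fent (f : Omega r m -> R) :
  entropy beta h tau f = fent (nu pk (m := m.+1) r None) (fun c => f (to_Omega r c)).
Proof. by rewrite /entropy !mu_Ex. Qed.

Lemma mu_le (F G : Omega r m -> R) : (forall s, F s <= G s) ->
  mu beta h tau F <= mu beta h tau G.
Proof. by move=> FG; rewrite !mu_Ex; apply: Ex_le => // c. Qed.

(** A crude bound, uniform in site and tree: a vertex and its neighbours are at most [b + 2]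
    vertices, with at most [b] child edges each. *)
Definition site_bound : R := beta * ((b + 2)%:R * b%:R + `|h|).

Lemma energy_site (x : vertex b) (g : config b) :
  `|energy beta h [fset x]%fset ([fset x] `|` bd r m [fset x])%fset g| <= site_bound.
Proof.
have sp a : `|spin R a| = 1 by case: a; rewrite /spin ?normrN normr1.
rewrite /energy normrM ger0_norm // ler_wpM2l //.
apply: le_trans (ler_normD _ _) _; apply: lerD; last first.
  by rewrite big_seq_fset1 normrM sp mulr1.
apply: le_trans (ler_norm_sum _ _ _) _.
set B := ([fset x] `|` bd r m [fset x])%fset.
have szB : (size B <= b + 2)%N.
  have -> : (b + 2)%N = size [:: x, behead x & [seq i :: x | i <- enum 'I_b]].
    by rewrite /= size_map size_enum_ord addn2.
  apply: uniq_leq_size; first exact: fset_uniq.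
  move=> y; rewrite !inE => /orP[->//|/andP[/andP[_ yN] _]].
  case/orP: yN => [/imfset2P[i _ [z + ->]]|/imfsetP[z + ->]].
    by rewrite !inE => /eqP ->; rewrite map_f ?mem_enum ?orbT.
  by rewrite !inE => /eqP ->; rewrite eqxx orbT.
apply: le_trans (_ : \sum_(y <- B) b%:R <= _).
  apply: ler_sum => y _; apply: le_trans (ler_norm_sum _ _ _) _.
  rewrite -[b in _ <= b%:R]card_ord -sumr_const big_mkcond; apply: ler_sum => i _.
  by case: ifP => _ //; rewrite normrM !sp mulr1.
by rewrite big_const_seq count_predT iter_addr_0 -[leLHS]mulr_natl ler_wpM2r // ler_nat.
Qed.

(** The single-site measure charges only [eta] and its flip, each with mass at least
    [expR (- (2 * site_bound)) / 2]. *)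
Lemma local_var_ge (F : Omega r m -> R) (eta : Omega r m) x : x \in T ->
  expR (- (2 * site_bound)) / 4 * (F eta - F (flip_Omega x eta)) ^+ 2 <=
  local_var beta h tau [fset x]%fset F eta.
Proof.
move=> xT; set A := [fset x]%fset; set eta' := flip_Omega x eta.
have w_ge (s : Omega r m) : expR (- site_bound) <= weight beta h tau A s.
  rewrite /weight ler_expR; have := energy_site x (Defs.glue s tau).
  by rewrite ler_norml => /andP[lo _]; exact: lo.
have w_le (s : Omega r m) : weight beta h tau A s <= expR site_bound.
  rewrite /weight ler_expR; have := energy_site x (Defs.glue s tau).
  by rewrite ler_norml => /andP[_ hi]; exact: hi.
have w_gt0 (s : Omega r m) : 0 < weight beta h tau A s by exact: expR_gt0.
have ne : eta != eta'.
  apply/negP => /eqP /ffunP /(_ [` xT]%fset); rewrite ffunE eqxx.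
  by case: (eta _).
have agE s : agree_off A eta s = (s == eta) || (s == eta').
  apply/forallP/orP => [H|H v].
    case: (boolP (s [` xT]%fset == eta [` xT]%fset)) => [/eqP E|E]; [left|right];
      apply/eqP/ffunP => v.
      case: (eqVneq (val v) x) => vx; last by have := H v; rewrite !inE vx => /eqP.
      by have -> : v = [` xT]%fset by exact: val_inj.
    rewrite ffunE; case: (eqVneq (val v) x) => vx; last by have := H v; rewrite !inE vx => /eqP.
    have -> : v = [` xT]%fset by exact: val_inj.
    by move: E; case: (s _); case: (eta _).
  apply/implyP; rewrite !inE => vx; case: H => /eqP -> //.
  by rewrite ffunE (negbTE vx).
set W := \sum_(s | agree_off A eta s) weight beta h tau A s.
have WE : W = weight beta h tau A eta + weight beta h tau A eta'.
  rewrite /W (eq_bigl (fun s => (s == eta) || (s == eta'))) => [|s]; last exact: agE.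
  rewrite (bigD1 eta) ?eqxx //= (bigD1 eta') /= ?eqxx ?orbT //; last by rewrite eq_sym.
  rewrite big1 ?addr0 // => s /andP[/andP[/orP[/eqP->|/eqP->]]]; rewrite eqxx //.
have W0 : 0 < W by rewrite WE addr_gt0.
have g_ge s : s = eta \/ s = eta' -> expR (- (2 * site_bound)) / 2 <= gibbs beta h tau A eta s.
  move=> H; rewrite /gibbs agE (_ : _ || _ = true); last first.
    by case: H => ->; rewrite eqxx ?orbT.
  rewrite -/W ler_pdivlMr //.
  apply: le_trans (_ : expR (- (2 * site_bound)) / 2 * (2 * expR site_bound) <= _).
    rewrite ler_wpM2l ?divr_ge0 ?expR_ge0 // WE.
    have := w_le eta; have := w_le eta'; lra.
  have -> : expR (- (2 * site_bound)) / 2 * (2 * expR site_bound) = expR (- site_bound).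
    rewrite (_ : - site_bound = - (2 * site_bound) + site_bound); last by ring.
    by rewrite expRD; field.
  exact: w_ge.
have g0 s : 0 <= gibbs beta h tau A eta s.
  by rewrite /gibbs; case: ifP => // _; rewrite divr_ge0 // ltW.
have g1 : \sum_s gibbs beta h tau A eta s = 1.
  rewrite /gibbs -big_mkcond -mulr_suml -/W divff // gt_eqF //.
set M := mean beta h tau A F eta.
have -> : local_var beta h tau A F eta = \sum_s gibbs beta h tau A eta s * (F s - M) ^+ 2.
  rewrite /local_var -/M /mean.
  rewrite [RHS](eq_bigr (fun s => gibbs beta h tau A eta s * F s ^+ 2 -
     2 * M * (gibbs beta h tau A eta s * F s) + M ^+ 2 * gibbs beta h tau A eta s)); last first.
    by move=> s _; ring.
  rewrite big_split /= sumrB -!mulr_sumr g1 -/(mean beta h tau A F eta) -/M; ring.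
rewrite (bigD1 eta) //= (bigD1 eta') /=; last by rewrite eq_sym.
rewrite addrA; apply: le_trans (_ : gibbs beta h tau A eta eta * (F eta - M) ^+ 2 +
  gibbs beta h tau A eta eta' * (F eta' - M) ^+ 2 <= _); last first.
  by rewrite lerDl; apply: sumr_ge0 => s _; rewrite mulr_ge0 // sqr_ge0.
set c := expR _.
have h1 := ler_wpM2r (sqr_ge0 (F eta - M)) (g_ge eta (or_introl erefl)).
have h2 := ler_wpM2r (sqr_ge0 (F eta' - M)) (g_ge eta' (or_intror erefl)).
apply: le_trans (lerD h1 h2); rewrite -/c -mulrDr.
have c0 : 0 <= c / 4 by rewrite divr_ge0 // expR_ge0.
have -> : c / 2 = c / 4 * 2 by field.
rewrite -[leRHS]mulrA ler_wpM2l //.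
have := sqr_ge0 ((F eta - M) + (F eta' - M)); rewrite !expr2; lra.
Qed.

Lemma dirichlet_ge (F : Omega r m -> R) :
  expR (- (2 * site_bound)) / 4 * path_sum m.+1 (fun p =>
    Ex pk r None (fun c : conf b m.+1 => (F (to_Omega r c) - F (to_Omega r (flip_at p c))) ^+ 2)) <=
  dirichlet beta h tau F.
Proof.
rewrite /dirichlet sum_subtree -path_sumZ; apply: path_sum_le => p pm.
have xT : rev p ++ r \in T by apply/mem_subtree; exists (rev p); rewrite ?size_rev.
apply: le_trans (_ : mu beta h tau (fun s : Omega r m => expR (- (2 * site_bound)) / 4 *
   (F s - F (flip_Omega (rev p ++ r) s)) ^+ 2) <= _); last first.
  by apply: mu_le => s; exact: local_var_ge.
rewrite mu_Ex /Ex /fmean mulr_sumr le_eqVlt; apply/orP; left; apply/eqP.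
apply: eq_bigr => c _; rewrite to_Omega_flip //; ring.
Qed.

End Tree.

Lemma csob_ge : contracting beta h tau ->
  exists C : R, 0 < C /\ forall r m, 1 / C <= csob beta h tau r m.
Proof.
move=> [lam [k0 [lam01 contr]]].
have t01 : 0 <= tnh beta < 1 by rewrite tnh_ge0 // tnh_lt1.
have b_gt0 : (0 < b)%N by exact: leq_trans b_ge2.
have [C [C0 HC]] := tree_log_sobolev (pk_min_gt0 b beta h) (pk_ge h tau beta_ge0)
  (pk_sum1 beta h tau) lam01 t01 contr (pk_lip h tau beta_ge0) b_gt0.
have e0 := expR_gt0 (- (2 * site_bound)).
set c := expR _ in e0.
exists (C / (c / 4)); split; first by rewrite divr_gt0 // divr_gt0.
move=> r m; rewrite /csob; apply: lb_le_inf.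
  (* The infimum is over a nonempty set: it contains the quotient of the indicator of a plus spin at
     [r]. *)
  have rT : r \in subtree r m by apply/mem_subtree; exists [::].
  eexists; exists (fun s : Omega r m => (s [` rT]%fset)%:R); last reflexivity.
  split=> [s|]; first exact: ler0n.
  exists [ffun=> true], [ffun=> false]; rewrite !ffunE; exact: oner_neq0.
move=> _ [f [f0 [s [s' ss']]] <-].
have ent0 : 0 < entropy beta h tau f.
  rewrite entropy_fent.
  apply: (@fent_gt0 _ _ _ _ (of_Omega s) (of_Omega s')) => [c'||c'|].
  - exact: nu_gt0.
  - exact: (nu_sum1 (pk_sum1 beta h tau)).
  - exact: f0.
  - by rewrite !of_OmegaK.
rewrite ler_pdivlMr // div1r mulrC ler_pdivrMr ?divr_gt0 //.
rewrite entropy_fent; apply: le_trans (HC _ r None _ (fun c => f0 _)) _.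
rewrite all_tot_root_grad.
have := dirichlet_ge (fun s => Num.sqrt (f s)); rewrite -/c.
rewrite -ler_pdivlMl ?divr_gt0 // => D.
apply: le_trans (ler_wpM2l (ltW C0) D) _.
by rewrite mulrA mulrC.
Qed.

End Transfer.

Local Open Scope classical_set_scope.
Local Open Scope ring_scope.

(** * Infinite-volume Bethe measures *)

Section BinaryCoding.

Variables (R : realType) (rho : nat -> (nat -> bool) -> R).
Hypothesis rho_local : forall n s s',
  (forall j, (j < n)%N -> s j = s' j) -> rho n s = rho n s'.
Hypothesis rho0 : forall s, rho 0 s = 1.
Hypothesis rho_ge0 : forall n s, 0 <= rho n s.
Hypothesis rho_add : forall n s,
  rho n s = \sum_(a : bool) rho n.+1 (fun j => if (j < n)%N then s j else a).

(* Words are read from the last bit to the first one, so that [a :: w] extends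
   [w] by the bit [a]. *)
Let wt (w : seq bool) : R := rho (size w) (nth false (rev w)).

Let wt_split w : wt w = wt (true :: w) + wt (false :: w).
Proof.
rewrite /wt rho_add big_bool /=; congr (_ + _); apply: rho_local => j;
  rewrite rev_cons nth_rcons size_rev ltnS leq_eqVlt => /orP[/eqP->|->] //;
  by rewrite ltnn eqxx.
Qed.

(** Left endpoint of the interval of [w]: the extension by [false] takes the left part, of length
    [wt (false :: w)], and the extension by [true] takes the rest. *)
Fixpoint code_left (w : seq bool) : R :=
  if w is a :: w' then code_left w' + (if a then wt (false :: w') else 0) else 0.

Fixpoint code (n : nat) (x : R) : seq bool :=
  if n is n'.+1 then
    let w := code n' x in (code_left w + wt (false :: w) <= x) :: w
  else [::].

Definition code_bit (n : nat) (x : R) : bool := head false (code n.+1 x).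

Let code_rev n x : code n x = rev (mkseq (code_bit^~ x) n).
Proof. by elim: n => //= n IH; rewrite mkseqS rev_rcons -IH. Qed.

Let code_itv w x : 0 <= x < 1 ->
  (code (size w) x == w) = (code_left w <= x < code_left w + wt w).
Proof.
move=> x01; elim: w => [|a w IH] /=; first by rewrite /wt rho0 add0r x01.
have T0 := rho_ge0 (size (true :: w)) (nth false (rev (true :: w))).
have F0 := rho_ge0 (size (false :: w)) (nth false (rev (false :: w))).
have spl := wt_split w.
rewrite -/(wt _) in T0; rewrite -/(wt _) in F0.
rewrite eqseq_cons IH.
have [cw|cw] := eqVneq (code (size w) x) w.
  move: IH; rewrite cw eqxx => /esym/andP[x1 x2]; rewrite x1 x2 andbT.
  case: a; case: (leP (code_left w + wt (false :: w)) x) => x3 //=; apply/esym.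
  - by rewrite -addrA [wt (false :: w) + _]addrC -spl.
  - by rewrite addr0 x1 ltNge x3.
  - by rewrite addr0 x1 x3.
have: ~~ (code_left w <= x < code_left w + wt w) by rewrite -IH.
move=> /negPf nx; rewrite nx andbF; apply/esym/negbTE/negP.
move: nx => /negbT/negP nx /andP[x1 x2]; apply: nx.
by case: a x1 x2 => x1 x2; apply/andP; split; lra.
Qed.

Let cyl_itv n (s : nat -> bool) :
  [set x : R | 0 <= x < 1 /\ forall j, (j < n)%N -> code_bit j x = s j] =
  [set x | 0 <= x < 1 /\ let w := rev (mkseq s n) in
     code_left w <= x < code_left w + wt w]%classic.
Proof.
apply/seteqP; split=> x /= [x01]; rewrite -code_itv // size_rev size_mkseq code_rev.
  move=> H; split=> //; apply/eqP; congr rev; apply/eq_in_map => j.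
  by rewrite mem_iota => /andP[_ /H].
move=> /eqP/(congr1 rev); rewrite !revK => E; split=> // j jn.
by rewrite -(nth_mkseq false (code_bit^~ x) jn) E nth_mkseq.
Qed.

Let code_left_ge0 w : 0 <= code_left w.
Proof. by elim: w => //= a w IH; rewrite addr_ge0 //; case: a; rewrite // rho_ge0. Qed.

Let code_right_le1 w : code_left w + wt w <= 1.
Proof.
elim: w => [|a w IH] /=; first by rewrite /wt rho0 add0r.
have T0 := rho_ge0 (size (true :: w)) (nth false (rev (true :: w))).
have F0 := rho_ge0 (size (false :: w)) (nth false (rev (false :: w))).
have spl := wt_split w.
rewrite -/(wt _) in T0; rewrite -/(wt _) in F0.
by case: a; lra.
Qed.

Let cylE n (s : nat -> bool) :
  [set x : R | 0 <= x < 1 /\ forall j, (j < n)%N -> code_bit j x = s j] =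
  [set` `[code_left (rev (mkseq s n)),
          code_left (rev (mkseq s n)) + wt (rev (mkseq s n))[ ].
Proof.
rewrite cyl_itv; set w := rev _; apply/seteqP; split=> x /=; rewrite in_itv /=.
  by case.
move=> xw; split=> //; case/andP: xw => x1 x2.
have := code_left_ge0 w; have := code_right_le1 w; lra.
Qed.

(* Nested intervals: the cylinder of a word [w] is coded by a subinterval of
   [0, 1[ of length [rho w]. *)
Lemma binary_coding : exists X : nat -> R -> bool,
  (forall n, measurable [set x | X n x]) /\
  (forall n s, lebesgue_measure
     [set x : R | 0 <= x < 1 /\ forall j, (j < n)%N -> X j x = s j] = (rho n s)%:E).
Proof.
(* Truncation to [0, 1[ makes the set of [x] with bit [true] a finite union of intervals, one for
   each word of the earlier bits. *)
exists (fun n x => (0 <= x < 1) && code_bit n x); split=> [n|n s].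
  have -> : [set x | (0 <= x < 1) && code_bit n x] =
      \big[setU/set0]_(w : n.-tuple bool)
        [set x : R | 0 <= x < 1 /\ forall j, (j < n.+1)%N ->
           code_bit j x = nth false (rcons w true) j]%classic.
    rewrite -[RHS]bigcup_seq; apply/seteqP; split=> x /=.
      move=> /andP[x01 xn]; exists [tuple of mkseq (code_bit^~ x) n].
        by rewrite /= mem_index_enum.
      split=> // j; rewrite ltnS leq_eqVlt nth_rcons /= size_mkseq => /orP[/eqP->|jn].
        by rewrite ltnn eqxx.
      by rewrite jn nth_mkseq.
    move=> [w _ [-> /(_ n (ltnSn n)) ->]].
    by rewrite nth_rcons size_tuple ltnn eqxx.
  apply: bigsetU_measurable => w _; rewrite (cylE n.+1 (nth false (rcons w true))); exact:
    measurable_itv.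
have -> : [set x : R | 0 <= x < 1 /\ forall j, (j < n)%N ->
             (0 <= x < 1) && code_bit j x = s j] =
    [set x | 0 <= x < 1 /\ forall j, (j < n)%N -> code_bit j x = s j].
  by apply/seteqP; split=> x /= [x01 H]; split=> // j /H; rewrite x01.
rewrite cylE lebesgue_measure_itv /= lte_fin; set w := rev _.
have r0 : 0 <= wt w by exact: rho_ge0.
have rw : wt w = rho n s.
  rewrite /wt /w revK size_rev size_mkseq; apply: rho_local => j jn.
  by rewrite nth_mkseq.
rewrite -rw; case: ifP => [_|/negbT]; first by rewrite EFinN EFinD addeAC subee ?add0e.
by rewrite -leNgt gerDl => r1; congr _%:E; apply/eqP; rewrite eq_le r0 r1.
Qed.

End BinaryCoding.

(** * Markov chains on the infinite tree *)

Section TreeMeasure.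

Variables (R : realType) (b : nat).
Hypothesis b_gt0 : (0 < b)%N.

(** A bijection onto the natural numbers in which parents precede children, so the chain can be
    sampled bit by bit in this order. *)
Fixpoint heap_index (v : vertex b) : nat :=
  if v is i :: x then (b * heap_index x + i).+1 else 0.

Lemma heap_index_inj : injective heap_index.
Proof.
elim=> [|i x IH] [|j y] //= [] E.
have := congr1 (edivn^~ b) E; rewrite ![(b * _)%N]mulnC !edivn_eq // => -[xy ij].
by rewrite (IH _ xy) (ord_inj ij).
Qed.

Lemma heap_index_surj n : exists v, heap_index v = n.
Proof.
elim/ltn_ind: n => -[|n] IH; first by exists [::].
have [|x xE] := IH (n %/ b)%N; first by rewrite ltnS leq_div.
exists (Ordinal (ltn_pmod n b_gt0) :: x) => /=.
by rewrite xE mulnC -divn_eq.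
Qed.

Definition heap_vertex n : vertex b := projT1 (cid (heap_index_surj n)).

Lemma heap_vertexK : cancel heap_vertex heap_index.
Proof. by move=> n; exact: (projT2 (cid (heap_index_surj n))). Qed.

Lemma heap_indexK : cancel heap_index heap_vertex.
Proof. by move=> v; apply: heap_index_inj; rewrite heap_vertexK. Qed.

Lemma heap_index_parent i x : (heap_index x < heap_index (i :: x))%N.
Proof. by rewrite /= ltnS (leq_trans _ (leq_addr _ _)) // leq_pmull. Qed.

Definition heap_cyl n (s : config b) : set (configs b) :=
  [set t : config b | forall v, (heap_index v < n)%N -> t v = s v].

Lemma measurable_coord (v : vertex b) a :
  measurable ([set t : config b | t v = a] : set (configs b)).
Proof. by apply: sub_sigma_algebra; exists v, a. Qed.

Lemma measurable_heap_cyl n s : measurable (heap_cyl n s).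
Proof.
have -> : heap_cyl n s =
    \bigcap_(j in [set j | (j < n)%N])
      ([set t : config b | t (heap_vertex j) = s (heap_vertex j)] : set (configs b)).
  apply/seteqP; split=> t H => [j jn|v vn]; first by apply: H; rewrite heap_vertexK.
  by rewrite -(heap_indexK v); apply: H.
by apply: bigcap_measurableType => j _; exact: measurable_coord.
Qed.

Variables (p0 : bool -> R) (p : bool -> bool -> R).
Hypotheses (p0_gt0 : forall a, 0 < p0 a) (p_gt0 : forall a c, 0 < p a c).
Hypotheses (p0_sum1 : \sum_a p0 a = 1) (p_sum1 : forall a, \sum_c p a c = 1).

Definition site_prob (s : config b) (v : vertex b) : R :=
  if v is i :: x then p (s x) (s v) else p0 (s v).

Definition heap_prob n (s : config b) : R := \prod_(j < n) site_prob s (heap_vertex j).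

Lemma site_prob_ext s s' v : s v = s' v -> s (behead v) = s' (behead v) ->
  site_prob s v = site_prob s' v.
Proof. by case: v => [|i x] /= -> // ->. Qed.

Lemma heap_index_behead v : (heap_index (behead v) <= heap_index v)%N.
Proof. by case: v => // i x; exact: ltnW (heap_index_parent i x). Qed.

Lemma heap_prob_gt0 n s : 0 < heap_prob n s.
Proof. by apply: prodr_gt0 => j _; rewrite /site_prob; case: (heap_vertex j). Qed.

Lemma heap_prob_ext n s s' :
  (forall v, (heap_index v < n)%N -> s v = s' v) -> heap_prob n s = heap_prob n s'.
Proof.
move=> E; apply: eq_bigr => j _; apply: site_prob_ext; apply: E.
  by rewrite heap_vertexK.
by rewrite (leq_ltn_trans (heap_index_behead _)) // heap_vertexK.
Qed.

Lemma heap_prob_split n (s : nat -> bool) :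
  heap_prob n (s \o heap_index) =
  \sum_(a : bool) heap_prob n.+1 ((fun j => if (j < n)%N then s j else a) \o heap_index).
Proof.
transitivity (\sum_(a : bool) heap_prob n (s \o heap_index) *
    (if heap_vertex n is i :: x then p (s (heap_index x)) a else p0 a)).
  by rewrite -mulr_sumr; case: (heap_vertex n) => [|i x];
    rewrite ?p0_sum1 ?p_sum1 mulr1.
apply: eq_bigr => a _; rewrite [in RHS]/heap_prob big_ord_recr /=; congr (_ * _).
  by apply: heap_prob_ext => v vn /=; rewrite vn.
have := heap_vertexK n; case: (heap_vertex n) => [|i x] vn.
  by rewrite /= -vn ltnn.
have := heap_index_parent i x; rewrite vn => xn.
by rewrite /site_prob [in RHS]/comp vn ltnn xn.
Qed.

Lemma tree_measure : exists P : probability (configs b) R,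
  forall n s, P (heap_cyl n s) = (heap_prob n s)%:E.
Proof.
have [|s|n s|n s|X [mX XE]] := @binary_coding R (fun n s => heap_prob n (s \o heap_index)).
- by move=> n s s' E; apply: heap_prob_ext => v vn /=; exact: E.
- by rewrite /heap_prob big_ord0.
- exact/ltW/heap_prob_gt0.
- exact: heap_prob_split.
pose Y : measurableTypeR R -> configs b := fun x v => X (heap_index v) x.
have mY : measurable_fun setT Y.
  apply: (@measurability _ _ _ _ setT Y (cylinders setT)) => // _ [_ [v [a [_ ->]] <-]].
  rewrite setTI; have := mX (heap_index v); case: a => mv; first exact: mv.
  rewrite (_ : _ @^-1` _ = ~` [set x | X (heap_index v) x]); first exact: measurableC.
  by apply/seteqP; split=> x /=; rewrite /Y; [move=> ->|move=> /negP/negbTE].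
pose YF : {mfun measurableTypeR R >-> configs b} :=
  HB.pack Y (isMeasurableFun.Build _ _ _ _ Y mY).
have m01 : measurable (`[0, 1[%classic : set (measurableTypeR R)) by exact: measurable_itv.
have m1 : mrestr lebesgue_measure m01 setT = 1%E.
  by rewrite /mrestr setTI lebesgue_measure_itv /= lte_fin ltr01 oppr0 adde0.
pose P0 : probability (measurableTypeR R) R :=
  HB.pack (mrestr lebesgue_measure m01)
    (Measure_isProbability.Build _ _ _ (mrestr lebesgue_measure m01) m1).
exists (distribution P0 YF) => n s.
transitivity (lebesgue_measure
    [set x : R | 0 <= x < 1 /\ forall j, (j < n)%N -> X j x = (s \o heap_vertex) j]).
  rewrite /= /distribution /pushforward /= /mrestr; congr (lebesgue_measure _).
  apply/seteqP; split=> x /=; rewrite in_itv /=.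
    by move=> [H x01]; split=> // j jn; rewrite -H ?heap_vertexK // /Y heap_vertexK.
  by move=> [x01 H]; split=> // v vn; rewrite /Y H //= heap_indexK.
by rewrite XE; congr _%:E; apply: heap_prob_ext => v _ /=; rewrite heap_indexK.
Qed.

End TreeMeasure.

Section GluingMeasurable.

Variables (b : nat) (A : {fset vertex b}).

Lemma glue_ext (xi : {ffun A -> bool}) s s' v :
  (v \notin A -> s v = s' v) -> Defs.glue xi s v = Defs.glue xi s' v.
Proof.
by case: (boolP (v \in A)) => vA E; [rewrite !glue_in|rewrite !glue_notin ?E].
Qed.

Lemma glue_glue (xi xi' : {ffun A -> bool}) s :
  Defs.glue xi (Defs.glue xi' s) = Defs.glue xi s.
Proof.
by apply/funext => v; apply: glue_ext => vA; rewrite glue_notin.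
Qed.

Definition spins_in (s : config b) : {ffun A -> bool} := [ffun u => s (val u)].

Lemma glue_id s : Defs.glue (spins_in s) s = s.
Proof.
apply/funext => v; case: (boolP (v \in A)) => vA; last exact: glue_notin.
by rewrite glue_in ffunE.
Qed.

Lemma spins_in_glue (xi : {ffun A -> bool}) s : spins_in (Defs.glue xi s) = xi.
Proof. by apply/ffunP => -[v vA]; rewrite ffunE glue_in; congr (xi _); exact: val_inj. Qed.

Lemma measurable_glue (xi : {ffun A -> bool}) :
  measurable_fun setT (Defs.glue xi : configs b -> configs b).
Proof.
apply: (@measurability _ _ (configs b) (configs b) setT _ (cylinders setT)) => // _ [_ [v [a [_
  ->]]] <-].
rewrite setTI; case: (boolP (v \in A)) => vA.
  rewrite (_ : _ @^-1` _ = if xi [` vA]%fset == a then setT else set0).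
    by case: ifP.
  by apply/seteqP; split=> s /=; rewrite glue_in; case: eqP.
rewrite (_ : _ @^-1` _ = [set t : config b | t v = a]).
  exact: (measurable_coord v a).
by apply/seteqP; split=> s /=; rewrite glue_notin.
Qed.

(** The sets invariant under gluing form a sigma-algebra that contains the generating cylinders. *)
Lemma off_glue (xi : {ffun A -> bool}) (G : set (config b)) :
  <<s cylinders (~` [set` A]) >> G -> Defs.glue xi @^-1` G = G.
Proof.
apply: (@smallest_sub _ _ _ [set G | Defs.glue xi @^-1` G = G]).
- split=> /=.
  + by rewrite preimage_set0.
  + by move=> X /= XE; rewrite setTD preimage_setC; congr (~` _).
  + by move=> F FE; rewrite preimage_bigcup; apply: eq_bigcupr => i _; exact: FE.
- move=> _ [v [a [vA ->]]] /=; apply/seteqP; split=> s /=;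
    by rewrite glue_notin //; apply/negP.
Qed.

Lemma off_measurable (G : set (config b)) :
  <<s cylinders (~` [set` A]) >> G -> measurable (G : set (configs b)).
Proof.
apply: sub_sigma_algebra2 => _ [v [a [_ ->]]]; by exists v, a.
Qed.

End GluingMeasurable.

(** * From densities on cylinders to the DLR equation *)

Section QuasiInvariance.

Variables (R : realType) (b : nat).
Hypothesis b_gt0 : (0 < b)%N.
Variables (p0 : bool -> R) (p : bool -> bool -> R).
Hypotheses (p0_gt0 : forall a, 0 < p0 a) (p_gt0 : forall a c, 0 < p a c).
Variables (P : probability (configs b) R).
Hypothesis P_cyl : forall n s, P (heap_cyl n s) = (heap_prob b_gt0 p0 p n s)%:E.
Variables (A : {fset vertex b}) (n : nat).
Hypothesis A_lt : forall v, v \in A -> (heap_index v < n)%N.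
Hypothesis childA_lt : forall i x, x \in A -> (heap_index (i :: x) < n)%N.

Let prob := heap_prob b_gt0 p0 p.

(** Only cylinders of length at least [n] occur, since the densities are compared with the first [n]
    spins fixed. The empty set closes the family under intersection; the full set gives the
    exhaustion in [measure_unique]. *)
Let cyls : set (set (configs b)) := [set E | E = set0 \/ E = setT \/
  exists k s, (n <= k)%N /\ E = heap_cyl k s].

Let cyls_setI : setI_closed cyls.
Proof.
move=> E F [->|[->|[k [s [nk ->]]]]]; rewrite ?set0I ?setTI //; first by left.
move=> [->|[->|[l [t [nl ->]]]]]; rewrite ?setI0 ?setIT; first by left.
  by right; right; exists k, s.
have [kl|lk] := leqP k l.
- have [->|/set0P[u [us ut]]] := eqVneq (heap_cyl k s `&` heap_cyl l t) set0; first by left.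
  right; right; exists l, u; split=> //; apply/seteqP; split=> w.
    by move=> [_ wt] v vl; rewrite wt // ut.
  move=> wu; split=> v vk; first by rewrite wu ?us // (leq_trans vk).
  by rewrite wu // ut.
- have [->|/set0P[u [us ut]]] := eqVneq (heap_cyl k s `&` heap_cyl l t) set0; first by left.
  right; right; exists k, u; split=> //; apply/seteqP; split=> w.
    by move=> [ws _] v vl; rewrite ws // us.
  move=> wu; split=> v vk; first by rewrite wu ?us.
  by rewrite wu ?ut // (ltn_trans vk).
Qed.

Let word_config k (w : k.-tuple bool) : config b := fun v => nth false w (heap_index v).

Let cyls_gen : @measurable _ (configs b) = <<s cyls >>.
Proof.
apply/seteqP; split.
  apply: smallest_sub; first exact: smallest_sigma_algebra.
  move=> _ [v [a [_ ->]]].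
  pose k := maxn n (heap_index v).+1.
  have -> : [set t : config b | t v = a] =
      \bigcup_(w in [set w : k.-tuple bool | word_config w v = a])
        heap_cyl k (word_config w).
    apply/seteqP; split=> t /=.
      move=> tv; exists [tuple of mkseq (fun j => t (heap_vertex b_gt0 j)) k] => /=.
        by rewrite /word_config nth_mkseq ?heap_indexK // leq_maxr.
      by move=> u uk; rewrite /word_config nth_mkseq // heap_indexK.
    by move=> [w <- H]; apply: H; rewrite leq_maxr.
  apply: (@fin_bigcup_measurable _ (g_sigma_algebraType cyls)) => [|w _].
    exact: finite_finset.
  apply: sub_sigma_algebra; right; right; exists k, (word_config w).
  by rewrite leq_maxl.
apply: smallest_sub; first exact: sigma_algebra_measurable.
by move=> E [->|[->|[k [s [_ ->]]]]] //; exact: measurable_heap_cyl.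
Qed.

(** Vertices numbered at least [n] are neither in [A] nor children of [A], so gluing leaves their
    factors unchanged. *)
Lemma heap_prob_glue (xi : {ffun A -> bool}) k s w : (n <= k)%N ->
  (forall v, (heap_index v < n)%N -> s v = w v) ->
  prob k (Defs.glue xi s) * prob n w = prob k s * prob n (Defs.glue xi w).
Proof.
move=> nk sw; rewrite -(subnKC nk) /prob /heap_prob !big_split_ord /=.
have E1 : heap_prob b_gt0 p0 p n (Defs.glue xi s) = heap_prob b_gt0 p0 p n (Defs.glue xi w).
  by apply: heap_prob_ext => v vn; apply: glue_ext => _; exact: sw.
have E2 : heap_prob b_gt0 p0 p n s = heap_prob b_gt0 p0 p n w by exact: heap_prob_ext.
rewrite /heap_prob in E1 E2; rewrite E1 E2 [LHS]mulrAC [RHS]mulrAC.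
congr (_ * _); first exact: mulrC.
apply: eq_bigr => j _; set v := heap_vertex _ _.
have nv : (n <= heap_index v)%N by rewrite heap_vertexK leq_addr.
apply: site_prob_ext; apply: glue_notin; apply/negP.
  by move=> /A_lt; rewrite ltnNge nv.
case: v nv => [|i x] /= nv; first by move=> /A_lt; rewrite ltnNge nv.
by move=> /(childA_lt i) /=; rewrite ltnNge nv.
Qed.

(** Both sides are finite measures in [E], and they agree on long cylinders by [heap_prob_glue]. *)
Lemma quasi_invariance (xi : {ffun A -> bool}) (w : config b) (E : set (configs b)) :
  measurable E ->
  ((prob n w)%:E * P (heap_cyl n (Defs.glue xi w) `&` E) =
   (prob n (Defs.glue xi w))%:E * P (heap_cyl n w `&` Defs.glue xi @^-1` E))%E.
Proof.
set w' := Defs.glue xi w.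
have pw : 0 <= prob n w by exact/ltW/heap_prob_gt0.
have pw' : 0 <= prob n w' by exact/ltW/heap_prob_gt0.
have mw := measurable_heap_cyl b_gt0 n w.
have mw' := measurable_heap_cyl b_gt0 n w'.
pose g : configs b -> configs b := Defs.glue xi.
pose m1 : {measure set (configs b) -> \bar R} := mscale (NngNum pw) (mrestr P mw').
have [m2 m2E] : exists m : {measure set (configs b) -> \bar R}, forall F,
    m F = ((prob n w')%:E * P (Defs.glue xi @^-1` F `&` heap_cyl n w))%E.
  unshelve eexists (mscale (NngNum pw') (pushforward (mrestr P mw) g)) => //.
  exact: measurable_glue.
have m1E F : m1 F = ((prob n w)%:E * P (F `&` heap_cyl n w'))%E by [].
have cyl_eq k s : (n <= k)%N -> m1 (heap_cyl k s) = m2 (heap_cyl k s).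
  move=> nk; rewrite m1E m2E.
  have [sw|/existsNP[v /not_implyP[vn sv]]] :=
      pselect (forall v, (heap_index v < n)%N -> s v = w' v).
    pose s' : config b := fun v => if (heap_index v < n)%N then w v else s v.
    have -> : heap_cyl k s `&` heap_cyl n w' = heap_cyl k s.
      by apply/setIidl => t ts v vn; rewrite ts ?sw // (leq_trans vn).
    have -> : Defs.glue xi @^-1` heap_cyl k s `&` heap_cyl n w = heap_cyl k s'.
      apply/seteqP; split=> t /=.
        move=> [ts tw] v vk; rewrite /s'; case: ifPn => vn; first exact: tw.
        by rewrite -ts // glue_notin //; apply: contra vn => /A_lt.
      move=> ts; split=> v vn; last by rewrite ts ?(leq_trans vn) // /s' vn.
      case: (ltnP (heap_index v) n) => vn'.
        by rewrite sw //; apply: glue_ext => _; rewrite ts // /s' vn'.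
      rewrite glue_notin; last by apply: contraL vn' => /A_lt; rewrite -ltnNge.
      by rewrite ts // /s' ltnNge vn'.
    rewrite !P_cyl -!EFinM; congr _%:E.
    have HE := @heap_prob_glue xi k s' w nk.
    rewrite mulrC [RHS]mulrC -HE; last by move=> v vn; rewrite /s' vn.
    congr (_ * _); apply: heap_prob_ext => v vk.
    case: (ltnP (heap_index v) n) => vn'.
      by rewrite sw //; apply: glue_ext => _; rewrite /s' vn'.
    rewrite glue_notin; last by apply: contraL vn' => /A_lt; rewrite -ltnNge.
    by rewrite /s' ltnNge vn'.
  have -> : heap_cyl k s `&` heap_cyl n w' = set0.
    apply/seteqP; split=> // t [ts tw]; apply: sv.
    by rewrite -tw // ts // (leq_trans vn).
  have -> : Defs.glue xi @^-1` heap_cyl k s `&` heap_cyl n w = set0.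
    apply/seteqP; split=> // t [ts tw]; apply: sv.
    by rewrite -ts ?(leq_trans vn) //; apply: glue_ext => _; exact: tw.
  by rewrite !measure0 !mule0.
have eqm F : cyls F -> m1 F = m2 F.
  move=> [->|[->|[k [s [nk ->]]]]]; [by rewrite !measure0| |exact: cyl_eq].
  rewrite m1E m2E preimage_setT !setTI !P_cyl -!EFinM; congr _%:E; exact: mulrC.
have cover : \bigcup_(k : nat) [set: configs b] = setT by rewrite bigcup_const //; exists 0%N.
have fin (_ : nat) : (m1 setT < +oo)%E by rewrite m1E setTI P_cyl -EFinM; exact: ltry.
have cT (_ : nat) : cyls setT by right; left.
move=> mE; have := measure_unique cyls (fun=> setT) cyls_gen cyls_setI cT cover m1 m2 eqm fin E mE.
by rewrite m1E m2E ![heap_cyl _ _ `&` _]setIC.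
Qed.

End QuasiInvariance.

Section DLR.

Variables (R : realType) (b : nat).
Hypothesis b_gt0 : (0 < b)%N.
Variables (p0 : bool -> R) (p : bool -> bool -> R).
Hypotheses (p0_gt0 : forall a, 0 < p0 a) (p_gt0 : forall a c, 0 < p a c).
Variables (P : probability (configs b) R).
Hypothesis P_cyl : forall n s, P (heap_cyl n s) = (heap_prob b_gt0 p0 p n s)%:E.
Variables (A : {fset vertex b}) (n : nat).
Hypothesis A_lt : forall v, v \in A -> (heap_index v < n)%N.
Hypothesis childA_lt : forall i x, x \in A -> (heap_index (i :: x) < n)%N.
Variable W : config b -> R.
Hypothesis W_gt0 : forall s, 0 < W s.
Hypothesis W_ext : forall s s',
  (forall v, (heap_index v < n)%N -> s v = s' v) -> W s = W s'.

Let prob := heap_prob b_gt0 p0 p n.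

Hypothesis W_prob : forall (xi : {ffun A -> bool}) s,
  prob (Defs.glue xi s) * W s = prob s * W (Defs.glue xi s).

Let word := n.-tuple bool.
Let wconf (w : word) : config b := fun v => nth false w (heap_index v).
Let cword (s : config b) : word := [tuple of mkseq (fun j => s (heap_vertex b_gt0 j)) n].

Let wconfE s v : (heap_index v < n)%N -> wconf (cword s) v = s v.
Proof. by move=> vn; rewrite /wconf nth_mkseq // heap_indexK. Qed.

Let wconfK w : cword (wconf w) = w.
Proof.
apply/val_inj/(@eq_from_nth _ false); first by rewrite /= size_mkseq size_tuple.
move=> j; rewrite size_mkseq => jn.
by rewrite /= nth_mkseq // /wconf heap_vertexK.
Qed.

Let cylP s w : heap_cyl n (wconf w) s <-> w = cword s.
Proof.
split=> [H|-> v vn]; last by rewrite wconfE.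
rewrite -(wconfK w); apply/val_inj/eq_in_map => j; rewrite mem_iota => /andP[_ jn].
by rewrite H ?heap_vertexK.
Qed.

Let wglue (xi : {ffun A -> bool}) (w : word) : word := cword (Defs.glue xi (wconf w)).

Let wglueE xi w : wconf (wglue xi w) = Defs.glue xi (wconf w).
Proof.
apply/funext => v; have [vn|vn] := ltnP (heap_index v) n; first exact: wconfE.
rewrite glue_notin; last by apply: contraL vn => /A_lt; rewrite -ltnNge.
by rewrite /wconf !nth_default // size_tuple.
Qed.

Let Z s := \sum_(xi : {ffun A -> bool}) W (Defs.glue xi s).

Let Z_gt0 s : 0 < Z s.
Proof.
rewrite /Z (bigD1 (spins_in A s)) //= ltr_pwDl // sumr_ge0 // => xi _; exact/ltW.
Qed.

Let kap (q : word * {ffun A -> bool}) : R := W (Defs.glue q.2 (wconf q.1)) / Z (wconf q.1).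

Let kap_ge0 q : 0 <= kap q.
Proof. by rewrite divr_ge0 // ltW. Qed.

Let piece (F : set (configs b)) (q : word * {ffun A -> bool}) : set (configs b) :=
  heap_cyl n (wconf q.1) `&` Defs.glue q.2 @^-1` F.

(** With the first [n] spins fixed, the weights are constants; the kernel is thus a finite
    combination of indicators, and its integral a finite sum. *)
Lemma kernel_pieces (F : set (configs b)) s :
  (\sum_(xi : {ffun A -> bool}) W (Defs.glue xi s) * \1_F (Defs.glue xi s)) / Z s =
  \sum_q kap q * \1_(piece F q) s.
Proof.
rewrite mulr_suml -(pair_bigA _ (fun w xi => kap (w, xi) * \1_(piece F (w, xi)) s)) /=.
rewrite (bigD1 (cword s)) //= [X in _ = _ + X]big1 ?addr0 => [|w ws].
  apply: eq_bigr => xi _; rewrite /kap /piece /=.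
  have E xi' : W (Defs.glue xi' (wconf (cword s))) = W (Defs.glue xi' s).
    by apply: W_ext => v vn; apply: glue_ext => _; exact: wconfE.
  rewrite E [Z (wconf _)](eq_bigr (fun xi => W (Defs.glue xi s))) -/(Z s) => [|xi' _];
    last exact: E.
  rewrite mulrAC; congr (_ * _); rewrite !indicE; congr (_%:R); congr nat_of_bool.
  apply/idP/idP; rewrite !inE /=; last by case.
  by move=> Fs; split=> //; apply/cylP.
apply: big1 => xi _; rewrite indicE memNset ?mulr0 // => -[/cylP] /= E _.
by rewrite E eqxx in ws.
Qed.

Let measurable_piece F q : measurable F -> measurable (piece F q).
Proof.
move=> mF; apply: measurableI; first exact: measurable_heap_cyl.
by rewrite -[X in measurable X]setTI; exact: measurable_glue.
Qed.

Let pr E := fine (P E).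

Let prE E : measurable E -> P E = (pr E)%:E.
Proof. by move=> mE; rewrite fineK // fin_num_measure. Qed.

Lemma integral_kernel (F G : set (configs b)) : measurable F -> measurable G ->
  (\int[P]_(s in G) ((\sum_(xi : {ffun A -> bool})
      W (Defs.glue xi s) * \1_F (Defs.glue xi s)) / Z s)%:E)%E =
  (\sum_q kap q * pr (piece F q `&` G))%:E.
Proof.
move=> mF mG; under eq_integral do rewrite kernel_pieces -sumEFin.
rewrite ge0_integral_sum //; last first.
- by move=> q s _; rewrite lee_fin mulr_ge0.
- move=> q; apply/measurable_EFinP/measurable_funM => //.
  by apply: measurable_indic; exact: measurable_piece.
rewrite -sumEFin; apply: eq_bigr => q _.
under eq_integral do rewrite EFinM.
rewrite ge0_integralZl_EFin //; last first.
  by apply/measurable_EFinP/measurable_indic; exact: measurable_piece.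
rewrite integral_indic //; last exact: measurable_piece.
rewrite [RHS]EFinM; congr (mule _ _); apply: prE; apply: measurableI => //; exact: measurable_piece.
Qed.

Let pr_words E : measurable E -> pr E = \sum_w pr (heap_cyl n (wconf w) `&` E).
Proof.
move=> mE; apply: EFin_inj; rewrite -sumEFin -prE //.
have mw w : measurable (heap_cyl n (wconf w) `&` E).
  by apply: measurableI => //; exact: measurable_heap_cyl.
rewrite (eq_bigr (fun w => P (heap_cyl n (wconf w) `&` E))) => [|w _]; last by rewrite prE.
rewrite (fsbig_seq _ _ (index_enum_uniq _)) -measure_fin_bigcup //.
- congr (P _); apply/seteqP; split=> s => [Es|[w _ []//]].
  by exists (cword s); [exact: mem_index_enum|split=> //; apply/cylP].
- by apply/trivIsetP => w w' _ _; apply: contraNeq => /set0P[s [[/cylP-> _] [/cylP-> _]]].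
Qed.

Let reindexing (q : word * {ffun A -> bool}) : word * {ffun A -> bool} :=
  (wglue q.2 q.1, spins_in A (wconf q.1)).

Let reindexingK : involutive reindexing.
Proof.
move=> [w xi]; rewrite /reindexing /=; congr (_, _).
  by rewrite /wglue -/(wglue xi w) wglueE glue_glue glue_id wconfK.
by rewrite wglueE spins_in_glue.
Qed.

(** Quasi-invariance and [W_prob] exchange the weight of the glued configuration for that of the
    original one. The involution [reindexing] swaps the configurations before and after gluing; the
    sum over [xi] then produces [Z], which cancels. *)
Lemma dlr_equation (F G : set (configs b)) : measurable F ->
  <<s cylinders (~` [set` A]) >> G ->
  P (F `&` G) = (\int[P]_(s in G) ((\sum_(xi : {ffun A -> bool})
      W (Defs.glue xi s) * \1_F (Defs.glue xi s)) / Z s)%:E)%E.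
Proof.
move=> mF GA; have mG := off_measurable GA; have mFG := measurableI _ _ mF mG.
rewrite integral_kernel // prE //; congr _%:E.
have pieceE (q : word * {ffun A -> bool}) : kap q * pr (piece F q `&` G) =
    W (wconf q.1) / Z (wconf q.1) * pr (heap_cyl n (wconf (wglue q.2 q.1)) `&` (F `&` G)).
  rewrite wglueE /kap [LHS]mulrAC [RHS]mulrAC; congr (_ / _).
  case: q => w xi /=.
  have -> : piece F (w, xi) `&` G = heap_cyl n (wconf w) `&` Defs.glue xi @^-1` (F `&` G).
    by rewrite /piece /= preimage_setI (off_glue xi GA) setIA.
  have pn0 : prob (wconf w) != 0 by rewrite gt_eqF // heap_prob_gt0.
  have := quasi_invariance p0_gt0 p_gt0 P_cyl A_lt childA_lt xi (wconf w) mFG.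
  rewrite !prE; last first.
  - by apply: measurableI => //; exact: measurable_heap_cyl.
  - exact: (measurable_piece (w, xi)).
  rewrite -!EFinM => -[E]; apply: (mulfI pn0).
  by rewrite mulrCA [RHS]mulrCA E mulrA [RHS]mulrA; congr (_ * _); rewrite mulrC -W_prob mulrC.
rewrite (eq_bigr _ (fun q _ => pieceE q)) (reindex_inj (inv_inj reindexingK)) /=.
rewrite -(pair_bigA _ (fun w xi => W (wconf (reindexing (w, xi)).1) /
  Z (wconf (reindexing (w, xi)).1) * pr (heap_cyl n (wconf (wglue (reindexing (w, xi)).2
    (reindexing (w, xi)).1)) `&` (F `&` G)))) /=.
transitivity (\sum_w pr (heap_cyl n (wconf w) `&` (F `&` G))); first exact: pr_words.
apply: eq_bigr => w _.
rewrite (eq_bigr (fun xi => W (Defs.glue xi (wconf w)) *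
    (pr (heap_cyl n (wconf w) `&` (F `&` G)) / Z (wconf w)))) => [|xi _].
  by rewrite -mulr_suml -/(Z _) mulrC divfK // gt_eqF.
have -> : wglue (spins_in A (wconf w)) (wglue xi w) = w.
  by rewrite {1}/wglue wglueE glue_glue glue_id wconfK.
rewrite wglueE mulrAC mulrA; congr (_ / _).
by apply: eq_bigr => xi' _; rewrite glue_glue.
Qed.

End DLR.

Section TreeSums.

Variables (R : realType) (b : nat).

Lemma sum_support (I : eqType) (B L : seq I) (F : I -> R) :
  uniq B -> uniq L -> {subset B <= L} -> (forall v, v \notin B -> F v = 0) ->
  \sum_(v <- L) F v = \sum_(v <- B) F v.
Proof.
move=> uB uL BL F0; rewrite (bigID (mem B)) /= [X in _ + X]big1 => [|v /F0] //.
rewrite addr0 -big_filter; apply: perm_big; apply: uniq_perm => // [|v].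
  exact: filter_uniq.
by rewrite mem_filter; case: (boolP (v \in B)) => //= /BL.
Qed.

Lemma sum_children (B : seq (vertex b)) (F : vertex b -> R) : uniq B ->
  \sum_(x <- B) \sum_(i < b | i :: x \in B) F (i :: x) =
  \sum_(v <- B | (v != [::]) && (behead v \in B)) F v.
Proof.
move=> uB.
have child x : \sum_(i < b | i :: x \in B) F (i :: x) =
    \sum_(v <- B | (v != [::]) && (behead v == x)) F v.
  rewrite big_mkcond [RHS]big_mkcond /=.
  transitivity (\sum_(i < b) \sum_(v <- B) if v == i :: x then F v else 0).
    apply: eq_bigr => i _; rewrite -big_mkcond.
    case: ifPn => ixB.
      rewrite (eq_bigr (fun=> F (i :: x))) => [|v /eqP -> //].
      rewrite -big_filter (perm_big [:: i :: x]) ?big_seq1 //.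
      apply: uniq_perm => //= [|v]; first exact: filter_uniq.
      by rewrite mem_filter inE; case: eqP => // ->.
    rewrite big1_seq // => v /andP[/eqP -> vB]; by rewrite vB in ixB.
  rewrite exchange_big; apply: eq_bigr => -[|j y] _ /=; first by rewrite big1.
  case: eqP => [->|yx]; last by rewrite big1 // => i _; case: eqP => // -[].
  rewrite (bigD1 j) //= eqxx big1 ?addr0 // => i ij.
  by case: eqP => // -[E]; rewrite E eqxx in ij.
rewrite (eq_bigr _ (fun x _ => child x)).
under eq_bigr do rewrite big_mkcond; rewrite exchange_big [RHS]big_mkcond /=.
apply: eq_bigr => v _; case: (boolP (v == [::])) => v0 /=; first by rewrite big1.
case: ifPn => vB.
  rewrite (bigD1_seq (behead v)) //= eqxx big1 ?addr0 // => x.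
  by rewrite eq_sym => /negPf ->.
rewrite big1_seq // => x /andP[_ xB]; case: eqP => // E.
by rewrite E xB in vB.
Qed.

End TreeSums.

(** * Fixed points of the recursion give Gibbs measures *)

Section BetheMeasure.

Variables (R : realType) (b : nat) (beta h z : R).
Hypothesis b_gt0 : (0 < b)%N.
Hypothesis fixed_z : bethe beta b (beta * h) z = z.

Local Notation spin := (spin R).

Definition bethe_root (a : bool) : R := expR (z * spin a) / ch z.
Definition bethe_kernel (a c : bool) : R :=
  expR ((z + beta * spin a) * spin c) / ch (z + beta * spin a).

Lemma sum_expR_spin y : \sum_(a : bool) expR (y * spin a) / ch y = 1 :> R.
Proof.
rewrite big_bool /Defs.spin /= mulr1 mulrN1 -mulrDl divff // gt_eqF //.
exact: ch_gt0.
Qed.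

Let prob := heap_prob b_gt0 bethe_root bethe_kernel.

(** The logarithm of a site probability up to an additive constant: by [ch_msgf], normalizing the
    kernel puts the field [- msgf beta z] on the parent. *)
Let exponent (v : vertex b) (s : config b) : R := z * spin (s v) +
  if v is i :: x then beta * (spin (s x) * spin (s v)) - msgf beta z * spin (s x) else 0.

Let site_prob_expR v : exists2 C : R, 0 < C &
  forall s, site_prob bethe_root bethe_kernel s v = C * expR (exponent v s).
Proof.
case: v => [|i x].
  exists (ch z)^-1 => [|s]; first by rewrite invr_gt0 ch_gt0.
  by rewrite /= /bethe_root /exponent addr0 mulrC.
set K := expR ((ln (ch (z + beta)) + ln (ch (z - beta))) / 2).
exists K^-1 => [|s]; first by rewrite invr_gt0 expR_gt0.
have -> : exponent (i :: x) s =
    (z + beta * spin (s x)) * spin (s (i :: x)) - msgf beta z * spin (s x).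
  by rewrite /exponent; ring.
by rewrite expRD expRN /= /bethe_kernel ch_msgf -/K invfM mulrCA.
Qed.

Let total n s := \sum_(j < n) exponent (heap_vertex b_gt0 j) s.

Let prob_expR n : exists C : R, forall s, prob n s = C * expR (total n s).
Proof.
elim: n => [|n [C CE]].
  by exists 1 => s; rewrite /prob /heap_prob /total !big_ord0 expR0 mulr1.
have [C' _ C'E] := site_prob_expR (heap_vertex b_gt0 n).
exists (C * C') => s.
have -> : prob n.+1 s = prob n s * site_prob bethe_root bethe_kernel s (heap_vertex b_gt0 n).
  by rewrite /prob /heap_prob big_ord_recr.
have -> : total n.+1 s = total n s + exponent (heap_vertex b_gt0 n) s.
  by rewrite /total big_ord_recr.
by rewrite C'E CE [expR (total n s + _)]expRD [RHS]mulrACA.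
Qed.

(** Each vertex of [A] has [b] children, each putting [- msgf beta z] on it; by the fixed point
    equation, what is left of [z] is the external field [beta * h]. *)
Lemma bethe_energy (A : {fset vertex b}) n (xi : {ffun A -> bool}) (s : config b) :
  (forall v, v \in (A `|` nbrs A)%fset -> (heap_index v < n)%N) ->
  total n (Defs.glue xi s) - total n s =
  energy beta h A (A `|` nbrs A)%fset (Defs.glue xi s) -
  energy beta h A (A `|` nbrs A)%fset s.
Proof.
set B := (A `|` nbrs A)%fset; set g := Defs.glue xi s => B_lt.
pose L := [seq heap_vertex b_gt0 j | j <- iota 0 n].
have LP v : (v \in L) = (heap_index v < n)%N.
  apply/mapP/idP => [[j]|vn]; first by rewrite mem_iota => /andP[_ jn] ->; rewrite heap_vertexK.
  by exists (heap_index v); rewrite ?mem_iota // heap_indexK.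
have uL : uniq L by rewrite map_inj_uniq ?iota_uniq //; exact: can_inj (heap_vertexK b_gt0).
have uB : uniq B by exact: fset_uniq.
have uA : uniq A by exact: fset_uniq.
have totalE t : total n t = \sum_(v <- L) exponent v t.
  by rewrite /total /L big_map -(big_mkord xpredT (fun j => exponent (heap_vertex b_gt0 j) t))
    /index_iota subn0.
have AB v : v \in A -> v \in B by move=> vA; rewrite inE vA.
have BL v : v \in B -> v \in L by move=> /B_lt; rewrite LP.
have childB i x : x \in A -> i :: x \in B.
  move=> xA; rewrite !inE; case: (boolP (i :: x \in A)) => //= _.
  by apply/orP; left; apply/imfset2P; exists i => //; exists x.
have parentB i x : i :: x \in A -> x \in B.
  move=> xA; rewrite !inE; case: (boolP (x \in A)) => //= _.
  by apply/orP; right; apply/imfsetP; exists (i :: x).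
pose D v : R := spin (g v) - spin (s v).
pose DD v : R := spin (g (behead v)) * spin (g v) - spin (s (behead v)) * spin (s v).
have D0 v : v \notin A -> D v = 0 by move=> vA; rewrite /D /g glue_notin // subrr.
have energyE : energy beta h A B g - energy beta h A B s =
    beta * (\sum_(v <- B | (v != [::]) && (behead v \in B)) DD v + h * \sum_(x <- A) D x).
  rewrite /energy -mulrBr; congr (_ * _).
  rewrite opprD addrACA -mulrBr -!sumrB -sum_children //; congr (_ + _).
  by apply: eq_bigr => x _; rewrite -sumrB.
(* An edge not contained in [B] has no endpoint in [A], so gluing does not change its term. *)
have edges : \sum_(v <- L | (v != [::]) && (behead v \in L)) DD v =
    \sum_(v <- B | (v != [::]) && (behead v \in B)) DD v.
  rewrite big_mkcond [RHS]big_mkcond /=.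
  transitivity (\sum_(v <- L) if [&& v != [::], behead v \in B & v \in B] then DD v else 0).
    apply: eq_big_seq => -[|i x] //= ixL.
    have -> : x \in L.
      by move: ixL; rewrite !LP; exact: (ltn_trans (heap_index_parent b_gt0 i x)).
    case: ifPn => // nB; rewrite /DD /= /g !glue_notin ?subrr //.
      by apply: contra nB => ixA; rewrite (parentB _ _ ixA) AB.
    by apply: contra nB => xA; rewrite AB // childB.
  rewrite (sum_support uB uL BL) => [|v vB].
    by apply: eq_big_seq => v vB; rewrite vB andbT.
  by rewrite (negPf vB) !andbF.
have fields : \sum_(v <- L | (v != [::]) && (behead v \in L)) D (behead v) =
    b%:R * \sum_(x <- A) D x.
  rewrite -(sum_children (fun v => D (behead v)) uL) /=.
  rewrite (sum_support uA uL) => [|v /AB/BL //|x xA]; last first.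
    by apply: big1 => i _; exact: D0.
  rewrite mulr_sumr; apply: eq_big_seq => x xA.
  rewrite (eq_bigl xpredT) => [|i]; last by rewrite BL // childB.
  by rewrite sumr_const card_ord mulr_natl.
rewrite energyE !totalE -sumrB -edges.
have sumD : \sum_(v <- L) D v = \sum_(x <- A) D x.
  by apply: sum_support => // v /AB/BL.
transitivity (z * \sum_(v <- L) D v + (beta * \sum_(v <- L | (v != [::]) && (behead v \in L)) DD v
    - msgf beta z * \sum_(v <- L | (v != [::]) && (behead v \in L)) D (behead v))).
  rewrite !mulr_sumr -sumrB [X in _ = _ + X]big_mkcond -big_split /=.
  apply: eq_big_seq => -[|i x] ixL; rewrite /exponent /=; first by rewrite /D; ring.
  have -> : x \in L.
    by move: ixL; rewrite !LP; exact: (ltn_trans (heap_index_parent b_gt0 i x)).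
  by rewrite /D /DD /=; ring.
rewrite sumD fields; have := fixed_z; rewrite /bethe => zE.
by rewrite -[X in X * _ + _]zE; ring.
Qed.

Lemma bethe_gibbs : exists2 P : probability (configs b) R, is_gibbs beta h P &
  P [set t : config b | t [::] = true] = (expR z / ch z)%:E.
Proof.
have root0 a : 0 < bethe_root a by rewrite divr_gt0 ?expR_gt0 ?ch_gt0.
have kernel0 a c : 0 < bethe_kernel a c by rewrite divr_gt0 ?expR_gt0 ?ch_gt0.
have [P PE] := tree_measure b_gt0 root0 kernel0 (sum_expR_spin z)
  (fun a => sum_expR_spin (z + beta * spin a)).
exists P => [A F G mF GA|].
  set B := (A `|` nbrs A)%fset.
  have AB v : v \in A -> v \in B by move=> vA; rewrite inE vA.
  pose n := (\max_(v <- B) heap_index v).+1.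
  have B_lt v : v \in B -> (heap_index v < n)%N.
    by move=> vB; rewrite ltnS; apply: leq_bigmax_seq.
  rewrite /gibbs_kernel; apply: (@dlr_equation _ _ b_gt0 _ _ root0 kernel0 P PE A n) => //.
  - by move=> v /AB/B_lt.
  - move=> i x xA; apply: B_lt; rewrite !inE; case: (boolP (i :: x \in A)) => //= _.
    by apply/orP; left; apply/imfset2P; exists i => //; exists x.
  - by move=> s; exact: expR_gt0.
  - move=> s s' E; rewrite /weight_inf; suff -> : energy beta h A B s = energy beta h A B s' by [].
    rewrite /energy (_ : \sum_(x <- A) spin (s x) = \sum_(x <- A) spin (s' x)); last first.
      by apply: eq_big_seq => x /AB xB; rewrite E // B_lt.
    rewrite (_ : \sum_(x <- B) _ = \sum_(x <- B) \sum_(i < b | i :: x \in B)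
      spin (s' x) * spin (s' (i :: x))) //.
    apply: eq_big_seq => x xB; apply: eq_bigr => i ixB.
    by rewrite !E // B_lt.
  - move=> xi s; have [C CE] := prob_expR n.
    have := bethe_energy xi s B_lt; rewrite -/B => /eqP; rewrite subr_eq => /eqP EE.
    have CE' t : heap_prob b_gt0 bethe_root bethe_kernel n t = C * expR (total n t) by exact: CE.
    rewrite !CE' EE /weight_inf -!mulrA -!expRD.
    by rewrite (_ : _ - _ + _ + _ = total n s + energy beta h A B (Defs.glue xi s)) //; ring.
have -> : [set t : config b | t [::] = true] = heap_cyl 1 (fun=> true).
  by apply/seteqP; split=> t /= tr => [[|i x]//|]; exact: tr.
rewrite PE /heap_prob big_ord1 /=; have := heap_vertexK b_gt0 0.
by case: (heap_vertex b_gt0 0) => //= _; rewrite /bethe_root mulr1.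
Qed.

End BetheMeasure.

(** The probability of a plus spin at the root is strictly increasing in the fixed point, so equal
    measures force equal fixed points. *)
Lemma gibbs_unique_fixed (R : realType) (b : nat) (beta h : R) : (0 < b)%N ->
  gibbs_unique b beta h -> forall z1 z2,
  bethe beta b (beta * h) z1 = z1 -> bethe beta b (beta * h) z2 = z2 -> z1 = z2.
Proof.
move=> b_gt0 [P _ uP] z1 z2 /(bethe_gibbs b_gt0)[P1 G1 E1] /(bethe_gibbs b_gt0)[P2 G2 E2].
have mr := measurable_coord ([::] : vertex b) true.
have : expR z1 / ch z1 = expR z2 / ch z2.
  by apply: EFin_inj; rewrite -E1 -E2 -(uP _ G1) // (uP _ G2).
move/eqP; rewrite eqr_div ?(gt_eqF (ch_gt0 _)) // => /eqP.
rewrite /ch !mulrDr -!expRD [z2 + z1]addrC => /addrI/expR_inj; lra.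
Qed.

Lemma beta0_lt_beta1 (R : realType) (b : nat) : (2 <= b)%N -> beta0 R b < beta1 R b.
Proof.
move=> b2; rewrite /beta0 /beta1 ltr_pM2l ?invr_gt0 //.
have b1 : 1 < b%:R :> R by rewrite ltr1n.
set s := Num.sqrt b%:R; have s2 : s * s = b%:R by rewrite -expr2 sqr_sqrtr.
have s0 : 0 <= s by exact: sqrtr_ge0.
have s1 : 1 < s by rewrite -(@ltr_pXn2r _ 2) ?nnegrE // expr1n expr2 s2.
rewrite ltr_ln ?posrE ?divr_gt0 ?subr_gt0 ?addr_gt0 //; try lra.
rewrite ltr_pdivrMr ?subr_gt0 // mulrAC ltr_pdivlMr ?subr_gt0 //; nra.
Qed.

Theorem theorem1p2 (R : realType) (b : nat) (hb : (2 <= b)%N)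
    (beta h : R) (hbeta : 0 <= beta) (tau : config b)
    (htau : (beta < beta1 R b \/ (hcrit b beta < `|h|%:E)%E)
            \/ (forall x : vertex b, tau x = true)) :
  exists C : R, 0 < C /\
    forall (r : vertex b) (m : nat), 1 / C <= csob beta h tau r m.
Proof.
have b_gt0 : (0 < b)%N by exact: leq_trans hb.
apply: csob_ge => //; case: htau => [[bb|hh]|tau_plus].
- exact: contracting_beta1.
- move: hh; rewrite /hcrit; case: (leP beta (beta0 R b)) => [b0 _|_ hh].
    (* Here [hcrit] is 0 by definition and carries no information on uniqueness, but [beta] is
       already below [beta1]. *)
    by apply: contracting_beta1 => //; exact: le_lt_trans b0 (beta0_lt_beta1 R hb).
  apply: contracting_unique => //; apply: gibbs_unique_fixed => //.
  apply: contrapT => nu; move: hh; rewrite ltNge => /negP; apply.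
  by apply: ereal_sup_ubound; exists h.
- exact: contracting_plus.
Qed.
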